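(* Fix $K>0$, $\delta_2>0$ and $0<\upsilon<K$ (with $\upsilon\ll K$), and consider the family $$\epsilon\bar x(\bar x-1)\frac{d\bar y}{d\bar x}+\bar y(1+\epsilon a^\epsilon\bar x)=\epsilon^{-1}g^\epsilon(\epsilon\bar x,\epsilon\bar y),\qquad g^\epsilon=f^\epsilon+\mu h^\epsilon ,$$ with data as in the context and $a^0>-2$. Then there is a $\mu_0>0$ such that for all $0\le \mu<\mu_0$ the limit $$S^0_\infty=\lim_{k\to\infty}\frac{(-1)^km^0_k}{\Gamma(k+a^0)}$$ (defined from the $\epsilon=0$ problem) exists, and if $$S^0_\infty\neq0$$ (so that the center manifold for $\epsilon=0$ is nonanalytic), then the following holds for all sufficiently small $\epsilon>0$ with $\epsilon^{-1}\notin\mathbb N$. Let $W^{ws}:\ \bar y=\bar m^\epsilon(\bar x)$, with $\bar m^\epsilon$ defined in a neighborhood of the origin, denote the analytic weak-stable manifold in the $(\bar x,\bar y)$-coordinates, put $N^\epsilon=\lfloor\epsilon^{-1}\rfloor$, and let $I\subset[-\delta_2\epsilon,\tfrac34]$ be an interval such that $$|\overline V^\epsilon(\bar x)|\le K\qquad\forall\,\bar x\in I .$$ Then $I\subset\operatorname{domain}(\bar m^\epsilon)$ and $$\left|\bar m^\epsilon(\bar x)-(-1)^{N^\epsilon}S^0_\infty\overline V^\epsilon(\bar x)\right|\le\upsilon\qquad\forall\,\bar x\in I .$$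
   Context: Data: $\epsilon_0,\rho,B>0$ are fixed. For $\epsilon\in[0,\epsilon_0)$, $a^\epsilon\in\mathbb R$ and $$f^\epsilon(x)=\sum_{k=2}^\infty f^\epsilon_kx^k,\qquad h^\epsilon(x,y)=\sum_{k=2}^\infty h^\epsilon_{k,1}x^ky+\sum_{k=1}^\infty\sum_{l=2}^\infty h^\epsilon_{k,l}x^ky^l$$ depend analytically on $\epsilon$, with $|f^\epsilon_k|\le B\rho^{-k}$, $|h^\epsilon_{k,l}|\le\rho^{-k-l}$ and $h^0_{k,1}=0$ for all $k,l$. $\mu\ge0$ is a parameter and $g^\epsilon=f^\epsilon+\mu h^\epsilon$; $a^\epsilon,f^\epsilon,h^\epsilon$ do not depend on $\mu$. The planar system is $\dot x=(x-\epsilon)x$, $\dot y=-y(1+a^\epsilon x)+g^\epsilon(x,y)$, and the coordinates $(\bar x,\bar y)$ are defined by $x=\epsilon\bar x$, $y=\epsilon\bar y$; eliminating time gives the equation in the claim. For $\epsilon>0$ the origin is an attracting node with eigenvalues $-\epsilon,-1$. For $\epsilon^{-1}\notin\mathbb N$ there is a unique analytic weak-stable manifold: the unique invariant manifold $y=m^\epsilon(x)=\sum_{k\ge2}m^\epsilon_kx^k$ analytic near $x=0$. In scaled coordinates $\bar m^\epsilon(\bar x)=\epsilon^{-1}m^\epsilon(\epsilon\bar x)$. $I\subset\operatorname{domain}(\bar m^\epsilon)$ means that this solution of the equation extends as a graph over $I$. For $\epsilon=0$: $\sum_{k\ge2}m^0_kx^k$ is the unique formal power series solution of $x^2\frac{dy}{dx}+y(1+a^0x)=g^0(x,y)$,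 i.e. the formal expansion of the center manifold. With $\epsilon^{-1}=N^\epsilon+\alpha^\epsilon$, $N^\epsilon=\lfloor\epsilon^{-1}\rfloor$, $\alpha^\epsilon\in(0,1)$, $$\overline V^\epsilon(\bar x):=\frac{\Gamma(\alpha^\epsilon)\Gamma(1-\alpha^\epsilon)}{\epsilon\,\Gamma(\epsilon^{-1})}\sum_{k=N^\epsilon}^\infty\frac{\Gamma(k+a^\epsilon)}{\Gamma(k+1-\epsilon^{-1})}\bar x^k,\qquad|\bar x|<1 .$$ *)

(* Defs.v *)
From Stdlib Require Export Reals Factorial.
From Coquelicot Require Export Coquelicot.

Open Scope R_scope.

(* Gauss' product formula, valid at every real number other than
   0, -1, -2, ... *)
Definition Gamma (x : R) : R :=
  real (Lim_seq (fun n =>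
    INR (fact n) * Rpower (INR n) x / prod_f_R0 (fun j => x + INR j) n)).

(* A family of power series with coefficients [F e i], [i : I] of total degree
   [deg i], depends analytically on [e] in [0, eps0): near every [e1] it is
   jointly a convergent power series in [e - e1] and the space variables.
   At [e1 = 0] only nonnegative [e] are constrained, so analyticity there
   means that the family extends analytically across 0. *)
Definition analytic_family {I : Type} (deg : I -> nat) (eps0 : R)
    (F : R -> I -> R) : Prop :=
  forall e1, 0 <= e1 < eps0 ->
  exists (r C : R) (c : I -> nat -> R),
    0 < r /\
    (forall i n, Rabs (c i n) * r ^ (deg i + n) <= C) /\
    (forall e i, 0 <= e < eps0 -> Rabs (e - e1) < r ->
       is_pseries (c i) (e - e1) (F e i)).

Definition g (f : nat -> R) (h : nat -> nat -> R) (mu x y : R) : R :=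
  PSeries f x + mu * PSeries (fun k => PSeries (h k) y) x.

Definition PS_pow (m : nat -> R) (l : nat) : nat -> R :=
  Nat.iter l (PS_mult m) (fun n => match n with O => 1 | S _ => 0 end).

(* The formal power series g(x, m(x)).  When m 0 = 0 the powers m^l with
   l > n do not contribute to the coefficient of x^n, so the sum over l
   can be cut at n. *)
Definition PS_g (f : nat -> R) (h : nat -> nat -> R) (mu : R)
    (m : nat -> R) (n : nat) : R :=
  f n + mu * sum_f_R0 (fun k =>
               sum_f_R0 (fun l => h k l * PS_pow m l (n - k)) n) n.

(* Formal solution y = sum_{k>=2} m_k x^k of
   x^2 dy/dx + y (1 + a x) = g(x, y). *)
Definition formal_center_manifold (a : R) (f : nat -> R)
    (h : nat -> nat -> R) (mu : R) (m : nat -> R) : Prop :=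
  m 0%nat = 0 /\ m 1%nat = 0 /\
  forall n, PS_incr_n (PS_derive m) 2 n + (m n + a * PS_incr_1 m n)
            = PS_g f h mu m n.

(* The graph y = sum_{k>=2} m_k x^k is analytic near x = 0 and invariant for
   x' = (x - e) x,  y' = - y (1 + a x) + g(x, y). *)
Definition weak_stable_manifold (a : R) (f : nat -> R)
    (h : nat -> nat -> R) (mu e : R) (m : nat -> R) : Prop :=
  m 0%nat = 0 /\ m 1%nat = 0 /\
  Rbar_lt 0 (CV_radius m) /\
  locally 0 (fun x : R =>
    Derive (PSeries m) x * ((x - e) * x)
    = - PSeries m x * (1 + a * x) + g f h mu x (PSeries m x)).

(* [Y] extends the germ xb |-> m(e xb) / e as a solution of the scaled equation
   over an open interval containing 0 and [I].  The solution has to stay where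
   the coefficient bounds make g(e xb, e yb) convergent. *)
Definition extends_over (rho a : R) (f : nat -> R) (h : nat -> nat -> R)
    (mu e : R) (m : nat -> R) (I : R -> Prop) (Y : R -> R) : Prop :=
  exists l r : R,
    l < 0 < r /\
    (forall x, I x -> l < x < r) /\
    locally 0 (fun x : R => Y x = / e * PSeries m (e * x)) /\
    forall x, l < x < r ->
      Rabs (e * x) < rho /\ Rabs (e * Y x) < rho /\
      ex_derive Y x /\
      e * x * (x - 1) * Derive Y x + Y x * (1 + e * a * x)
      = / e * g f h mu (e * x) (e * Y x).

Definition Neps (e : R) : nat := Z.to_nat (Int_part (/ e)).

Definition alpha (e : R) : R := / e - INR (Neps e).

Definition Vbar (a e x : R) : R :=
  Gamma (alpha e) * Gamma (1 - alpha e) / (e * Gamma (/ e)) *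
  Series (fun j => let k := (Neps e + j)%nat in
    Gamma (INR k + a) / Gamma (INR k + 1 - / e) * x ^ k).

Definition is_interval (I : R -> Prop) : Prop :=
  forall x y z, I x -> I y -> x <= z <= y -> I z.

(* Main.v *)
From Stdlib Require Import Compare_dec Wf_nat ZArith FunctionalExtensionality Lra Lia Psatz.
Require Import Defs.

(** Write [tau = 1 / rho] and [N = floor (1 / e)].  In the original variables
    the coefficients of the weak-stable manifold satisfy
      [(1 - e k) m_k + (k - 1 + a) m_(k-1) = g_k],
    where [g_k] is the coefficient of [x^k] in [g (x, m x)].  Let [W_k] be the
    absolute value of the solution of the homogeneous recursion, that is
    [W_k = Gamma (k + a) / prod_(j <= k) |1 - e j|].  By the functional
    equation of Gamma, [e Vbar (x)] is the tail [sum_(k >= N) W_k (e x)^k]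
    ([Vbar_tail]), so the theorem compares the tail of [m] with that of [W].
    Nothing but power series is used: the solution on the whole interval is the
    sum of its Taylor series at the origin.

    Up to order [N] the recursion is a summation,
      [m_k = (-1)^k W_k S_k],  [S_k - S_(k-1) = (-1)^k g_k / ((1 - e k) W_k)].
    The sequence [W] is log-convex there, its convolution square is
    dominated by its end terms ([W_conv]), and hence nonlinear terms contribute
    to [g_k] only [O(mu W_(k-2))] ([Hmaj_W]).  For small [mu] this gives
    [|m_k| <= C0 W_k] and a summable bound for the increments of [S_k], both
    uniform in [e >= 0] ([low_bound]).  For [e = 0] the limit of [S_k] is the
    [S] of the theorem, and by Tannery's theorem [S_N] tends to it as [e]
    tends to 0.

    Beyond order [N] the factor [1 - e k] is negative, the solution of the
    homogeneous recursion no longer alternates, and the recursion for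
    [d_k = m_k - (-1)^N S_N W_k] has a majorant with positive coefficients.
    The partial sums of [|d_k| x^k] are therefore subsolutions of a linear
    first-order equation on [0 < x < e], whose forcing is small wherever the
    tail of [W] is bounded by [O(e)].  The product of [e + x] with the tail of
    [W] is, up to a constant, a supersolution ([deviation_bound]), so [d]
    contributes only [O(e^2)].  The low-order part of [m] is [O(e^2)] as well,
    because the largest terms [W_k Y^k] with [k < N] are the first and the last
    ones ([low_sum]).

    For [x > 0] the bound on the tail is the hypothesis [|Vbar| <= K].  For [x]
    in [-delta2 e, 0] the tail at [|x|] is needed; it is bounded by the one at
    [x] because the tail is a hypergeometric function which stays away from 0
    whenever a resonant factor [Gamma alpha] or [Gamma (1 - alpha)] is large
    ([negative_side]). *)

(** * The Gamma function on the positive axis *)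

Lemma exp_le_mono x y : x <= y -> exp x <= exp y.
Proof. intros [H | ->]; [left; apply exp_increasing, H | lra]. Qed.

(** Gauss' approximants of [Gamma x]. *)
Definition Gseq (x : R) (n : nat) : R :=
  INR (fact n) * Rpower (INR n) x / prod_f_R0 (fun j => x + INR j) n.

Lemma prod_shift_pos x n : 0 < x -> 0 < prod_f_R0 (fun j => x + INR j) n.
Proof.
  intros Hx; induction n.
  - simpl; lra.
  - change (0 < prod_f_R0 (fun j => x + INR j) n * (x + INR (S n))).
    apply Rmult_lt_0_compat; [exact IHn | pose proof (pos_INR (S n)); lra].
Qed.

Lemma Gseq_pos x n : 0 < x -> 0 < Gseq x n.
Proof.
  intros Hx; unfold Gseq, Rdiv.
  apply Rmult_lt_0_compat; [apply Rmult_lt_0_compat|].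
  - apply INR_fact_lt_0.
  - apply exp_pos.
  - apply Rinv_0_lt_compat, prod_shift_pos, Hx.
Qed.

Lemma ln_1p_bounds t : 0 <= t -> t / (1 + t) <= ln (1 + t) <= t.
Proof.
  intros Ht. split.
  - assert (H : ln (/ (1 + t)) <= / (1 + t) - 1).
    { pose proof (exp_ineq1_le (ln (/ (1 + t)))) as H.
      rewrite exp_ln in H by (apply Rinv_0_lt_compat; lra). lra. }
    rewrite ln_Rinv in H by lra.
    replace (t / (1 + t)) with (1 - / (1 + t)) by (field; lra). lra.
  - pose proof (exp_ineq1_le (ln (1 + t))) as H. rewrite exp_ln in H by lra. lra.
Qed.

Lemma ln_Gseq_S x n : 0 < x ->
  ln (Gseq x (S (S n))) - ln (Gseq x (S n))
  = x * ln (1 + / INR (S n)) - ln (1 + x / INR (S (S n))).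
Proof.
  intros Hx.
  pose proof (prod_shift_pos x (S n) Hx) as Hp.
  pose proof (INR_fact_lt_0 (S n)) as Hf.
  assert (H1 : 0 < INR (S n)) by (apply lt_0_INR; lia).
  assert (H2 : 0 < INR (S (S n))) by (apply lt_0_INR; lia).
  assert (E : Gseq x (S (S n)) = Gseq x (S n) *
    (Rpower (1 + / INR (S n)) x * / (1 + x / INR (S (S n))))).
  { unfold Gseq.
    replace (1 + / INR (S n)) with (INR (S (S n)) * / INR (S n))
      by (rewrite (S_INR (S n)); field; lra).
    replace (INR (fact (S (S n)))) with (INR (S (S n)) * INR (fact (S n)))
      by (rewrite <- mult_INR; reflexivity).
    change (prod_f_R0 (fun j => x + INR j) (S (S n))) with
      (prod_f_R0 (fun j => x + INR j) (S n) * (x + INR (S (S n)))).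
    unfold Rpower. rewrite ln_mult, ln_Rinv by (try apply Rinv_0_lt_compat; lra).
    replace (x * (ln (INR (S (S n))) + - ln (INR (S n))))
      with (x * ln (INR (S (S n))) + - (x * ln (INR (S n)))) by ring.
    rewrite exp_plus.
    rewrite exp_Ropp. pose proof (exp_pos (x * ln (INR (S n)))).
    field. repeat split; try lra. }
  assert (Hq : 0 < x / INR (S (S n))) by (apply Rdiv_lt_0_compat; lra).
  rewrite E, ln_mult; [| apply Gseq_pos, Hx |].
  2:{ apply Rmult_lt_0_compat; [apply exp_pos | apply Rinv_0_lt_compat; lra]. }
  rewrite ln_mult, ln_Rinv; try lra; [| apply exp_pos | apply Rinv_0_lt_compat; lra].
  unfold Rpower. rewrite ln_exp. ring.
Qed.

(** Each factor [(1 + 1/n)^x / (1 + x/(n+1))] of the product is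
    [1 + O(1/n^2)], from the elementary bounds on [ln (1 + t)]. *)
Lemma ln_Gseq_step x n : 0 < x ->
  0 <= ln (Gseq x (S (S n))) - ln (Gseq x (S n))
    <= x * (1 + x) * / (INR (S n) * INR (S n)).
Proof.
  intros Hx. rewrite ln_Gseq_S by exact Hx.
  assert (H1 : 0 < INR (S n)) by (apply lt_0_INR; lia).
  assert (H2 : INR (S (S n)) = INR (S n) + 1) by (rewrite (S_INR (S n)); ring).
  rewrite H2. set (q := INR (S n)) in *.
  assert (Hi : 0 < / q) by (apply Rinv_0_lt_compat; lra).
  assert (Hx' : 0 < x / (q + 1)) by (apply Rdiv_lt_0_compat; lra).
  destruct (ln_1p_bounds (/ q)) as [A1 A2]; [lra|].
  destruct (ln_1p_bounds (x / (q + 1))) as [B1 B2]; [lra|].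
  replace (/ q / (1 + / q)) with (/ (q + 1)) in A1 by (field; lra).
  replace (x / (q + 1) / (1 + x / (q + 1))) with (x * / (q + 1 + x)) in B1
    by (field; lra).
  split.
  - assert (x * / (q + 1) <= x * ln (1 + / q)) by (apply Rmult_le_compat_l; lra).
    unfold Rdiv in B2 at 2. unfold Rdiv in *. lra.
  - assert (x * ln (1 + / q) <= x * / q) by (apply Rmult_le_compat_l; lra).
    apply Rle_trans with (x * / q - x * / (q + 1 + x)); [lra|].
    replace (x * / q - x * / (q + 1 + x)) with (x * (1 + x) * / (q * (q + 1 + x)))
      by (field; lra).
    apply Rmult_le_compat_l; [nra|]. apply Rinv_le_contravar; nra.
Qed.

Lemma Gseq_incr x n m : 0 < x -> (n <= m)%nat ->
  Gseq x (S n) <= Gseq x (S m).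
Proof.
  intros Hx H; induction H; [lra|].
  apply Rle_trans with (1 := IHle).
  apply Rnot_lt_le; intros C. apply ln_increasing in C; [| apply Gseq_pos, Hx].
  destruct (ln_Gseq_step x m Hx). lra.
Qed.

Lemma ln_Gseq_upper x n m : 0 < x -> (n <= m)%nat ->
  ln (Gseq x (S (S m))) + x * (1 + x) * / INR (S m)
  <= ln (Gseq x (S (S n))) + x * (1 + x) * / INR (S n).
Proof.
  intros Hx H; induction H; [lra|].
  apply Rle_trans with (2 := IHle).
  destruct (ln_Gseq_step x (S m) Hx) as [_ A].
  assert (H1 : 0 < INR (S m)) by (apply lt_0_INR; lia).
  assert (H2 : INR (S (S m)) = INR (S m) + 1) by (rewrite (S_INR (S m)); ring).
  rewrite H2 in *. set (q := INR (S m)) in *.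
  assert (/ ((q + 1) * (q + 1)) <= / q - / (q + 1)).
  { replace (/ q - / (q + 1)) with (/ (q * (q + 1))) by (field; lra).
    apply Rinv_le_contravar; nra. }
  assert (x * (1 + x) * / ((q + 1) * (q + 1)) <= x * (1 + x) * (/ q - / (q + 1)))
    by (apply Rmult_le_compat_l; nra).
  lra.
Qed.

Lemma Gseq_upper x n m : 0 < x -> (n <= m)%nat ->
  Gseq x (S (S m)) <= Gseq x (S (S n)) * exp (x * (1 + x) * / INR (S n)).
Proof.
  intros Hx H. pose proof (ln_Gseq_upper x n m Hx H) as A.
  assert (0 < x * (1 + x) * / INR (S m)).
  { apply Rmult_lt_0_compat; [nra|]. apply Rinv_0_lt_compat, lt_0_INR; lia. }
  rewrite <- (exp_ln (Gseq x (S (S m)))) by (apply Gseq_pos, Hx).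
  rewrite <- (exp_ln (Gseq x (S (S n)))) by (apply Gseq_pos, Hx).
  rewrite <- exp_plus. apply exp_le_mono. lra.
Qed.

Lemma Gamma_is_lim x : 0 < x -> is_lim_seq (Gseq x) (Gamma x).
Proof.
  intros Hx.
  assert (E : ex_finite_lim_seq (fun n => Gseq x (S (S n)))).
  { apply ex_finite_lim_seq_incr with (Gseq x 2 * exp (x * (1 + x) * / INR 1)).
    - intros n. apply Gseq_incr; auto with arith.
    - intros n. apply (Gseq_upper x 0 n Hx). lia. }
  destruct E as [l E].
  assert (E2 : is_lim_seq (Gseq x) l).
  { apply <- (is_lim_seq_incr_1 (Gseq x) l).
    apply <- (is_lim_seq_incr_1 (fun n => Gseq x (S n)) l). exact E. }
  unfold Gamma. change (fun n => INR (fact n) * Rpower (INR n) x / _) with (Gseq x).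
  rewrite (is_lim_seq_unique _ _ E2). exact E2.
Qed.

(** The approximants increase, and multiplied by [exp (x (1 + x) / n)] they
    decrease; this traps Gamma between continuous functions that agree to
    first order, which gives positivity and continuity at once. *)
Lemma Gamma_between x n : 0 < x ->
  Gseq x (S (S n)) <= Gamma x <=
  Gseq x (S (S n)) * exp (x * (1 + x) * / INR (S n)).
Proof.
  intros Hx. pose proof (Gamma_is_lim x Hx) as L.
  assert (L2 : is_lim_seq (fun m => Gseq x (S (S (m + n)))) (Gamma x)).
  { apply -> (is_lim_seq_incr_n (fun m => Gseq x (S (S m))) n (Gamma x)).
    apply -> (is_lim_seq_incr_1 (fun m => Gseq x (S m)) (Gamma x)).
    apply -> (is_lim_seq_incr_1 (Gseq x) (Gamma x)). exact L. }
  split.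
  - apply (is_lim_seq_le (fun _ => Gseq x (S (S n))) (fun m => Gseq x (S (S (m + n))))
             (Gseq x (S (S n))) (Gamma x)); [| apply is_lim_seq_const | exact L2].
    intros m. apply Gseq_incr; [exact Hx | lia].
  - apply (is_lim_seq_le (fun m => Gseq x (S (S (m + n)))) (fun _ => Gseq x (S (S n)) * exp (x * (1 + x) * / INR (S n)))
             (Gamma x) (Gseq x (S (S n)) * exp (x * (1 + x) * / INR (S n)))); [| exact L2 | apply is_lim_seq_const].
    intros m. apply Gseq_upper; [exact Hx | lia].
Qed.

Lemma Gamma_pos x : 0 < x -> 0 < Gamma x.
Proof.
  intros Hx. destruct (Gamma_between x 0 Hx) as [A _].
  pose proof (Gseq_pos x 2 Hx). lra.
Qed.

Lemma prod_shift_S x n :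
  prod_f_R0 (fun j => x + INR j) (S n)
  = x * prod_f_R0 (fun j => x + 1 + INR j) n.
Proof.
  induction n.
  - simpl. ring.
  - change (prod_f_R0 (fun j => x + INR j) (S n) * (x + INR (S (S n))) =
      x * (prod_f_R0 (fun j => x + 1 + INR j) n * (x + 1 + INR (S n)))).
    rewrite IHn, (S_INR (S n)). ring.
Qed.

Lemma Gamma_S x : 0 < x -> Gamma (x + 1) = x * Gamma x.
Proof.
  intros Hx.
  assert (Hx1 : 0 < x + 1) by lra.
  pose proof (Gamma_is_lim x Hx) as L.
  pose proof (Gamma_is_lim (x + 1) Hx1) as L1.
  assert (L2 : is_lim_seq (fun n => Gseq (x + 1) (S n) *
                (1 + x * / INR (S n) + / INR (S n))) (Gamma (x + 1) * (1 + x * 0 + 0))).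
  { assert (Li : is_lim_seq (fun n => / INR (S n)) 0).
    { apply -> (is_lim_seq_incr_1 (fun n => / INR n) 0).
      replace (Finite 0) with (Rbar_inv p_infty) by reflexivity.
      apply is_lim_seq_inv; [apply is_lim_seq_INR | discriminate]. }
    apply is_lim_seq_mult'.
    - apply is_lim_seq_incr_1 in L1. exact L1.
    - apply is_lim_seq_plus'; [|exact Li].
      apply is_lim_seq_plus'; [apply is_lim_seq_const|].
      apply is_lim_seq_mult'; [apply is_lim_seq_const | exact Li]. }
  assert (L3 : is_lim_seq (fun n => x * Gseq x (S n)) (x * Gamma x)).
  { apply is_lim_seq_mult'; [apply is_lim_seq_const|].
    apply is_lim_seq_incr_1 in L. exact L. }
  assert (E : forall n, x * Gseq x (S n) = Gseq (x + 1) (S n) *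
                (1 + x * / INR (S n) + / INR (S n))).
  { intros n. unfold Gseq. rewrite (prod_shift_S x n).
    change (prod_f_R0 (fun j => x + 1 + INR j) (S n)) with
      (prod_f_R0 (fun j => x + 1 + INR j) n * (x + 1 + INR (S n))).
    pose proof (prod_shift_pos (x + 1) n Hx1).
    assert (H1 : 0 < INR (S n)) by (apply lt_0_INR; lia).
    rewrite Rpower_plus, (Rpower_1 _ H1). field. repeat split; lra. }
  apply (is_lim_seq_ext _ _ _ E) in L3.
  apply is_lim_seq_unique in L2. apply is_lim_seq_unique in L3.
  rewrite L2 in L3. injection L3; lra.
Qed.

Lemma Gseq_continuous n x : 0 < x -> continuous (fun y => Gseq y (S n)) x.
Proof.
  intros Hx. unfold Gseq.
  assert (Hp : forall k, continuous (fun y => prod_f_R0 (fun j => y + INR j) k) x).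
  { induction k.
    - apply (continuous_plus (fun y => y) (fun _ => 0)); [apply continuous_id | apply continuous_const].
    - apply (continuous_mult (fun y => prod_f_R0 (fun j => y + INR j) k) (fun y => y + INR (S k))); [exact IHk|].
      apply (continuous_plus (fun y => y) (fun _ => INR (S k))); [apply continuous_id | apply continuous_const]. }
  unfold Rdiv.
  apply (continuous_mult (fun y => INR (fact (S n)) * Rpower (INR (S n)) y)
           (fun y => / prod_f_R0 (fun j => y + INR j) (S n))).
  - apply (continuous_mult (fun _ => INR (fact (S n))) (fun y => Rpower (INR (S n)) y)); [apply continuous_const|].
    unfold Rpower. apply continuous_comp.
    + apply (continuous_mult (fun y => y) (fun _ => ln (INR (S n)))); [apply continuous_id | apply continuous_const].
    + apply continuous_exp.
  - apply continuous_comp; [apply Hp|]. apply continuous_Rinv.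
    pose proof (prod_shift_pos x (S n) Hx). lra.
Qed.

Lemma Gamma_continuous x : 0 < x -> continuous Gamma x.
Proof.
  intros Hx. apply continuity_pt_filterlim. intros eps Heps.
  set (M := (x + 1) * (1 + (x + 1))).
  assert (HM : 0 < M) by (unfold M; nra).
  (* relative error [exp (M / n) - 1] of the n-th approximant near x *)
  set (L := Gamma x + 1).
  assert (HG : 0 < Gamma x) by (apply Gamma_pos, Hx).
  assert (Hn : exists n : nat, exp (M * / INR (S n)) - 1 < Rmin 1 (eps / (4 * L))).
  { assert (Hl : is_lim_seq (fun n => exp (M * / INR (S n))) (exp (M * 0))).
    { apply is_lim_seq_continuous; [apply derivable_continuous_pt, derivable_pt_exp|].
      apply is_lim_seq_mult'; [apply is_lim_seq_const|].
      apply -> (is_lim_seq_incr_1 (fun n => / INR n) 0).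
      replace (Finite 0) with (Rbar_inv p_infty) by reflexivity.
      apply is_lim_seq_inv; [apply is_lim_seq_INR | discriminate]. }
    rewrite Rmult_0_r, exp_0 in Hl.
    assert (Hd : 0 < Rmin 1 (eps / (4 * L))).
    { apply Rmin_pos; [lra|]. apply Rdiv_lt_0_compat; unfold L; lra. }
    apply is_lim_seq_spec in Hl. destruct (Hl (mkposreal _ Hd)) as [n0 H0].
    exists n0. specialize (H0 n0 (le_n _)).
    change (Rabs (exp (M * / INR (S n0)) - 1) < Rmin 1 (eps / (4 * L))) in H0.
    apply Rabs_def2 in H0. lra. }
  destruct Hn as [n Hn].
  pose proof (Rmin_l 1 (eps / (4 * L))) as Hm1.
  pose proof (Rmin_r 1 (eps / (4 * L))) as Hm2.
  set (t := exp (M * / INR (S n)) - 1) in *.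
  assert (Hq : 0 < / INR (S n)) by (apply Rinv_0_lt_compat, lt_0_INR; lia).
  assert (Hc := Gseq_continuous (S n) x Hx).
  apply continuity_pt_filterlim in Hc.
  destruct (Hc (Rmin 1 (eps / 4))) as [d [Hd Hc']]; [apply Rmin_pos; lra|].
  exists (Rmin d (Rmin 1 (x / 2))). split.
  { apply Rmin_pos; [exact Hd | apply Rmin_pos; lra]. }
  intros y [_ Hy]. simpl in Hy. unfold Rdist in *. simpl. unfold Rdist.
  pose proof (Rmin_l d (Rmin 1 (x / 2))). pose proof (Rmin_r d (Rmin 1 (x / 2))).
  pose proof (Rmin_l 1 (x / 2)). pose proof (Rmin_r 1 (x / 2)).
  assert (Hyx : Rabs (y - x) < x / 2) by lra. apply Rabs_def2 in Hyx.
  assert (Hyx1 : Rabs (y - x) < 1) by lra. apply Rabs_def2 in Hyx1.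
  assert (Hy0 : 0 < y) by lra.
  assert (Hb : forall z, 0 < z -> z <= x + 1 ->
     Gseq z (S (S n)) <= Gamma z <= Gseq z (S (S n)) * (1 + t)).
  { intros z Hz Hz1. destruct (Gamma_between z n Hz) as [A1 A2]. split; [exact A1|].
    apply Rle_trans with (1 := A2). apply Rmult_le_compat_l; [left; apply Gseq_pos, Hz|].
    unfold t. replace (1 + (exp (M * / INR (S n)) - 1)) with (exp (M * / INR (S n))) by ring.
    apply exp_le_mono. apply Rmult_le_compat_r; [lra|]. unfold M. nra. }
  destruct (Hb x Hx ltac:(lra)) as [X1 X2]. destruct (Hb y Hy0 ltac:(lra)) as [Y1 Y2].
  assert (Ht : 0 < t) by (unfold t; pose proof (exp_ineq1 (M * / INR (S n)));
    assert (0 < M * / INR (S n)) by (apply Rmult_lt_0_compat; lra); lra).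
  assert (Hcl : Rabs (Gseq y (S (S n)) - Gseq x (S (S n))) < Rmin 1 (eps / 4)).
  { destruct (Req_dec y x) as [->|Hne].
    - rewrite Rminus_diag, Rabs_R0. apply Rmin_pos; lra.
    - apply Hc'. split; [split; [exact I | congruence]|]. simpl. unfold Rdist. lra. }
  pose proof (Rmin_l 1 (eps / 4)). pose proof (Rmin_r 1 (eps / 4)).
  pose proof (Gseq_pos x (S (S n)) Hx). pose proof (Gseq_pos y (S (S n)) Hy0).
  apply Rabs_def2 in Hcl.
  assert (Ht2 : t * L < eps / 4).
  { apply Rlt_le_trans with (eps / (4 * L) * L).
    - apply Rmult_lt_compat_r; unfold L in *; lra.
    - right. unfold L. field. lra. }
  assert (Gseq y (S (S n)) <= L) by (unfold L; lra).
  assert (Gseq x (S (S n)) <= L) by (unfold L; lra).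
  apply Rabs_def1; nra.
Qed.

(** * Finite sums *)

Lemma sum_nonneg (u : nat -> R) n :
  (forall k, (k <= n)%nat -> 0 <= u k) -> 0 <= sum_f_R0 u n.
Proof.
  intros H; induction n; simpl; [apply H; lia |].
  apply Rplus_le_le_0_compat; [apply IHn; intros; apply H; lia | apply H; lia].
Qed.

Lemma sum_S (u : nat -> R) n : sum_f_R0 u (S n) = sum_f_R0 u n + u (S n).
Proof. reflexivity. Qed.

Lemma sum_shift (u : nat -> R) n :
  sum_f_R0 u (S n) = u 0%nat + sum_f_R0 (fun k => u (S k)) n.
Proof. rewrite (decomp_sum u (S n)) by lia. reflexivity. Qed.

Lemma sum_scal (c : R) (u : nat -> R) n :
  sum_f_R0 (fun k => c * u k) n = c * sum_f_R0 u n.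
Proof. rewrite scal_sum. apply sum_eq. intros; ring. Qed.

Lemma sum_zero (u : nat -> R) n :
  (forall k, (k <= n)%nat -> u k = 0) -> sum_f_R0 u n = 0.
Proof. intros H. induction n; simpl; [apply H; lia|]. rewrite IHn by (intros; apply H; lia).
  rewrite H by lia. ring. Qed.

Lemma sum_mono_len (u : nat -> R) n m :
  (forall k, (k <= m)%nat -> 0 <= u k) -> (n <= m)%nat ->
  sum_f_R0 u n <= sum_f_R0 u m.
Proof.
  intros H Hnm; induction Hnm; [lra|]. rewrite sum_S.
  assert (0 <= u (S m)) by (apply H; lia).
  assert (sum_f_R0 u n <= sum_f_R0 u m) by (apply IHHnm; intros; apply H; lia). lra.
Qed.

Lemma sum_ge_term (u : nat -> R) n k :
  (forall j, (j <= n)%nat -> 0 <= u j) -> (k <= n)%nat -> u k <= sum_f_R0 u n.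
Proof.
  intros H Hk. apply Rle_trans with (sum_f_R0 u k).
  - destruct k; [simpl; lra|]. rewrite sum_S.
    assert (0 <= sum_f_R0 u k) by (apply sum_nonneg; intros; apply H; lia). lra.
  - apply sum_mono_len; auto.
Qed.

Lemma sum_swap (F : nat -> nat -> R) n m :
  sum_f_R0 (fun i => sum_f_R0 (F i) m) n =
  sum_f_R0 (fun j => sum_f_R0 (fun i => F i j) n) m.
Proof.
  induction n; [reflexivity|].
  rewrite sum_S, IHn, <- plus_sum. apply sum_eq. reflexivity.
Qed.

Lemma sum_triangle (F : nat -> nat -> R) n :
  sum_f_R0 (fun k => sum_f_R0 (fun i => F i (k - i)%nat) k) n =
  sum_f_R0 (fun i => sum_f_R0 (F i) (n - i)) n.
Proof.
  induction n; [reflexivity|].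
  rewrite sum_S, IHn, (sum_S (fun i => F i (S n - i)%nat)).
  rewrite (sum_S (fun i => sum_f_R0 (F i) (S n - i))).
  rewrite Nat.sub_diag. simpl (sum_f_R0 (F (S n)) 0).
  rewrite <- Rplus_assoc, <- plus_sum. f_equal. apply sum_eq. intros i Hi.
  replace (S n - i)%nat with (S (n - i)) by lia. reflexivity.
Qed.

Definition psum (y : nat -> R) (X : R) (n : nat) : R :=
  sum_f_R0 (fun k => y k * X ^ k) n.

Lemma psum_nonneg y X n :
  0 <= X -> (forall k, 0 <= y k) -> 0 <= psum y X n.
Proof. intros HX H. apply sum_nonneg. intros. apply Rmult_le_pos; [apply H | apply pow_le, HX]. Qed.

Lemma psum_le y z X n :
  0 <= X -> (forall k, (k <= n)%nat -> y k <= z k) -> psum y X n <= psum z X n.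
Proof. intros HX H. apply sum_Rle. intros. apply Rmult_le_compat_r; [apply pow_le, HX | apply H; lia]. Qed.

Lemma psum_mono_len y X n m :
  0 <= X -> (forall k, 0 <= y k) -> (n <= m)%nat -> psum y X n <= psum y X m.
Proof. intros HX H Hn. apply sum_mono_len; [|exact Hn].
  intros. apply Rmult_le_pos; [apply H | apply pow_le, HX]. Qed.

Lemma psum_mono_X y X X' n :
  0 <= X <= X' -> (forall k, 0 <= y k) -> psum y X n <= psum y X' n.
Proof. intros HX H. apply sum_Rle. intros. apply Rmult_le_compat_l; [apply H | apply pow_incr, HX]. Qed.

Lemma psum_plus y z X n :
  psum (fun k => y k + z k) X n = psum y X n + psum z X n.
Proof. unfold psum. rewrite <- plus_sum. apply sum_eq. intros; ring. Qed.

Lemma psum_scal c y X n :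
  psum (fun k => c * y k) X n = c * psum y X n.
Proof. unfold psum. rewrite <- sum_scal. apply sum_eq. intros; ring. Qed.

Lemma psum_mult_le y z X n :
  0 <= X -> (forall k, 0 <= y k) -> (forall k, 0 <= z k) ->
  psum (PS_mult y z) X n <= psum y X n * psum z X n.
Proof.
  intros HX Hy Hz. unfold psum, PS_mult.
  rewrite (sum_eq _ (fun k => sum_f_R0 (fun i =>
     (fun i j => (y i * X ^ i) * (z j * X ^ j)) i (k - i)%nat) k)).
  2:{ intros k Hk. rewrite Rmult_comm, <- sum_scal. apply sum_eq. intros i Hi.
      replace (X ^ k) with (X ^ i * X ^ (k - i)) by (rewrite <- pow_add; f_equal; lia). ring. }
  rewrite (sum_triangle (fun i j => (y i * X ^ i) * (z j * X ^ j))).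
  rewrite (Rmult_comm (sum_f_R0 _ _)), <- sum_scal. apply sum_Rle. intros i Hi.
  rewrite sum_scal, Rmult_comm.
  apply Rmult_le_compat_r; [apply Rmult_le_pos; [apply Hy | apply pow_le, HX]|].
  apply (psum_mono_len z X); auto; lia.
Qed.

Lemma PS_mult_abs y z n :
  Rabs (PS_mult y z n) <= PS_mult (fun k => Rabs (y k)) (fun k => Rabs (z k)) n.
Proof.
  unfold PS_mult. apply Rle_trans with (1 := Rsum_abs _ _). right. apply sum_eq.
  intros. apply Rabs_mult.
Qed.

Lemma PS_mult_le y z y' z' n :
  (forall k, (k <= n)%nat -> 0 <= y k <= y' k) ->
  (forall k, (k <= n)%nat -> 0 <= z k <= z' k) ->
  PS_mult y z n <= PS_mult y' z' n.
Proof. intros Hy Hz. apply sum_Rle. intros.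
  apply Rmult_le_compat; try apply Hy; try apply Hz; lia. Qed.

(** * Power series through their absolute partial sums *)

Definition abs_bounded (b : nat -> R) (X M : R) : Prop :=
  forall L, psum (fun k => Rabs (b k)) X L <= M.

Lemma nonneg_ex_series (u : nat -> R) M :
  (forall k, 0 <= u k) -> (forall n, sum_f_R0 u n <= M) -> ex_series u.
Proof.
  intros Hu HM.
  destruct (ex_finite_lim_seq_incr (sum_f_R0 u) M) as [l Hl].
  - intros n. rewrite sum_S. pose proof (Hu (S n)). lra.
  - exact HM.
  - exists l. apply is_lim_seq_ext with (2 := Hl). intros n. symmetry. apply sum_n_Reals.
Qed.

Lemma nonneg_series_bounds (u : nat -> R) M n :
  (forall k, 0 <= u k) -> (forall n, sum_f_R0 u n <= M) ->
  sum_f_R0 u n <= Series u <= M.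
Proof.
  intros Hu HM. pose proof (Series_correct _ (nonneg_ex_series u M Hu HM)) as Hs.
  assert (Hl : is_lim_seq (sum_f_R0 u) (Series u)).
  { apply is_lim_seq_ext with (2 := Hs). intros k. apply sum_n_Reals. }
  split.
  - apply (is_lim_seq_le_loc (fun _ => sum_f_R0 u n) (sum_f_R0 u)
             (sum_f_R0 u n) (Series u)); [| apply is_lim_seq_const | exact Hl].
    exists n. intros m Hm. apply sum_mono_len; auto.
  - apply (is_lim_seq_le (sum_f_R0 u) (fun _ => M) (Series u) M);
      [exact HM | exact Hl | apply is_lim_seq_const].
Qed.

Lemma series_tail (u : nat -> R) n :
  (forall k, 0 <= u k) -> ex_series u -> sum_f_R0 u n <= Series u.
Proof.
  intros Hu He.
  assert (Hl : is_lim_seq (sum_f_R0 u) (Series u)).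
  { apply is_lim_seq_ext with (2 := Series_correct _ He). intros k. apply sum_n_Reals. }
  apply (is_lim_seq_le_loc (fun _ => sum_f_R0 u n) (sum_f_R0 u)
             (sum_f_R0 u n) (Series u)); [| apply is_lim_seq_const | exact Hl].
  exists n. intros m Hm. apply sum_mono_len; auto.
Qed.

Lemma abs_bounded_ex_series b x M :
  abs_bounded b (Rabs x) M -> ex_series (fun n => Rabs (b n * x ^ n)).
Proof.
  intros H. apply nonneg_ex_series with M; [intros; apply Rabs_pos|].
  intros n. apply Rle_trans with (2 := H n). right. apply sum_eq. intros.
  rewrite Rabs_mult, RPow_abs. reflexivity.
Qed.

Lemma abs_bounded_is_pseries b x M :
  abs_bounded b (Rabs x) M -> is_pseries b x (PSeries b x).
Proof.
  intros H. apply PSeries_correct, ex_pseries_R, ex_series_Rabs.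
  exact (abs_bounded_ex_series b x M H).
Qed.

Lemma abs_bounded_PSeries_le b x M :
  abs_bounded b (Rabs x) M -> Rabs (PSeries b x) <= M.
Proof.
  intros H. unfold PSeries. apply Rle_trans with (1 := Series_Rabs _ (abs_bounded_ex_series b x M H)).
  apply (nonneg_series_bounds (fun n => Rabs (b n * x ^ n)) M 0).
  - intros; apply Rabs_pos.
  - intros n. apply Rle_trans with (2 := H n). right. apply sum_eq. intros.
    rewrite Rabs_mult, RPow_abs. reflexivity.
Qed.

Lemma abs_bounded_radius b X M :
  0 <= X -> abs_bounded b X M -> Rbar_le X (CV_radius b).
Proof.
  intros HX H. destruct (CV_radius_bounded b) as [U _]. apply U. exists M. intros n.
  apply Rle_trans with (2 := H n).
  rewrite Rabs_mult, <- RPow_abs, (Rabs_pos_eq X HX).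
  apply (sum_ge_term (fun k => Rabs (b k) * X ^ k)); [|lia].
  intros; apply Rmult_le_pos; [apply Rabs_pos | apply pow_le, HX].
Qed.

Lemma abs_bounded_le b c X M :
  0 <= X -> (forall k, Rabs (b k) <= c k) -> (forall L, psum c X L <= M) ->
  abs_bounded b X M.
Proof. intros HX H HM L. apply Rle_trans with (2 := HM L). apply psum_le; auto. Qed.

Lemma abs_bounded_mult b c X M M' :
  0 <= X -> abs_bounded b X M -> abs_bounded c X M' ->
  abs_bounded (PS_mult b c) X (M * M').
Proof.
  intros HX Hb Hc L.
  apply Rle_trans with (psum (PS_mult (fun k => Rabs (b k)) (fun k => Rabs (c k))) X L).
  { apply psum_le; [exact HX|]. intros. apply PS_mult_abs. }
  apply Rle_trans with (1 := psum_mult_le _ _ X L HX (fun k => Rabs_pos _) (fun k => Rabs_pos _)).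
  apply Rmult_le_compat; auto; apply psum_nonneg; auto; intros; apply Rabs_pos.
Qed.

Lemma is_pseries_mult_abs b c x M M' :
  abs_bounded b (Rabs x) M -> abs_bounded c (Rabs x) M' ->
  is_pseries (PS_mult b c) x (PSeries b x * PSeries c x).
Proof.
  intros Hb Hc. apply is_pseries_R.
  apply is_series_ext with (fun n => sum_f_R0 (fun k => (b k * x ^ k) * (c (n - k)%nat * x ^ (n - k))) n).
  - intros n. unfold PS_mult. rewrite (Rmult_comm (sum_f_R0 _ _)), <- sum_scal. apply sum_eq.
    intros k Hk. replace (x ^ n) with (x ^ k * x ^ (n - k)) by (rewrite <- pow_add; f_equal; lia). ring.
  - apply (is_series_mult (fun n => b n * x ^ n) (fun n => c n * x ^ n)).
    + apply is_pseries_R, (abs_bounded_is_pseries b x M Hb).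
    + apply is_pseries_R, (abs_bounded_is_pseries c x M' Hc).
    + exact (abs_bounded_ex_series b x M Hb).
    + exact (abs_bounded_ex_series c x M' Hc).
Qed.

Lemma ball_0 (r : posreal) (x : R) : ball 0 r x <-> Rabs x < r.
Proof. rewrite <- (Rminus_0_r x) at 2. reflexivity. Qed.

(** Tannery's theorem, in the form of vanishing sums: a family of sums of
    varying length tends to 0 when each term does and a summable sequence
    dominates. *)
Lemma tannery {T} (F : (T -> Prop) -> Prop) {FF : Filter F}
    (t : T -> nat -> R) (N : T -> nat) (beta : nat -> R) :
  (forall j, filterlim (fun x => t x j) F (locally 0)) ->
  ex_series beta -> (forall j, 0 <= beta j) ->
  F (fun x => forall j, (j <= N x)%nat -> Rabs (t x j) <= beta j) ->
  filterlim (fun x => sum_f_R0 (t x) (N x)) F (locally 0).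
Proof.
  intros Ht Hb Hb0 Hd. apply filterlim_locally. intros eps.
  assert (Hl : is_lim_seq (sum_f_R0 beta) (Series beta)).
  { apply is_lim_seq_ext with (2 := Series_correct _ Hb). intros k. apply sum_n_Reals. }
  apply is_lim_seq_spec in Hl.
  destruct (Hl (pos_div_2 eps)) as [M HM]. specialize (HM M (le_n _)). simpl in HM.
  assert (Hfin : forall L, F (fun x => forall j, (j <= L)%nat ->
     Rabs (t x j) < eps / 2 / INR (S M))).
  { assert (Hq : 0 < eps / 2 / INR (S M)).
    { apply Rdiv_lt_0_compat; [pose proof (cond_pos eps); lra | apply lt_0_INR; lia]. }
    assert (Hone : forall j, F (fun x => Rabs (t x j) < eps / 2 / INR (S M))).
    { intros j. pose proof (proj1 (filterlim_locally _ _) (Ht j) (mkposreal _ Hq)) as HH.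
      revert HH; apply filter_imp. intros x Hx. unfold ball in Hx. simpl in Hx.
      unfold AbsRing_ball, abs, minus, plus, opp in Hx. simpl in Hx.
      rewrite Ropp_0, Rplus_0_r in Hx. exact Hx. }
    induction L.
    - generalize (Hone 0%nat); apply filter_imp. intros x Hx j Hj. replace j with 0%nat by lia. exact Hx.
    - generalize (filter_and _ _ IHL (Hone (S L))). apply filter_imp. intros x [A1 A2] j Hj.
      destruct (Nat.eq_dec j (S L)) as [->|]; [exact A2 | apply A1; lia]. }
  generalize (filter_and _ _ Hd (Hfin M)). apply filter_imp. intros x [A1 A2].
  apply <- ball_0. apply Rle_lt_trans with (1 := Rsum_abs _ _).
  assert (Hc : forall n, (n <= N x)%nat ->
     sum_f_R0 (fun l => Rabs (t x l)) n <=
       sum_f_R0 (fun l => if le_dec l (N x) then Rabs (t x l) else 0) M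
        + (Series beta - sum_f_R0 beta M)).
  { intros n Hn. destruct (le_dec n M) as [HnM|HnM].
    - apply Rle_trans with (sum_f_R0 (fun l => if le_dec l (N x) then Rabs (t x l) else 0) M).
      + apply Rle_trans with (sum_f_R0 (fun l => if le_dec l (N x) then Rabs (t x l) else 0) n).
        * apply sum_Rle. intros k Hk. destruct (le_dec k (N x)); [lra | lia].
        * apply sum_mono_len; [|exact HnM]. intros k _. destruct (le_dec k (N x)); [apply Rabs_pos | lra].
      + pose proof (series_tail beta M Hb0 Hb). lra.
    - assert (HMn : (M <= n)%nat) by lia.
      apply Rle_trans with (sum_f_R0 (fun l => if le_dec l (N x) then Rabs (t x l) else 0) M
           + (sum_f_R0 beta n - sum_f_R0 beta M)).
      + clear HnM. induction HMn.
        * assert (E : sum_f_R0 (fun l => Rabs (t x l)) M =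
             sum_f_R0 (fun l => if le_dec l (N x) then Rabs (t x l) else 0) M).
          { apply sum_eq. intros k Hk. destruct (le_dec k (N x)); [reflexivity | lia]. }
          rewrite E. lra.
        * rewrite !sum_S. specialize (IHHMn ltac:(lia)). specialize (A1 (S m) Hn). lra.
      + pose proof (series_tail beta n Hb0 Hb). lra. }
  apply Rle_lt_trans with (1 := Hc _ (le_n _)).
  assert (sum_f_R0 (fun l => if le_dec l (N x) then Rabs (t x l) else 0) M <= eps / 2).
  { apply Rle_trans with (sum_f_R0 (fun _ => eps / 2 / INR (S M)) M).
    - apply sum_Rle. intros k Hk. destruct (le_dec k (N x)).
      + left. apply A2, Hk.
      + left. apply Rdiv_lt_0_compat; [pose proof (cond_pos eps); lra | apply lt_0_INR; lia].
    - rewrite sum_cte. right. field. apply not_0_INR. lia. }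
  apply Rabs_def2 in HM. lra.
Qed.

(** A sum of power series whose orders increase may be taken coefficient by
    coefficient. *)
Lemma sum_of_pseries (b : nat -> nat -> R) x (beta : nat -> R) :
  (forall j k, (k < j)%nat -> b j k = 0) ->
  (forall j, abs_bounded (b j) (Rabs x) (beta j)) ->
  ex_series beta ->
  is_pseries (fun n => sum_f_R0 (fun j => b j n) n) x
    (Series (fun j => PSeries (b j) x)).
Proof.
  intros Hz Hb He.
  assert (Hb0 : forall j, 0 <= beta j).
  { intros j. apply Rle_trans with (2 := Hb j 0%nat). apply psum_nonneg; [apply Rabs_pos | intros; apply Rabs_pos]. }
  set (s := fun j => PSeries (b j) x).
  assert (Hs : forall j, Rabs (s j) <= beta j).
  { intros j. apply abs_bounded_PSeries_le, Hb. }
  assert (Hes : ex_series s).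
  { apply ex_series_Rabs, nonneg_ex_series with (Series beta); [intros; apply Rabs_pos|].
    intros n. apply Rle_trans with (2 := series_tail beta n Hb0 He).
    apply sum_Rle. intros; apply Hs. }
  assert (H1 : filterlim (fun L => sum_f_R0 (fun j => psum (b j) x L - s j) L)
                 eventually (locally 0)).
  { apply tannery with (beta := fun j => 2 * beta j).
    - apply eventually_filter.
    - intros j. pose proof (abs_bounded_is_pseries _ _ _ (Hb j)) as Hj.
      apply is_pseries_R in Hj.
      assert (HL : is_lim_seq (fun L => psum (b j) x L - s j) (s j - s j)).
      { apply is_lim_seq_minus'; [|apply is_lim_seq_const].
        apply is_lim_seq_ext with (2 := Hj). intros n. apply sum_n_Reals. }
      rewrite Rminus_diag in HL. exact HL.
    - destruct He as [l Hl]. exists (2 * l).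
      apply (is_series_scal_l 2 beta l Hl).
    - intros j. specialize (Hb0 j). lra.
    - exists 0%nat. intros L _ j _.
      assert (Rabs (psum (b j) x L) <= beta j).
      { apply Rle_trans with (2 := Hb j L). unfold psum.
        apply Rle_trans with (1 := Rsum_abs _ _). right. apply sum_eq. intros.
        rewrite Rabs_mult, RPow_abs. reflexivity. }
      pose proof (Hs j). apply Rle_trans with (1 := Rabs_triang _ _). rewrite Rabs_Ropp. lra. }
  apply is_pseries_R.
  assert (H2 : is_lim_seq (fun L => sum_f_R0 (fun j => psum (b j) x L - s j) L + sum_f_R0 s L)
     (0 + Series s)).
  { apply is_lim_seq_plus'; [exact H1|].
    apply is_lim_seq_ext with (2 := Series_correct _ Hes). intros n. apply sum_n_Reals. }
  rewrite Rplus_0_l in H2.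
  apply is_lim_seq_ext with (2 := H2). intros L. rewrite sum_n_Reals, <- plus_sum.
  rewrite (sum_eq _ (fun j => psum (b j) x L)) by (intros; ring).
  unfold psum. rewrite sum_swap. apply sum_eq. intros n Hn.
  rewrite (Rmult_comm (sum_f_R0 _ _)), <- sum_scal.
  assert (E : forall d, sum_f_R0 (fun i => b i n * x ^ n) (n + d) =
                sum_f_R0 (fun i => x ^ n * b i n) n).
  { induction d.
    - rewrite Nat.add_0_r. apply sum_eq. intros; ring.
    - rewrite Nat.add_succ_r, sum_S, IHd, (Hz (S (n + d)) n) by lia. ring. }
  rewrite <- (E (L - n)%nat). f_equal. lia.
Qed.

(** * Substituting a power series into the nonlinearity *)

Lemma PS_pow_S m l : PS_pow m (S l) = PS_mult m (PS_pow m l).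
Proof. reflexivity. Qed.

Lemma PS_pow_order m l k : m 0%nat = 0 -> (k < l)%nat -> PS_pow m l k = 0.
Proof.
  intros H0. revert k. induction l; intros k Hk; [lia|].
  rewrite PS_pow_S. unfold PS_mult. apply sum_zero. intros i Hi.
  destruct i; [rewrite H0; ring|]. rewrite IHl by lia. ring.
Qed.

Lemma PS_pow_abs_bounded m X M l :
  0 <= X -> abs_bounded m X M -> abs_bounded (PS_pow m l) X (M ^ l).
Proof.
  intros HX Hm. induction l.
  - intros L. unfold psum. induction L.
    + simpl. rewrite Rabs_R1. lra.
    + rewrite sum_S. simpl PS_pow. rewrite Rabs_R0. simpl in *. lra.
  - rewrite PS_pow_S. simpl pow. apply abs_bounded_mult; auto.
Qed.

Lemma is_pseries_PS_pow m x M l :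
  abs_bounded m (Rabs x) M -> PSeries (PS_pow m l) x = PSeries m x ^ l.
Proof.
  intros Hm. induction l.
  - simpl. apply is_pseries_unique. apply is_pseries_R.
    apply (filterlim_ext (fun _ => 1)); [|apply filterlim_const].
    intros n. rewrite sum_n_Reals. induction n; [simpl; ring|].
    rewrite sum_S, <- IHn. simpl. ring.
  - rewrite PS_pow_S. simpl pow. rewrite <- IHl. apply is_pseries_unique.
    apply is_pseries_mult_abs with M (M ^ l); [exact Hm|].
    apply PS_pow_abs_bounded; [apply Rabs_pos | exact Hm].
Qed.

Lemma geom_sum_le2 t n : 0 <= t <= 1 / 2 -> sum_f_R0 (fun k => t ^ k) n <= 2.
Proof.
  intros Ht. assert (sum_f_R0 (fun k => t ^ k) n <= 2 - (1/2) ^ n).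
  { induction n; [simpl; lra|]. rewrite sum_S.
    assert (t ^ (S n) <= (1/2) ^ (S n)) by (apply pow_incr; lra). simpl in *. lra. }
  assert (0 < (1/2) ^ n) by (apply pow_lt; lra). lra.
Qed.

Lemma abs_bounded_scal c b X M :
  abs_bounded b X M -> abs_bounded (fun k => c * b k) X (Rabs c * M).
Proof.
  intros H L. apply Rle_trans with (psum (fun k => Rabs c * Rabs (b k)) X L).
  - right. apply sum_eq. intros. rewrite Rabs_mult. reflexivity.
  - rewrite psum_scal. apply Rmult_le_compat_l; [apply Rabs_pos | apply H].
Qed.

Lemma abs_bounded_incr b X M j :
  0 <= X -> abs_bounded b X M ->
  abs_bounded (fun n => if le_dec j n then b (n - j)%nat else 0) X (X ^ j * M).
Proof.
  intros HX H L. unfold psum.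
  assert (HM : 0 <= M).
  { apply Rle_trans with (2 := H 0%nat). apply psum_nonneg; auto. intros; apply Rabs_pos. }
  destruct (le_dec j L) as [HjL|HjL].
  - replace L with (j + (L - j))%nat by lia. set (d := (L - j)%nat).
    assert (E : forall d, sum_f_R0 (fun k => Rabs (if le_dec j k then b (k - j)%nat else 0) * X ^ k) (j + d)
       = X ^ j * psum (fun k => Rabs (b k)) X d).
    { clear. intros d. induction d.
      - rewrite Nat.add_0_r. unfold psum. simpl sum_f_R0 at 2.
        destruct j.
        + simpl. ring.
        + rewrite sum_S, sum_zero.
          * destruct (le_dec (S j) (S j)); [|lia]. rewrite Nat.sub_diag. simpl. ring.
          * intros k Hk. destruct (le_dec (S j) k); [lia|]. rewrite Rabs_R0. ring.
      - rewrite Nat.add_succ_r, sum_S, IHd. unfold psum. rewrite sum_S.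
        destruct (le_dec j (S (j + d))); [|lia].
        replace (S (j + d) - j)%nat with (S d) by lia.
        replace (X ^ S (j + d)) with (X ^ j * X ^ S d) by (rewrite <- pow_add; f_equal; lia). ring. }
    rewrite E. apply Rmult_le_compat_l; [apply pow_le, HX | apply H].
  - rewrite sum_zero; [apply Rmult_le_pos; [apply pow_le, HX | exact HM]|].
    intros k Hk. destruct (le_dec j k); [lia|]. rewrite Rabs_R0. ring.
Qed.

Lemma is_pseries_incr_dec b x M j :
  abs_bounded b (Rabs x) M ->
  PSeries (fun n => if le_dec j n then b (n - j)%nat else 0) x = x ^ j * PSeries b x.
Proof.
  intros H. rewrite <- PSeries_incr_n. apply PSeries_ext. intros n.
  rewrite PS_incr_n_simplify. destruct (le_dec j n), (le_lt_dec j n); try lia; reflexivity.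
Qed.

Section Composition.

Variables (f : nat -> R) (h : nat -> nat -> R) (mu tau B : R) (m : nat -> R).
Hypothesis Htau : 0 < tau.
Hypothesis Hf : forall k, Rabs (f k) <= B * tau ^ k.
Hypothesis Hh : forall k l, Rabs (h k l) <= tau ^ (k + l).
Hypothesis Hm0 : m 0%nat = 0.

(** Both summations in [g x (m x)], over the powers of [m x] and over the
    powers of [x], are summations of power series of increasing order. *)
Lemma is_pseries_PS_g x M :
  abs_bounded m (Rabs x) M -> tau * Rabs x <= 1 / 2 -> tau * M <= 1 / 2 ->
  is_pseries (PS_g f h mu m) x (g f h mu x (PSeries m x)).
Proof.
  intros Hm Hx HM.
  assert (HX : 0 <= Rabs x) by apply Rabs_pos.
  assert (HM0 : 0 <= M).
  { apply Rle_trans with (2 := Hm 0%nat). apply psum_nonneg; auto. intros; apply Rabs_pos. }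
  assert (Hgeo : forall t, 0 <= t <= 1/2 -> ex_series (fun l => t ^ l)).
  { intros t Ht. apply ex_series_geom. rewrite Rabs_pos_eq; lra. }
  assert (HtX : 0 <= tau * Rabs x) by (apply Rmult_le_pos; lra).
  assert (HtM : 0 <= tau * M) by (apply Rmult_le_pos; lra).
  (* the coefficient of x^j as a power series in x *)
  set (phi := fun j n => sum_f_R0 (fun l => h j l * PS_pow m l n) n).
  set (y := PSeries m x).
  assert (Hb1 : forall j l, abs_bounded (fun n => h j l * PS_pow m l n) (Rabs x)
                  (tau ^ j * (tau * M) ^ l)).
  { intros j l L.
    apply Rle_trans with (1 := abs_bounded_scal (h j l) (PS_pow m l) (Rabs x) (M ^ l)
        (PS_pow_abs_bounded m (Rabs x) M l HX Hm) L).
    rewrite Rpow_mult_distr, <- Rmult_assoc, <- pow_add.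
    apply Rmult_le_compat_r; [apply pow_le, HM0 | apply Hh]. }
  assert (Hphi : forall j, is_pseries (phi j) x (PSeries (h j) y)).
  { intros j.
    replace (PSeries (h j) y) with (Series (fun l => PSeries (fun n => h j l * PS_pow m l n) x)).
    - apply sum_of_pseries with (fun l => tau ^ j * (tau * M) ^ l).
      + intros l k Hk. rewrite PS_pow_order by auto. ring.
      + apply Hb1.
      + destruct (Hgeo (tau * M)) as [s Hs]; [lra|]. exists (tau ^ j * s).
        apply (is_series_scal_l (tau ^ j) _ _ Hs).
    - unfold PSeries at 2. apply Series_ext. intros l.
      change (PSeries (PS_scal (h j l) (PS_pow m l)) x = h j l * y ^ l).
      rewrite PSeries_scal. unfold y. rewrite <- (is_pseries_PS_pow m x M l Hm). reflexivity. }
  assert (Hphib : forall j, abs_bounded (phi j) (Rabs x) (2 * tau ^ j)).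
  { intros j L. unfold phi.
    apply Rle_trans with (psum (fun n => sum_f_R0 (fun l => Rabs (h j l * PS_pow m l n)) L) (Rabs x) L).
    - apply psum_le; [exact HX|]. intros n Hn. apply Rle_trans with (1 := Rsum_abs _ _).
      apply sum_mono_len; [intros; apply Rabs_pos | exact Hn].
    - unfold psum.
      rewrite (sum_eq _ (fun n => sum_f_R0 (fun l => Rabs (h j l * PS_pow m l n) * Rabs x ^ n) L)).
      2:{ intros n Hn. rewrite Rmult_comm, <- sum_scal. apply sum_eq. intros; ring. }
      rewrite sum_swap.
      apply Rle_trans with (sum_f_R0 (fun l => tau ^ j * (tau * M) ^ l) L).
      + apply sum_Rle. intros l Hl. apply (Hb1 j l L).
      + rewrite sum_scal, Rmult_comm. apply Rmult_le_compat_r; [apply pow_le; lra|].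
        apply geom_sum_le2. lra. }
  assert (H2 : is_pseries (fun n => sum_f_R0 (fun k =>
               sum_f_R0 (fun l => h k l * PS_pow m l (n - k)) n) n) x
             (PSeries (fun k => PSeries (h k) y) x)).
  { replace (PSeries (fun k => PSeries (h k) y) x) with
      (Series (fun j => PSeries (fun n => if le_dec j n then phi j (n - j)%nat else 0) x)).
    - apply is_pseries_ext with (fun n => sum_f_R0 (fun j => if le_dec j n then phi j (n - j)%nat else 0) n).
      + intros n. apply sum_eq. intros j Hj. destruct (le_dec j n); [|lia]. unfold phi.
        assert (E : forall d, sum_f_R0 (fun i => h j i * PS_pow m i (n - j)) (n - j + d) =
                sum_f_R0 (fun i => h j i * PS_pow m i (n - j)) (n - j)).
        { induction d; [rewrite Nat.add_0_r; reflexivity|].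
          rewrite Nat.add_succ_r, sum_S, IHd, (PS_pow_order m _ _ Hm0) by lia. ring. }
        rewrite <- (E j). f_equal. lia.
      + apply sum_of_pseries with (fun j => 2 * (tau * Rabs x) ^ j).
        * intros j k Hk. destruct (le_dec j k); [lia | reflexivity].
        * intros j. replace (2 * (tau * Rabs x) ^ j) with (Rabs x ^ j * (2 * tau ^ j))
            by (rewrite Rpow_mult_distr; ring).
          apply abs_bounded_incr; auto.
        * destruct (Hgeo (tau * Rabs x)) as [s Hs]; [lra|]. exists (2 * s).
          apply (is_series_scal_l 2 _ _ Hs).
    - unfold PSeries at 2. apply Series_ext. intros j.
      rewrite (is_pseries_incr_dec _ x _ j (Hphib j)).
      rewrite (is_pseries_unique _ _ _ (Hphi j)). ring. }
  assert (H1 : is_pseries f x (PSeries f x)).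
  { apply abs_bounded_is_pseries with (B * 2). intros L.
    apply Rle_trans with (psum (fun k => B * tau ^ k) (Rabs x) L).
    - apply psum_le; auto.
    - rewrite psum_scal. apply Rmult_le_compat_l.
      + pose proof (Hf 0%nat). simpl in H. pose proof (Rabs_pos (f 0%nat)). lra.
      + unfold psum. rewrite (sum_eq _ (fun k => (tau * Rabs x) ^ k)).
        * apply geom_sum_le2; lra.
        * intros. rewrite Rpow_mult_distr. reflexivity. }
  unfold g. apply (is_pseries_plus f (fun n => mu * sum_f_R0 (fun k =>
               sum_f_R0 (fun l => h k l * PS_pow m l (n - k)) n) n) x _ _ H1).
  apply is_pseries_R. apply is_pseries_R in H2.
  apply is_series_ext with (fun n => mu * (sum_f_R0 (fun k =>
               sum_f_R0 (fun l => h k l * PS_pow m l (n - k)) n) n * x ^ n)).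
  - intros n. exact (eq_sym (Rmult_assoc mu _ _)).
  - apply (is_series_scal_l mu _ _ H2).
Qed.

End Composition.

(** * Growth sequences below the resonance *)

(** [W_k] is the absolute value of the solution of
    [(1 - e k) w_k + (k - 1 + a) w_(k-1) = 0]; orders 0 and 1, which do not
    occur in the manifolds, are set to 0 so that convolutions need no
    restriction of their indices. *)
Definition growth (e a : R) (W : nat -> R) : Prop :=
  W 0%nat = 0 /\ W 1%nat = 0 /\ (forall k, (2 <= k)%nat -> 0 < W k) /\
  forall k, (2 <= k)%nat ->
    Rabs (1 - e * INR (S k)) * W (S k) = (INR k + a) * W k.

(** The coefficients [tau^(k+l)] on the support of [h]: [k >= 2] and [l = 1], or
    [k >= 1] and [l >= 2]. *)
Definition hmaj (tau : R) (k l : nat) : R :=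
  match k, l with
  | O, _ | _, O | 1%nat, 1%nat => 0
  | _, _ => tau ^ (k + l)
  end.

(** The coefficients of the series with coefficients [hmaj] at [(x, y x)]. *)
Definition Hmaj (tau : R) (y : nat -> R) (n : nat) : R :=
  sum_f_R0 (fun k => sum_f_R0 (fun l => hmaj tau k l * PS_pow y l (n - k)) n) n.

Lemma hmaj_nonneg tau k l : 0 < tau -> 0 <= hmaj tau k l.
Proof. intros H. destruct k as [|[|k]], l as [|[|l]]; unfold hmaj; first [lra | apply pow_le; lra]. Qed.

Lemma PS_pow_abs y z l k :
  (forall i, (i <= k)%nat -> Rabs (y i) <= z i) ->
  Rabs (PS_pow y l k) <= PS_pow z l k.
Proof.
  revert k. induction l; intros k H.
  - simpl. destruct k; rewrite ?Rabs_R1, ?Rabs_R0; lra.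
  - rewrite !PS_pow_S. apply Rle_trans with (1 := PS_mult_abs _ _ _).
    apply PS_mult_le.
    + intros i Hi; split; [apply Rabs_pos | apply H, Hi].
    + intros i Hi; split; [apply Rabs_pos | apply IHl; intros; apply H; lia].
Qed.

Lemma PS_pow_nonneg y l k :
  (forall i, (i <= k)%nat -> 0 <= y i) -> 0 <= PS_pow y l k.
Proof.
  intros H. apply Rle_trans with (Rabs (PS_pow y l k)); [apply Rabs_pos|].
  apply PS_pow_abs. intros i Hi. rewrite Rabs_pos_eq by (apply H, Hi). lra.
Qed.

Lemma PS_g_majorant f h mu tau m y n :
  0 < tau -> 0 <= mu ->
  (forall k l, Rabs (h k l) <= hmaj tau k l) ->
  (forall i, (i < n)%nat -> Rabs (m i) <= y i) ->
  Rabs (PS_g f h mu m n) <= Rabs (f n) + mu * Hmaj tau y n.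
Proof.
  intros Ht Hmu Hh Hy. unfold PS_g, Hmaj.
  apply Rle_trans with (1 := Rabs_triang _ _). apply Rplus_le_compat_l.
  rewrite Rabs_mult, (Rabs_pos_eq mu Hmu). apply Rmult_le_compat_l; [exact Hmu|].
  apply Rle_trans with (1 := Rsum_abs _ _). apply sum_Rle. intros k Hk.
  apply Rle_trans with (1 := Rsum_abs _ _). apply sum_Rle. intros l Hl.
  rewrite Rabs_mult. destruct k.
  - replace (h 0%nat l) with 0.
    2:{ specialize (Hh 0%nat l). simpl in Hh. symmetry. apply Rabs_eq_0.
        pose proof (Rabs_pos (h 0%nat l)). lra. }
    rewrite Rabs_R0. simpl. lra.
  - apply Rmult_le_compat; try apply Rabs_pos; [apply Hh|].
    apply PS_pow_abs. intros i Hi. apply Hy. lia.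
Qed.

Lemma sum_indicator c p n :
  (p <= n)%nat -> sum_f_R0 (fun i => if Nat.eq_dec i p then c else 0) n = c.
Proof.
  intros H. induction H.
  - destruct p; [simpl; destruct (Nat.eq_dec 0 0); [reflexivity | lia]|].
    rewrite sum_S, sum_zero.
    + destruct (Nat.eq_dec (S p) (S p)); [ring | lia].
    + intros k Hk. destruct (Nat.eq_dec k (S p)); [lia | reflexivity].
  - rewrite sum_S, IHle. destruct (Nat.eq_dec (S m) p); [lia | ring].
Qed.

Section LowOrder.

Variables c0 A g0 g1 : R.
Hypothesis Hc0 : 0 < c0 <= 1.
Hypothesis HA : 1 <= A.
Hypothesis Hg0 : 0 < g0.

(** Every bound below depends only on these ranges for [a] and [W 2], and so
    is uniform in [e], the value 0 included. *)
Definition tame (e a : R) (W : nat -> R) : Prop :=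
  0 <= e <= 1 / 4 /\ c0 - 2 <= a <= A /\ growth e a W /\ g0 <= W 2%nat <= g1.

Section OneSequence.

Variables (e a : R) (W : nat -> R).
Hypothesis HT : tame e a W.

Lemma W_nonneg k : 0 <= W k.
Proof.
  destruct HT as (_ & _ & (W0 & W1 & Wp & _) & _).
  destruct k as [|[|k]]; [lra | lra | left; apply Wp; lia].
Qed.

Lemma low_le n k : (k <= n)%nat -> e * INR n < 1 -> e * INR k < 1.
Proof.
  intros H Hn. apply le_INR in H. destruct HT as [He _].
  apply Rle_lt_trans with (2 := Hn). apply Rmult_le_compat_l; lra.
Qed.

Lemma W_rec_low k : (2 <= k)%nat -> e * INR (S k) < 1 ->
  (1 - e * INR (S k)) * W (S k) = (INR k + a) * W k.
Proof.
  intros Hk H. destruct HT as (_ & _ & (_ & _ & _ & Wr) & _).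
  rewrite <- (Wr k Hk), Rabs_pos_eq; lra.
Qed.

Lemma index_pos k : (2 <= k)%nat -> INR k - 2 + c0 <= INR k + a /\ c0 <= INR k + a.
Proof.
  intros Hk. destruct HT as (_ & Ha & _). apply le_INR in Hk. simpl in Hk. lra.
Qed.

Lemma W_step k : (2 <= k)%nat -> e * INR (S k) < 1 ->
  (INR k + a) * W k <= W (S k).
Proof.
  intros Hk H. rewrite <- W_rec_low by assumption.
  destruct HT as [He _]. pose proof (pos_INR (S k)). pose proof (W_nonneg (S k)).
  assert (0 <= e * INR (S k) * W (S k)) by (repeat apply Rmult_le_pos; lra). lra.
Qed.

Lemma W_down k : e * INR (S k) < 1 -> c0 * W k <= W (S k).
Proof.
  intros H. destruct (le_lt_dec 2 k) as [Hk|Hk].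
  - apply Rle_trans with (2 := W_step k Hk H).
    apply Rmult_le_compat_r; [apply W_nonneg | apply index_pos, Hk].
  - replace (W k) with 0; [rewrite Rmult_0_r; apply W_nonneg|].
    destruct HT as (_ & _ & (W0 & W1 & _) & _). destruct k as [|[|]]; [auto | auto | lia].
Qed.

(** Convexity of the inverse ratio [(1 - e i) / (i - 1 + a)] of consecutive
    terms, applied to the pair [(i, l)] and its midpoint. *)
Lemma W_pair i l : (3 <= i)%nat -> (3 <= l)%nat ->
  e * INR i < 1 -> e * INR l < 1 ->
  2 * (2 - e * (INR i + INR l)) * (W i * W l) <=
  (W (pred i) * W l + W i * W (pred l)) * (INR i + INR l - 2 + 2 * a).
Proof.
  intros Hi Hl Ei El.
  destruct i as [|i]; [lia|]. destruct l as [|l]; [lia|]. simpl pred.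
  pose proof (W_rec_low i ltac:(lia) Ei) as Ri. pose proof (W_rec_low l ltac:(lia) El) as Rl.
  destruct (index_pos i ltac:(lia)) as [_ Ui]. destruct (index_pos l ltac:(lia)) as [_ Ul].
  set (u := INR i + a) in *. set (v := INR l + a) in *.
  set (p := 1 - e * INR (S i)) in *. set (q := 1 - e * INR (S l)) in *.
  assert (Hu : 0 < u) by lra. assert (Hv : 0 < v) by lra.
  assert (Eu : W i = p * W (S i) / u) by (rewrite Ri; field; apply Rgt_not_eq, Hu).
  assert (Ev : W l = q * W (S l) / v) by (rewrite Rl; field; apply Rgt_not_eq, Hv).
  rewrite Eu, Ev.
  assert (Ha : 0 <= 1 - e * (1 - a)).
  { destruct HT as (He & Ha & _). assert (INR 3 <= INR (S i)) by (apply le_INR; lia).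
    simpl in H. nra. }
  assert (E : p * v - q * u = (v - u) * (1 - e * (1 - a))).
  { unfold p, q, u, v. rewrite !S_INR. ring. }
  replace (INR (S i) + INR (S l) - 2 + 2 * a) with (u + v)
    by (unfold u, v; rewrite !S_INR; ring).
  replace (2 - e * (INR (S i) + INR (S l))) with (p + q) by (unfold p, q; ring).
  apply Rminus_le_0.
  replace (_ - _) with (W (S i) * W (S l) * ((v - u) * (p * v - q * u) * / (u * v)))
    by (field; split; apply Rgt_not_eq; assumption).
  rewrite E. pose proof (W_nonneg (S i)). pose proof (W_nonneg (S l)).
  apply Rmult_le_pos; [nra|]. apply Rmult_le_pos; [|left; apply Rinv_0_lt_compat; nra].
  replace ((v - u) * ((v - u) * (1 - e * (1 - a)))) with ((v - u) * (v - u) * (1 - e * (1 - a))) by ring.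
  apply Rmult_le_pos; [apply Rle_0_sqr | exact Ha].
Qed.

Lemma PS_mult_pred n :
  sum_f_R0 (fun i => W (pred i) * W (S n - i)) (S n) = PS_mult W W n /\
  sum_f_R0 (fun i => W i * W (pred (S n - i))) (S n) = PS_mult W W n.
Proof.
  destruct HT as (_ & _ & (W0 & _) & _). split.
  - rewrite sum_shift. simpl pred. rewrite W0, Rmult_0_l, Rplus_0_l. reflexivity.
  - rewrite sum_S. rewrite Nat.sub_diag. simpl (pred 0). rewrite W0, Rmult_0_r, Rplus_0_r.
    apply sum_eq. intros i Hi. f_equal. f_equal. lia.
Qed.

(** The self-convolution of a log-convex sequence is dominated by its end
    terms.  Averaging [W_pair] over [i + l = n + 2] bounds the convolution at
    [n + 2] by the end terms plus roughly half the growth factor of [W n]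
    times the convolution at [n + 1], so the bound propagates. *)
Lemma W_conv n : e * INR n < 1 -> PS_mult W W (S (S n)) <= 4 * g1 * (2 + A) * W n.
Proof.
  induction n as [|n IH]; intros Hn.
  { destruct HT as (_ & _ & (W0 & W1 & _) & _). unfold PS_mult. simpl. rewrite W0, W1. lra. }
  destruct (le_lt_dec 4 (S n)) as [H4|H4].
  2:{ destruct HT as (_ & Ha & (W0 & W1 & Wp & _) & Hg).
      pose proof (W_nonneg 3) as H3. pose proof (W_nonneg 2) as H2.
      assert (0 <= g1 * A) by (apply Rmult_le_pos; lra).
      assert (0 <= g1 * A * W 2%nat) by (apply Rmult_le_pos; lra).
      assert (0 <= g1 * A * W 3%nat) by (apply Rmult_le_pos; lra).
      assert (0 <= g1 * W 2%nat) by (apply Rmult_le_pos; lra).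
      assert (0 <= g1 * W 3%nat) by (apply Rmult_le_pos; lra).
      destruct n as [|[|[|n]]]; [| | |lia]; unfold PS_mult; simpl; rewrite ?W0, ?W1.
      - lra.
      - assert (W 2%nat * W 2%nat <= g1 * W 2%nat) by (apply Rmult_le_compat_r; lra). lra.
      - assert (W 2%nat * W 3%nat <= g1 * W 3%nat) by (apply Rmult_le_compat_r; lra). lra. }
  assert (Hn' : e * INR n < 1) by (apply low_le with (S n); auto).
  specialize (IH Hn').
  set (P := 2 - e * INR (S (S (S n)))).
  set (U := INR (S (S (S n))) - 2 + 2 * a).
  assert (HeS : 0 <= e <= 1/4) by apply HT.
  assert (Ha : c0 - 2 <= a <= A) by apply HT.
  assert (Hg : g0 <= W 2%nat <= g1) by apply HT.
  assert (N3 : 3 <= INR n) by (assert (X : (3 <= n)%nat) by lia; apply le_INR in X; simpl in X; lra).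
  assert (En : INR (S (S (S n))) = INR n + 3) by (rewrite !S_INR; ring).
  assert (En1 : INR (S n) = INR n + 1) by apply S_INR.
  assert (HP : 0 < P) by (unfold P; rewrite En; rewrite En1 in Hn; nra).
  assert (HU : 0 < U) by (unfold U; rewrite En; lra).
  assert (Hsum : 2 * P * PS_mult W W (S (S (S n))) <=
     2 * (2 * P * (W 2%nat * W (S n))) + 2 * U * PS_mult W W (S (S n))).
  { destruct (PS_mult_pred (S (S n))) as [E1 E2].
    set (c := 2 * P * (W 2%nat * W (S n))).
    apply Rle_trans with (sum_f_R0 (fun i =>
       ((if Nat.eq_dec i 2 then c else 0) + (if Nat.eq_dec i (S n) then c else 0)) +
       U * (W (pred i) * W (S (S (S n)) - i)%nat + W i * W (pred (S (S (S n)) - i)))) (S (S (S n)))).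
    - unfold PS_mult. rewrite <- sum_scal. apply sum_Rle. intros i Hi.
      assert (Hc : 0 <= c).
      { unfold c. pose proof (W_nonneg 2). pose proof (W_nonneg (S n)).
        apply Rmult_le_pos; nra. }
      assert (HR : 0 <= U * (W (pred i) * W (S (S (S n)) - i)%nat + W i * W (pred (S (S (S n)) - i)))).
      { apply Rmult_le_pos; [lra|]. apply Rplus_le_le_0_compat; apply Rmult_le_pos; apply W_nonneg. }
      destruct (Nat.eq_dec i 2) as [->|N2].
      { replace (S (S (S n)) - 2)%nat with (S n) in * by lia. fold c.
        destruct (Nat.eq_dec 2 (S n)); lra. }
      destruct (Nat.eq_dec i (S n)) as [->|N4].
      { replace (S (S (S n)) - S n)%nat with 2%nat in * by lia.
        replace (2 * P * (W (S n) * W 2%nat)) with c by (unfold c; ring). lra. }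
      assert (Hz : forall j, (j < 2)%nat -> W j = 0).
      { intros j Hj. destruct HT as (_ & _ & (W0 & W1 & _) & _). destruct j as [|[|]]; auto; lia. }
      destruct (le_lt_dec 3 i) as [I3|I3]; [destruct (le_lt_dec i n) as [I4|I4]|].
      + assert (Hl : e * INR (S (S (S n)) - i) < 1) by (apply low_le with (S n); [lia | exact Hn]).
        assert (Hi' : e * INR i < 1) by (apply low_le with (S n); [lia | exact Hn]).
        pose proof (W_pair i (S (S (S n)) - i) I3 ltac:(lia) Hi' Hl) as HW.
        replace (INR i + INR (S (S (S n)) - i)) with (INR (S (S (S n)))) in HW
          by (rewrite minus_INR by lia; ring).
        fold P in HW. fold U in HW. lra.
      + rewrite (Hz (S (S (S n)) - i)%nat) by lia. rewrite (Hz (S (S (S n)) - i)%nat) in HR by lia. lra.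
      + rewrite (Hz i) by lia. rewrite (Hz i) in HR by lia. lra.
    - rewrite plus_sum, plus_sum, sum_scal, plus_sum, E1, E2, !sum_indicator by lia. lra. }
  (* the ratio of [W (S n)] to [W n] beats that of the midpoint *)
  pose proof (W_rec_low n ltac:(lia) Hn) as HR.
  set (q := 1 - e * INR (S n)) in *.
  set (C1 := 4 * g1 * (2 + A)) in *.
  assert (Hq : 0 < q) by (unfold q; lra).
  assert (HC1 : 0 < C1) by (unfold C1; nra).
  pose proof (W_nonneg n) as Wn. pose proof (W_nonneg (S n)) as WSn.
  assert (Hna : 0 < INR n + a) by lra.
  assert (Key : U * W n * 2 <= 2 * P * (1 - / (2 * (2 + A))) * W (S n)).
  { assert (E : W n = q * W (S n) / (INR n + a)) by (rewrite HR; field; lra).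
    rewrite E.
    assert (H2q : 2 * q <= P) by (unfold q, P; rewrite En, En1; nra).
    assert (Hth : U <= 2 * (1 - / (2 * (2 + A))) * (INR n + a)).
    { unfold U. rewrite En.
      assert (HAi : / (2 * (2 + A)) * (2 * (2 + A)) = 1) by (field; lra).
      assert (Hi0 : 0 < / (2 * (2 + A))) by (apply Rinv_0_lt_compat; lra).
      assert (/ (2 * (2 + A)) * (INR n + a) <= / (2 * (2 + A)) * ((INR n - 1) * (2 + A)))
        by (apply Rmult_le_compat_l; nra).
      replace (/ (2 * (2 + A)) * ((INR n - 1) * (2 + A))) with ((INR n - 1) / 2 * (/ (2 * (2 + A)) * (2 * (2 + A)))) in H by (field; lra).
      rewrite HAi in H. lra. }
    replace (U * (q * W (S n) / (INR n + a)) * 2) with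
       (2 * q * (U / (INR n + a)) * W (S n)) by (field; lra).
    apply Rmult_le_compat_r; [exact WSn|].
    assert (HUd : U / (INR n + a) <= 2 * (1 - / (2 * (2 + A)))).
    { apply Rmult_le_reg_r with (INR n + a); [lra|].
      unfold Rdiv. rewrite Rmult_assoc, Rinv_l, Rmult_1_r by lra. exact Hth. }
    assert (0 <= U / (INR n + a)) by (left; apply Rdiv_lt_0_compat; lra).
    nra. }
  assert (HIH : 2 * U * PS_mult W W (S (S n)) <= C1 * (U * W n * 2)).
  { apply Rle_trans with (2 * U * (C1 * W n)); [apply Rmult_le_compat_l; lra | lra]. }
  assert (HK2 : C1 * (U * W n * 2) <= C1 * (2 * P * (1 - / (2 * (2 + A))) * W (S n)))
    by (apply Rmult_le_compat_l; lra).
  assert (HC : C1 * / (2 * (2 + A)) = 2 * g1) by (unfold C1; field; lra).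
  assert (H2W : 2 * (2 * P * (W 2%nat * W (S n))) <= 2 * P * (2 * g1 * W (S n))).
  { assert (W 2%nat * W (S n) <= g1 * W (S n)) by (apply Rmult_le_compat_r; lra). nra. }
  apply Rmult_le_reg_l with (2 * P); [lra|].
  replace (2 * P * (C1 * W (S n))) with
    (2 * P * (C1 * / (2 * (2 + A)) * W (S n)) + C1 * (2 * P * (1 - / (2 * (2 + A))) * W (S n))) by ring.
  rewrite HC. lra.
Qed.

Lemma W_lower k : (2 <= k)%nat -> e * INR k < 1 -> g0 * c0 ^ k <= W k.
Proof.
  intros Hk. induction Hk; intros H.
  - assert (g0 <= W 2%nat) by apply HT. assert (c0 ^ 2 <= 1 ^ 2) by (apply pow_incr; lra).
    simpl in *. nra.
  - assert (H' : e * INR m < 1) by (apply low_le with (S m); auto).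
    pose proof (W_down m H). specialize (IHHk H').
    simpl. apply Rle_trans with (c0 * W m); [|lra]. nra.
Qed.

Lemma W_conv_shift k l : e * INR k < 1 ->
  sum_f_R0 (fun i => W i * W (k - i - l)%nat) k <= 4 * g1 * (2 + A) / c0 * W (k - l - 1)%nat.
Proof.
  intros Hk.
  assert (W0 : W 0%nat = 0) by apply HT.
  assert (HC : 0 < 4 * g1 * (2 + A) / c0).
  { assert (g0 <= W 2%nat <= g1) by apply HT. apply Rdiv_lt_0_compat; nra. }
  destruct (le_lt_dec k l) as [Hl|Hl].
  - rewrite sum_zero; [apply Rmult_le_pos; [lra | apply W_nonneg]|].
    intros i Hi. replace (k - i - l)%nat with 0%nat by lia. rewrite W0; ring.
  - assert (E : sum_f_R0 (fun i => W i * W (k - i - l)%nat) k = PS_mult W W (k - l)).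
    { unfold PS_mult. assert (X : forall d, sum_f_R0 (fun i => W i * W (k - i - l)%nat) (k - l + d) =
        sum_f_R0 (fun i => W i * W (k - l - i)%nat) (k - l)).
      { induction d.
        - rewrite Nat.add_0_r. apply sum_eq. intros i Hi. f_equal. f_equal. lia.
        - rewrite Nat.add_succ_r, sum_S, IHd.
          replace (k - S (k - l + d) - l)%nat with 0%nat by lia. rewrite W0; ring. }
      rewrite <- (X l). f_equal. lia. }
    rewrite E. remember (k - l - 1)%nat as p. replace (k - l)%nat with (S p) by lia.
    destruct p as [|p].
    { unfold PS_mult. simpl. rewrite W0. lra. }
    assert (Hp : e * INR (S p) < 1) by (apply low_le with k; [lia | exact Hk]).
    assert (Hp' : e * INR p < 1) by (apply low_le with k; [lia | exact Hk]).
    apply Rle_trans with (1 := W_conv p Hp').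
    pose proof (W_down p Hp).
    replace (4 * g1 * (2 + A) * W p) with (4 * g1 * (2 + A) / c0 * (c0 * W p)) by (field; lra).
    apply Rmult_le_compat_l; lra.
Qed.

(** Each further factor lowers the index by 1, which compensates the
    geometric growth of the coefficients of [h]. *)
Lemma PS_pow_W C0 l k : 0 <= C0 -> e * INR k < 1 ->
  PS_pow (fun i => C0 * W i) (S l) k <=
  C0 * (C0 * (4 * g1 * (2 + A) / c0)) ^ l * W (k - l)%nat.
Proof.
  intros HC. set (Cc := 4 * g1 * (2 + A) / c0). revert k.
  assert (HCc : 0 < Cc).
  { assert (g0 <= W 2%nat <= g1) by apply HT. apply Rdiv_lt_0_compat; nra. }
  assert (HCp : 0 <= (C0 * Cc) ^ l) by (apply pow_le, Rmult_le_pos; lra).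
  induction l; intros k Hk.
  - rewrite PS_pow_S. unfold PS_mult. rewrite Nat.sub_0_r. simpl pow.
    assert (E : forall n, sum_f_R0 (fun k0 : nat => C0 * W k0 * PS_pow (fun i : nat => C0 * W i) 0 (n - k0)) n
       = C0 * W n).
    { intros n. destruct n; [simpl; ring|]. rewrite sum_S, Nat.sub_diag, sum_zero.
      - simpl. ring.
      - intros i Hi. replace (S n - i)%nat with (S (n - i)) by lia. simpl. ring. }
    rewrite E. lra.
  - rewrite PS_pow_S. unfold PS_mult.
    assert (HCl : 0 <= C0 * (C0 * Cc) ^ l) by (apply Rmult_le_pos; [lra | apply pow_le, Rmult_le_pos; lra]).
    apply Rle_trans with (sum_f_R0 (fun i => (C0 * (C0 * (C0 * Cc) ^ l)) * (W i * W (k - i - l)%nat)) k).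
    + apply sum_Rle. intros i Hi.
      replace (C0 * (C0 * (C0 * Cc) ^ l) * (W i * W (k - i - l)%nat)) with
        (C0 * W i * (C0 * (C0 * Cc) ^ l * W (k - i - l)%nat)) by ring.
      apply Rmult_le_compat_l; [apply Rmult_le_pos; [lra | apply W_nonneg]|].
      apply IHl; [apply pow_le, Rmult_le_pos; lra|]. apply low_le with k; [lia | exact Hk].
    + rewrite sum_scal. pose proof (W_conv_shift k l Hk) as HS. fold Cc in HS.
      replace (k - S l)%nat with (k - l - 1)%nat by lia.
      apply Rle_trans with (C0 * (C0 * (C0 * Cc) ^ l) * (Cc * W (k - l - 1)%nat)).
      * apply Rmult_le_compat_l; [nra | exact HS].
      * right. simpl pow. ring.
Qed.

End OneSequence.

(** [W] grows like a factorial, faster than any exponential. *)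
Lemma W_geom M : 1 <= M -> exists C, 0 < C /\
  forall e a W k, tame e a W -> (2 <= k)%nat -> e * INR k < 1 -> M ^ k <= C * W k.
Proof.
  intros HM. destruct (nfloor_ex (M + 2)) as [p Hp]; [lra|].
  set (K0 := S (S p)). exists (M ^ K0 / (g0 * c0 ^ K0)).
  assert (HcK : 0 < c0 ^ K0) by (apply pow_lt; lra).
  assert (HMK : 0 < M ^ K0) by (apply pow_lt; lra).
  assert (HD : 0 < g0 * c0 ^ K0) by nra.
  split; [apply Rdiv_lt_0_compat; lra|].
  intros e a W k HT Hk. induction Hk; intros H.
  - pose proof (W_lower e a W HT 2 (le_n _) H) as L.
    apply Rmult_le_reg_l with (g0 * c0 ^ K0); [exact HD|].
    replace (g0 * c0 ^ K0 * (M ^ K0 / (g0 * c0 ^ K0) * W 2%nat)) with (M ^ K0 * W 2%nat)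
      by (field; lra).
    assert (M ^ 2 <= M ^ K0) by (apply Rle_pow; [lra | unfold K0; lia]).
    assert (c0 ^ K0 <= c0 ^ 2).
    { unfold K0. replace (c0 ^ S (S p)) with (c0 ^ 2 * c0 ^ p) by (simpl; ring).
      assert (c0 ^ p <= 1 ^ p) by (apply pow_incr; lra). rewrite pow1 in H1.
      assert (0 < c0 ^ 2) by (apply pow_lt; lra). nra. }
    assert (0 < M ^ 2) by (apply pow_lt; lra).
    apply Rle_trans with (M ^ 2 * (g0 * c0 ^ 2)).
    + rewrite Rmult_comm. apply Rmult_le_compat_l; nra.
    + apply Rmult_le_compat; nra.
  - assert (H' : e * INR m < 1) by (apply (low_le e a W HT) with (S m); auto).
    specialize (IHHk H').
    destruct (le_lt_dec K0 m) as [Hm|Hm].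
    + pose proof (W_step e a W HT m Hk H) as Hs.
      destruct (index_pos e a W HT m Hk) as [Hi _].
      apply le_INR in Hm. unfold K0 in Hm. rewrite !S_INR in Hm.
      pose proof (W_nonneg e a W HT m) as Wn.
      assert (HMm : M * W m <= W (S m)) by (apply Rle_trans with (2 := Hs); apply Rmult_le_compat_r; lra).
      simpl. apply Rle_trans with (M * (M ^ K0 / (g0 * c0 ^ K0) * W m)).
      * apply Rmult_le_compat_l; lra.
      * replace (M * (M ^ K0 / (g0 * c0 ^ K0) * W m)) with (M ^ K0 / (g0 * c0 ^ K0) * (M * W m)) by ring.
        apply Rmult_le_compat_l; [left; apply Rdiv_lt_0_compat; assumption | exact HMm].
    + pose proof (W_lower e a W HT (S m) ltac:(lia) H) as L.
      apply Rmult_le_reg_l with (g0 * c0 ^ K0); [exact HD|].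
      replace (g0 * c0 ^ K0 * (M ^ K0 / (g0 * c0 ^ K0) * W (S m))) with (M ^ K0 * W (S m))
        by (field; lra).
      assert (M ^ (S m) <= M ^ K0) by (apply Rle_pow; [lra | lia]).
      assert (c0 ^ K0 <= c0 ^ (S m)).
      { replace K0 with (S m + (K0 - S m))%nat by lia. rewrite pow_add.
        assert (c0 ^ (K0 - S m) <= 1 ^ (K0 - S m)) by (apply pow_incr; lra). rewrite pow1 in H1.
        assert (0 < c0 ^ S m) by (apply pow_lt; lra). nra. }
      assert (0 < M ^ S m) by (apply pow_lt; lra).
      assert (0 < c0 ^ S m) by (apply pow_lt; lra).
      apply Rle_trans with (M ^ S m * (g0 * c0 ^ S m)).
      * rewrite Rmult_comm. apply Rmult_le_compat_l; nra.
      * apply Rmult_le_compat; nra.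
Qed.

(** Exponential weights are absorbed: by [W_geom] they are themselves
    dominated by [W], and the convolution of [W] with itself is under control. *)
Lemma W_geom_conv M : 1 <= M -> exists C, 0 < C /\
  forall e a W n L, tame e a W -> e * INR n < 1 ->
    sum_f_R0 (fun j => M ^ j * W (n - j)%nat) L <= C * W n.
Proof.
  intros HM. destruct (W_geom M HM) as [CM [HCM Hgeo]].
  destruct (Rle_lt_dec g1 0) as [Hg1|Hg1].
  { exists 1. split; [lra|]. intros e a W n L HT. exfalso.
    assert (g0 <= W 2%nat <= g1) by apply HT. lra. }
  set (C1 := 4 * g1 * (2 + A)).
  assert (HC1 : 0 < C1) by (unfold C1; nra).
  exists (1 + M / c0 + CM * C1 / (c0 * c0)).
  assert (Hq : 0 < c0 * c0) by nra.
  assert (HMc : 0 < M / c0) by (apply Rdiv_lt_0_compat; lra).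
  assert (HCc : 0 < CM * C1 / (c0 * c0)) by (apply Rdiv_lt_0_compat; nra).
  split; [lra|].
  intros e a W n L HT Hn.
  assert (Hz : forall j, (j < 2)%nat -> W j = 0).
  { intros j Hj. destruct HT as (_ & _ & (W0 & W1 & _) & _). destruct j as [|[|]]; auto; lia. }
  pose proof (W_nonneg e a W HT) as Wn.
  destruct n as [|[|n]].
  { rewrite sum_zero; [rewrite Hz by lia; lra|]. intros; rewrite Hz by lia; ring. }
  { rewrite sum_zero; [rewrite Hz by lia; lra|]. intros; rewrite Hz by lia; ring. }
  apply Rle_trans with (sum_f_R0 (fun j => M ^ j * W (S (S n) - j)%nat) (S (S n))).
  { destruct (le_lt_dec L (S (S n))) as [HL|HL].
    - apply sum_mono_len; [|exact HL]. intros. apply Rmult_le_pos; [apply pow_le; lra | apply Wn].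
    - assert (X : forall d, sum_f_R0 (fun j => M ^ j * W (S (S n) - j)%nat) (S (S n) + d) =
        sum_f_R0 (fun j => M ^ j * W (S (S n) - j)%nat) (S (S n))).
      { induction d; [rewrite Nat.add_0_r; reflexivity|].
        rewrite Nat.add_succ_r, sum_S, IHd, (Hz (S (S n) - _)%nat) by lia. ring. }
      rewrite <- (X (L - S (S n))%nat).
      replace (S (S n) + (L - S (S n)))%nat with L by lia. lra. }
  assert (Hn1 : e * INR (S n) < 1) by (apply (low_le e a W HT) with (S (S n)); [lia | exact Hn]).
  assert (Hn0 : e * INR n < 1) by (apply (low_le e a W HT) with (S (S n)); [lia | exact Hn]).
  pose proof (W_down e a W HT _ Hn) as D1. pose proof (W_down e a W HT _ Hn1) as D0.
  apply Rle_trans with (sum_f_R0 (fun j =>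
     ((if Nat.eq_dec j 0 then W (S (S n)) else 0) + (if Nat.eq_dec j 1 then M * W (S n) else 0))
     + CM * (W j * W (S (S n) - j)%nat)) (S (S n))).
  - apply sum_Rle. intros j Hj.
    assert (0 <= CM * (W j * W (S (S n) - j)%nat))
      by (apply Rmult_le_pos; [lra | apply Rmult_le_pos; apply Wn]).
    destruct j as [|[|j]].
    + simpl (Nat.eq_dec _ _). destruct (Nat.eq_dec 0 0); [|lia]. destruct (Nat.eq_dec 0 1); [lia|].
      simpl pow. rewrite Nat.sub_0_r in *. lra.
    + destruct (Nat.eq_dec 1 0); [lia|]. destruct (Nat.eq_dec 1 1); [|lia].
      simpl pow. replace (S (S n) - 1)%nat with (S n) in * by lia. lra.
    + destruct (Nat.eq_dec (S (S j)) 0); [lia|]. destruct (Nat.eq_dec (S (S j)) 1); [lia|].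
      rewrite <- Rmult_assoc, !Rplus_0_l. apply Rmult_le_compat_r; [apply Wn|].
      apply (Hgeo e a W _ HT); [lia|]. apply (low_le e a W HT) with (S (S n)); [lia | exact Hn].
  - rewrite plus_sum, plus_sum, sum_scal, !sum_indicator by lia.
    pose proof (W_conv e a W HT n Hn0) as HW. fold C1 in HW. unfold PS_mult in HW.
    assert (M * W (S n) <= M / c0 * W (S (S n))).
    { replace (M * W (S n)) with (M / c0 * (c0 * W (S n))) by (field; lra).
      apply Rmult_le_compat_l; lra. }
    assert (CM * sum_f_R0 (fun k => W k * W (S (S n) - k)%nat) (S (S n)) <= CM * C1 / (c0 * c0) * W (S (S n))).
    { apply Rle_trans with (CM * (C1 * W n)); [apply Rmult_le_compat_l; lra|].
      replace (CM * (C1 * W n)) with (CM * C1 / (c0 * c0) * (c0 * (c0 * W n))) by (field; lra).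
      apply Rmult_le_compat_l; [lra|]. apply Rle_trans with (2 := D1). apply Rmult_le_compat_l; lra. }
    lra.
Qed.

(** On the support of [h] a term [x^k y^l] shifts indices by at least 2: [x^k]
    by [k], and each factor [y] after the first by 1. *)
Lemma Hmaj_W tau C0 : 0 < tau -> 0 <= C0 -> exists C2, 0 < C2 /\
  forall e a W n, tame e a W -> e * INR (S (S n)) < 1 ->
    Hmaj tau (fun i => C0 * W i) (S (S n)) <= C2 * W n.
Proof.
  intros Ht HC0.
  set (Cc := 4 * g1 * (2 + A) / c0).
  set (M := 1 + tau + tau * C0 * Rabs Cc).
  assert (HtC : 0 <= tau * C0 * Rabs Cc)
    by (apply Rmult_le_pos; [nra | apply Rabs_pos]).
  assert (HM : 1 <= M) by (unfold M; lra).
  destruct (W_geom_conv M HM) as [G [HG Hgeo]].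
  set (D := C0 * tau * (M * M)).
  assert (HD : 0 <= D) by (unfold D; apply Rmult_le_pos; nra).
  exists (D * G + D * G * G + 1). split; [nra|].
  intros e a W n HT Hn.
  pose proof (W_nonneg e a W HT) as Wn.
  assert (HCc : 0 < Cc).
  { assert (g0 <= W 2%nat <= g1) by apply HT. unfold Cc. apply Rdiv_lt_0_compat; nra. }
  assert (HCcM : tau * C0 * Cc <= M) by (unfold M; rewrite Rabs_pos_eq; lra).
  assert (HtM : tau <= M) by (unfold M; lra).
  set (y := fun i => C0 * W i).
  assert (HTm : forall k l, (1 <= k <= S (S n))%nat ->
     hmaj tau k (S l) * PS_pow y (S l) (S (S n) - k) <=
     C0 * tau * M ^ k * M ^ l * W (S (S n) - k - l)%nat).
  { intros k l Hk.
    assert (Hpw : 0 <= PS_pow y (S l) (S (S n) - k)).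
    { apply PS_pow_nonneg. intros; apply Rmult_le_pos; [lra | apply Wn]. }
    assert (Hh : hmaj tau k (S l) <= tau ^ (k + S l)).
    { destruct k as [|[|k]], l; unfold hmaj; try lra; apply pow_le; lra. }
    apply Rle_trans with (tau ^ (k + S l) * (C0 * (C0 * Cc) ^ l * W (S (S n) - k - l)%nat)).
    - apply Rmult_le_compat; [apply hmaj_nonneg, Ht | exact Hpw | exact Hh |].
      apply (PS_pow_W e a W HT); [exact HC0|].
      apply (low_le e a W HT) with (S (S n)); [lia | exact Hn].
    - replace (tau ^ (k + S l) * (C0 * (C0 * Cc) ^ l * W (S (S n) - k - l)%nat)) with
        (C0 * tau * tau ^ k * (tau * C0 * Cc) ^ l * W (S (S n) - k - l)%nat)
        by (rewrite pow_add, !Rpow_mult_distr; simpl pow; ring).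
      apply Rmult_le_compat_r; [apply Wn|].
      assert (Hk' : tau ^ k <= M ^ k) by (apply pow_incr; lra).
      assert (Hl' : (tau * C0 * Cc) ^ l <= M ^ l).
      { apply pow_incr. split; [apply Rmult_le_pos; nra | exact HCcM]. }
      assert (0 <= C0 * tau) by nra.
      apply Rmult_le_compat; [apply Rmult_le_pos; [lra | apply pow_le; lra] | apply pow_le; apply Rmult_le_pos; nra | | exact Hl'].
      apply Rmult_le_compat_l; lra. }
  assert (Hl0 : forall k p, hmaj tau k 0 * p = 0) by (intros [|[|k]] p; unfold hmaj; ring).
  unfold Hmaj. rewrite sum_shift, (sum_shift _ n). fold y.
  assert (I0 : sum_f_R0 (fun l => hmaj tau 0 l * PS_pow y l (S (S n) - 0)) (S (S n)) = 0)
    by (apply sum_zero; intros; unfold hmaj; ring).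
  assert (I1 : sum_f_R0 (fun l => hmaj tau 1 l * PS_pow y l (S (S n) - 1)) (S (S n)) <= D * G * W n).
  { rewrite sum_shift, sum_shift, Hl0.
    replace (hmaj tau 1 1) with 0 by reflexivity.
    rewrite Rmult_0_l, !Rplus_0_l, Rmult_assoc.
    apply Rle_trans with (D * sum_f_R0 (fun j => M ^ j * W (n - j)%nat) n).
    - rewrite <- sum_scal. apply sum_Rle. intros l Hl.
      apply Rle_trans with (1 := HTm 1%nat (S l) ltac:(lia)).
      replace (S (S n) - 1 - S l)%nat with (n - l)%nat by lia. right. unfold D. simpl pow. ring.
    - apply Rmult_le_compat_l; [exact HD|].
      apply (Hgeo e a W _ _ HT). apply (low_le e a W HT) with (S (S n)); [lia | exact Hn]. }
  assert (I2 : forall k, (k <= n)%nat ->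
     sum_f_R0 (fun l => hmaj tau (S (S k)) l * PS_pow y l (S (S n) - S (S k))) (S (S n))
       <= D * G * (M ^ k * W (n - k)%nat)).
  { intros k Hk. rewrite sum_shift, Hl0, Rplus_0_l.
    apply Rle_trans with (D * M ^ k * sum_f_R0 (fun j => M ^ j * W (n - k - j)%nat) (S n)).
    - rewrite <- sum_scal. apply sum_Rle. intros l Hl.
      apply Rle_trans with (1 := HTm (S (S k)) l ltac:(lia)).
      replace (S (S n) - S (S k) - l)%nat with (n - k - l)%nat by lia. right. unfold D. simpl pow. ring.
    - replace (D * G * (M ^ k * W (n - k)%nat)) with (D * M ^ k * (G * W (n - k)%nat)) by ring.
      apply Rmult_le_compat_l; [apply Rmult_le_pos; [exact HD | apply pow_le; lra]|].
      apply (Hgeo e a W _ _ HT). apply (low_le e a W HT) with (S (S n)); [lia | exact Hn]. }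
  cbv beta. rewrite I0, Rplus_0_l.
  assert (I3 : sum_f_R0 (fun k => sum_f_R0 (fun l => hmaj tau (S (S k)) l * PS_pow y l (S (S n) - S (S k))) (S (S n))) n
     <= D * G * G * W n).
  { apply Rle_trans with (D * G * sum_f_R0 (fun k => M ^ k * W (n - k)%nat) n).
    - rewrite <- sum_scal. apply sum_Rle. exact I2.
    - rewrite (Rmult_assoc (D * G)). apply Rmult_le_compat_l; [nra|].
      apply (Hgeo e a W _ _ HT). apply (low_le e a W HT) with (S (S n)); [lia | exact Hn]. }
  pose proof (Wn n). nra.
Qed.

End LowOrder.

(** * Uniform bounds up to the resonance *)

Definition recursion (e a : R) (f : nat -> R) (h : nat -> nat -> R) (mu : R)
    (m : nat -> R) : Prop :=
  m 0%nat = 0 /\ m 1%nat = 0 /\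
  forall n, (1 - e * INR (S (S n))) * m (S (S n)) + (INR (S n) + a) * m (S n)
            = PS_g f h mu m (S (S n)).

(** The increment of [(-1)^k m_k / W_k], with the sign of [1 - e k] kept. *)
Definition increment (e : R) (f : nat -> R) (h : nat -> nat -> R) (mu : R)
    (W m : nat -> R) (k : nat) : R :=
  match k with
  | O | 1%nat => 0
  | _ => (-1) ^ k * PS_g f h mu m k / ((1 - e * INR k) * W k)
  end.

(** [1 / ((n + c0) (n + 1 + c0))] at [k = n + 4], the bound for
    [W_(k-2) / ((1 - e k) W_k)]. *)
Definition telescope (c0 : R) (k : nat) : R :=
  match k with
  | O | 1%nat | 2%nat | 3%nat => 0
  | S (S (S (S n))) => / (INR n + c0) - / (INR (S n) + c0)
  end.

Lemma telescope_nonneg c0 k : 0 < c0 -> 0 <= telescope c0 k.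
Proof.
  intros H. destruct k as [|[|[|[|n]]]]; try (apply Rle_refl).
  change (0 <= / (INR n + c0) - / (INR (S n) + c0)).
  pose proof (pos_INR n). rewrite (S_INR n).
  assert (/ (INR n + 1 + c0) <= / (INR n + c0)) by (apply Rinv_le_contravar; lra). lra.
Qed.

Lemma telescope_sum c0 n : 0 < c0 -> sum_f_R0 (telescope c0) n <= / c0.
Proof.
  intros H. apply Rle_trans with (sum_f_R0 (telescope c0) (3 + n)).
  - apply sum_mono_len; [intros; apply telescope_nonneg, H | lia].
  - assert (E : sum_f_R0 (telescope c0) (3 + n) = / c0 - / (INR n + c0)).
    { induction n.
      - replace (INR 0 + c0) with c0 by (simpl; ring). simpl. ring.
      - replace (3 + S n)%nat with (S (3 + n)) by lia. rewrite sum_S, IHn.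
        change (telescope c0 (S (3 + n))) with (/ (INR n + c0) - / (INR (S n) + c0)). ring. }
    rewrite E. pose proof (pos_INR n).
    assert (0 < / (INR n + c0)) by (apply Rinv_0_lt_compat; lra). lra.
Qed.

Lemma pow_m1_sqr k : (-1) ^ k * (-1) ^ k = 1.
Proof. rewrite <- Rpow_mult_distr. replace (-1 * -1) with 1 by ring. apply pow1. Qed.

Lemma pow_m1_abs k : Rabs ((-1) ^ k) = 1.
Proof. rewrite <- RPow_abs. replace (Rabs (-1)) with 1; [apply pow1|].
  rewrite Rabs_left; lra. Qed.

Section LowBound.

Variables c0 A g0 g1 tau B : R.
Hypothesis Hc0 : 0 < c0 <= 1.
Hypothesis HA : 1 <= A.
Hypothesis Hg0 : 0 < g0.
Hypothesis Htau : 0 < tau.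
Hypothesis HB : 0 < B.

(** Dividing [m k] by [(-1)^k W k] turns the recursion into a summation of the
    increments.  The linear and nonlinear terms of [g] contribute at order [k]
    only coefficients of order at most [k - 2], which makes the increments
    summable, uniformly in [e] and up to the resonance [e k = 1]. *)
Lemma low_bound : exists (C0 mu0 : R) (beta : nat -> R),
  0 < C0 /\ 0 < mu0 /\ (forall k, 0 <= beta k) /\ ex_series beta /\
  forall e a W f h mu m,
    tame c0 A g0 g1 e a W -> 0 <= mu <= mu0 ->
    (forall k, Rabs (f k) <= B * tau ^ k) ->
    (forall k l, Rabs (h k l) <= hmaj tau k l) ->
    recursion e a f h mu m ->
    forall k, e * INR k < 1 ->
      Rabs (increment e f h mu W m k) <= beta k /\
      m k = (-1) ^ k * W k * sum_f_R0 (increment e f h mu W m) k /\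
      Rabs (m k) <= C0 * W k.
Proof.
  set (M := 1 + 2 * tau).
  destruct (W_geom c0 A g0 g1 Hc0 Hg0 M) as [CM [HCM Hgeo]]; [unfold M; lra|].
  assert (HM : 1 <= M) by (unfold M; lra).
  assert (HCp0 : 0 < M * CM / c0) by (apply Rdiv_lt_0_compat; nra).
  set (Cp := 2 * CM + M * CM / c0).
  assert (HCp : 0 < Cp) by (unfold Cp; lra).
  set (Cf := B * Cp). assert (HCf : 0 < Cf) by (unfold Cf; nra).
  set (C0 := 2 * Cf + 1). assert (HC0 : 0 < C0) by (unfold C0; lra).
  destruct (Hmaj_W c0 A g0 g1 Hc0 HA Hg0 tau C0 Htau) as [C2 [HC2 HH]]; [lra|].
  set (mu0 := c0 / C2).
  assert (Hmu0 : 0 < mu0) by (unfold mu0; apply Rdiv_lt_0_compat; lra).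
  set (beta := fun k => Cf * (1 / 2) ^ k + c0 * telescope c0 k).
  assert (Hb0 : forall k, 0 <= beta k).
  { intros k. unfold beta. pose proof (telescope_nonneg c0 k ltac:(lra)).
    assert (0 < (1/2)^k) by (apply pow_lt; lra).
    apply Rplus_le_le_0_compat; apply Rmult_le_pos; (assumption || (left; assumption) || lra). }
  assert (Hbs : forall n, sum_f_R0 beta n <= C0).
  { intros n. unfold beta. rewrite plus_sum, !sum_scal.
    pose proof (geom_sum_le2 (1/2) n ltac:(lra)). pose proof (telescope_sum c0 n ltac:(lra)).
    assert (c0 * sum_f_R0 (telescope c0) n <= c0 * / c0) by (apply Rmult_le_compat_l; lra).
    rewrite Rinv_r in H1 by lra. unfold C0.
    assert (Cf * sum_f_R0 (pow (1 / 2)) n <= Cf * 2) by (apply Rmult_le_compat_l; [lra | exact H]). lra. }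
  exists C0, mu0, beta. split; [exact HC0|]. split; [exact Hmu0|]. split; [exact Hb0|].
  split; [apply nonneg_ex_series with C0; auto|].
  intros e a W f h mu m HT Hmu Hf Hh (m0 & m1 & Hrec).
  pose proof (W_nonneg _ _ _ _ _ _ _ HT) as Wn.
  assert (He : 0 <= e <= 1 / 4) by apply HT.
  assert (Hgr : growth e a W) by apply HT. destruct Hgr as (W0 & W1 & Wp & _).
  intros k. induction k as [k IH] using lt_wf_ind. intros Hk.
  destruct k as [|[|k]].
  { simpl increment. rewrite m0, W0, Rabs_R0. repeat split; try apply Hb0; lra. }
  { simpl increment. rewrite m1, W1, Rabs_R0. repeat split; try apply Hb0; lra. }
  set (u := (1 - e * INR (S (S k))) * W (S (S k))).
  assert (Hu : 0 < u).
  { unfold u. apply Rmult_lt_0_compat; [lra | apply Wp; lia]. }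
  assert (Hk1 : e * INR (S k) < 1) by (apply (low_le _ _ _ _ _ _ _ HT) with (S (S k)); auto).
  assert (Hu3 : (1 <= k)%nat -> u = (INR (S k) + a) * W (S k)).
  { intros Hk3. unfold u. apply (W_rec_low _ _ _ _ _ _ _ HT); [lia | exact Hk]. }
  assert (HMu : M ^ (S (S k)) <= Cp * u).
  { destruct k as [|k].
    - pose proof (Hgeo e a W 2%nat HT (le_n _) Hk) as HG.
      assert (W 2%nat <= 2 * u).
      { unfold u. pose proof (Wn 2%nat). simpl INR. nra. }
      assert (CM * W 2%nat <= CM * (2 * u)) by (apply Rmult_le_compat_l; lra).
      assert (0 <= M * CM / c0 * u) by (apply Rmult_le_pos; lra). unfold Cp. lra.
    - rewrite Hu3 by lia. pose proof (Hgeo e a W (S (S k)) HT ltac:(lia) Hk1) as HG.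
      destruct (index_pos _ _ _ _ _ _ _ HT (S (S k)) ltac:(lia)) as [_ Hi].
      pose proof (Wn (S (S k))) as Wk.
      assert (c0 * W (S (S k)) <= (INR (S (S k)) + a) * W (S (S k))) by (apply Rmult_le_compat_r; lra).
      change (M ^ S (S (S k))) with (M * M ^ S (S k)).
      apply Rle_trans with (M * (CM * W (S (S k)))); [apply Rmult_le_compat_l; lra|].
      replace (M * (CM * W (S (S k)))) with (M * CM / c0 * (c0 * W (S (S k)))) by (field; lra).
      apply Rle_trans with (M * CM / c0 * ((INR (S (S k)) + a) * W (S (S k)))).
      + apply Rmult_le_compat_l; lra.
      + unfold Cp. assert (0 <= 2 * CM * ((INR (S (S k)) + a) * W (S (S k)))).
        { apply Rmult_le_pos; [lra|]. apply Rmult_le_pos; lra. }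
        lra. }
  assert (Hfk : Rabs (f (S (S k))) <= Cf * (1/2) ^ (S (S k)) * u).
  { apply Rle_trans with (1 := Hf _).
    assert (tau ^ (S (S k)) <= (1 / 2 * M) ^ (S (S k))).
    { apply pow_incr. unfold M. lra. }
    rewrite Rpow_mult_distr in H. unfold Cf.
    assert (0 < (1/2) ^ (S (S k))) by (apply pow_lt; lra).
    apply Rle_trans with (B * ((1/2) ^ (S (S k)) * (Cp * u))).
    - apply Rmult_le_compat_l; [lra|]. apply Rle_trans with (1 := H).
      apply Rmult_le_compat_l; lra.
    - right. ring. }
  assert (Hg : Rabs (PS_g f h mu m (S (S k))) <= beta (S (S k)) * u).
  { assert (Hmi : forall i, (i < S (S k))%nat -> Rabs (m i) <= C0 * W i).
    { intros i Hi. apply (IH i Hi). apply (low_le _ _ _ _ _ _ _ HT) with (S (S k)); [lia | exact Hk]. }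
    apply Rle_trans with (1 := PS_g_majorant f h mu tau m (fun i => C0 * W i) (S (S k)) Htau (proj1 Hmu) Hh Hmi).
    pose proof (HH e a W k HT Hk) as HHk.
    unfold beta. rewrite Rmult_plus_distr_r. apply Rplus_le_compat; [exact Hfk|].
    assert (HW : W k <= telescope c0 (S (S k)) * u).
    { destruct k as [|[|k]]; [rewrite W0; simpl; lra | rewrite W1; simpl; lra|].
      rewrite Hu3 by lia.
      assert (Hs := W_step _ _ _ _ _ _ _ HT (S (S k)) ltac:(lia) Hk1).
      destruct (index_pos _ _ _ _ _ _ _ HT (S (S k)) ltac:(lia)) as [Hi _].
      destruct (index_pos _ _ _ _ _ _ _ HT (S (S (S k))) ltac:(lia)) as [Hi' _].
      change (telescope c0 (S (S (S (S k))))) with (/ (INR k + c0) - / (INR (S k) + c0)).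
      rewrite !S_INR in *. pose proof (pos_INR k) as Pk.
      replace (/ (INR k + c0) - / (INR k + 1 + c0)) with (/ (INR k + c0) * / (INR k + 1 + c0))
        by (field; lra).
      pose proof (Wn (S (S k))) as W2. pose proof (Wn (S (S (S k)))) as W3.
      assert (Q1 : (INR k + c0) * W (S (S k)) <= W (S (S (S k)))).
      { apply Rle_trans with (2 := Hs). apply Rmult_le_compat_r; lra. }
      assert (Q2 : (INR k + 1 + c0) * W (S (S (S k))) <= (INR k + 1 + 1 + 1 + a) * W (S (S (S k)))).
      { apply Rmult_le_compat_r; lra. }
      apply Rmult_le_reg_l with ((INR k + c0) * (INR k + 1 + c0)); [nra|].
      replace ((INR k + c0) * (INR k + 1 + c0) * (/ (INR k + c0) * / (INR k + 1 + c0) *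
         ((INR k + 1 + 1 + 1 + a) * W (S (S (S k)))))) with ((INR k + 1 + 1 + 1 + a) * W (S (S (S k))))
        by (field; lra).
      apply Rle_trans with (2 := Q2).
      replace ((INR k + c0) * (INR k + 1 + c0) * W (S (S k))) with ((INR k + 1 + c0) * ((INR k + c0) * W (S (S k)))) by ring.
      apply Rmult_le_compat_l; lra. }
    apply Rle_trans with (mu * (C2 * W k)); [apply Rmult_le_compat_l; lra|].
    apply Rle_trans with (mu0 * (C2 * W k)).
    - apply Rmult_le_compat_r; [|lra]. apply Rmult_le_pos; [lra | apply Wn].
    - replace (mu0 * (C2 * W k)) with (c0 * W k) by (unfold mu0; field; lra).
      rewrite Rmult_assoc. apply Rmult_le_compat_l; lra. }
  assert (Hinc : increment e f h mu W m (S (S k)) = (-1) ^ (S (S k)) * PS_g f h mu m (S (S k)) / u) by reflexivity.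
  assert (Hd : Rabs (increment e f h mu W m (S (S k))) <= beta (S (S k))).
  { rewrite Hinc. unfold Rdiv. rewrite !Rabs_mult, pow_m1_abs, Rmult_1_l.
    rewrite (Rabs_pos_eq (/ u)) by (left; apply Rinv_0_lt_compat, Hu).
    apply Rmult_le_reg_r with u; [exact Hu|].
    rewrite Rmult_assoc, Rinv_l, Rmult_1_r by lra. exact Hg. }
  assert (Hm : m (S (S k)) = (-1) ^ S (S k) * W (S (S k)) * sum_f_R0 (increment e f h mu W m) (S (S k))).
  { specialize (Hrec k).
    assert (Hprev : (INR (S k) + a) * m (S k) = - (-1) ^ (S (S k)) * u * sum_f_R0 (increment e f h mu W m) (S k)).
    { destruct k as [|k].
      - rewrite m1. rewrite (sum_zero (increment e f h mu W m) 1); [ring|].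
        intros i Hi. destruct i as [|[|]]; [reflexivity | reflexivity | lia].
      - destruct (IH (S (S k)) ltac:(lia) Hk1) as (_ & E & _). rewrite E, (Hu3 ltac:(lia)).
        simpl pow. ring. }
    rewrite sum_S, Hinc.
    assert (H1 : 0 < 1 - e * INR (S (S k))) by lra.
    apply Rmult_eq_reg_l with (1 - e * INR (S (S k))); [|lra].
    assert (HWk : W (S (S k)) <> 0) by (pose proof (Wp (S (S k)) ltac:(lia)); lra).
    replace ((1 - e * INR (S (S k))) * m (S (S k))) with
       (PS_g f h mu m (S (S k)) - (INR (S k) + a) * m (S k)) by lra.
    rewrite Hprev.
    set (s := sum_f_R0 (increment e f h mu W m) (S k)).
    set (gk := PS_g f h mu m (S (S k))).
    pose proof (pow_m1_sqr (S (S k))) as Hs. set (sg := (-1) ^ S (S k)) in *.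
    transitivity (sg * u * s + sg * sg * gk); [rewrite Hs; ring|].
    replace ((1 - e * INR (S (S k))) * (sg * W (S (S k)) * (s + sg * gk / u))) with
      (sg * u * s + sg * sg * gk * (u / u)) by (unfold u at 2; unfold Rdiv; unfold u at 1; unfold u; ring).
    unfold Rdiv. rewrite Rinv_r by lra. ring. }
  split; [exact Hd|]. split; [exact Hm|].
  rewrite Hm, !Rabs_mult, pow_m1_abs, Rmult_1_l, (Rabs_pos_eq (W _)) by apply Wn.
  rewrite Rmult_comm. apply Rmult_le_compat_r; [apply Wn|].
  apply Rle_trans with (1 := Rsum_abs _ _).
  apply Rle_trans with (2 := Hbs (S (S k))). apply sum_Rle. intros j Hj.
  destruct (Nat.eq_dec j (S (S k))) as [->|Hne]; [exact Hd|].
  apply (IH j ltac:(lia)). apply (low_le _ _ _ _ _ _ _ HT) with (S (S k)); [lia | exact Hk].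
Qed.

End LowBound.

(** * The linear operator and its comparison principle *)

(** The coefficients of [x (e - x) y' - (1 + a x) y] for [y = sum b_k x^k]. *)
Definition Lcoef (e a : R) (b : nat -> R) (k : nat) : R :=
  match k with
  | O => - b 0%nat
  | S j => (e * INR (S j) - 1) * b (S j) - (INR j + a) * b j
  end.

Lemma L_pseries e a b x :
  Rbar_lt (Rabs x) (CV_radius b) ->
  is_pseries (Lcoef e a b) x
    (x * (e - x) * Derive (PSeries b) x - (1 + a * x) * PSeries b x).
Proof.
  intros Hx.
  pose proof (is_pseries_derive b x Hx) as HD.
  pose proof (PSeries_correct b x (CV_radius_inside b x Hx)) as HP.
  pose proof (is_pseries_incr_1 _ _ _ HD) as HD1.
  pose proof (is_pseries_incr_1 _ _ _ HD1) as HD2.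
  pose proof (is_pseries_incr_1 _ _ _ HP) as HP1.
  apply is_pseries_R in HP, HD1, HD2, HP1. apply is_pseries_R.
  pose proof (is_series_scal_l e _ _ HD1) as S1.
  pose proof (is_series_scal_l (-1) _ _ HD2) as S2.
  pose proof (is_series_scal_l (-1) _ _ HP) as S3.
  pose proof (is_series_scal_l (- a) _ _ HP1) as S4.
  pose proof (is_series_plus _ _ _ _ (is_series_plus _ _ _ _ S1 S2) (is_series_plus _ _ _ _ S3 S4)) as S.
  assert (E : x * (e - x) * Derive (PSeries b) x - (1 + a * x) * PSeries b x =
    plus (plus (e * (scal x (Derive (PSeries b) x))) (-1 * scal x (scal x (Derive (PSeries b) x))))
         (plus (-1 * PSeries b x) (- a * scal x (PSeries b x)))).
  { unfold plus, scal; simpl. unfold mult; simpl. ring. }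
  rewrite E. revert S. apply is_series_ext. intros [|[|k]].
  - change (e * (0 * x ^ 0) + -1 * (0 * x ^ 0) + (-1 * (b 0%nat * x ^ 0) + - a * (0 * x ^ 0))
            = - b 0%nat * x ^ 0). ring.
  - change (e * (INR 1 * b 1%nat * x ^ 1) + -1 * (0 * x ^ 1)
            + (-1 * (b 1%nat * x ^ 1) + - a * (b 0%nat * x ^ 1))
            = ((e * INR 1 - 1) * b 1%nat - (INR 0 + a) * b 0%nat) * x ^ 1). simpl INR. ring.
  - change (e * (INR (S (S k)) * b (S (S k)) * x ^ S (S k)) + -1 * (INR (S k) * b (S k) * x ^ S (S k))
            + (-1 * (b (S (S k)) * x ^ S (S k)) + - a * (b (S k) * x ^ S (S k)))
            = ((e * INR (S (S k)) - 1) * b (S (S k)) - (INR (S k) + a) * b (S k)) * x ^ S (S k)). ring.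
Qed.

Lemma psum_finite b x n :
  (forall k, (n < k)%nat -> b k = 0) -> is_pseries b x (psum b x n).
Proof.
  intros H. apply is_pseries_R.
  apply (filterlim_ext_loc (fun _ => psum b x n)); [|apply filterlim_const].
  exists n. intros k Hk. rewrite sum_n_Reals. unfold psum. induction Hk; [reflexivity|].
  rewrite sum_S, <- IHHk, H by lia. ring.
Qed.

Lemma finite_radius b x n :
  (forall k, (n < k)%nat -> b k = 0) -> Rbar_lt (Rabs x) (CV_radius b).
Proof.
  intros H. apply Rbar_lt_le_trans with (Finite (Rabs x + 1)); [simpl; lra|].
  apply abs_bounded_radius with (psum (fun k => Rabs (b k)) (Rabs x + 1) n).
  - pose proof (Rabs_pos x); lra.
  - assert (HX : 0 <= Rabs x + 1) by (pose proof (Rabs_pos x); lra).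
    intros L. destruct (le_lt_dec L n) as [Hl|Hl].
    + apply psum_mono_len; auto. intros; apply Rabs_pos.
    + right. assert (HL : (n <= L)%nat) by lia. clear Hl. unfold psum. induction HL; [reflexivity|].
      rewrite sum_S, IHHL, H by lia. rewrite Rabs_R0. ring.
Qed.

(** The homogeneous solution of [x (e - x) u' = (1 + a x) u] is
    [x^(1/e) (e - x)^(-1/e-a)]: a subsolution that vanishes at the origin to
    an order above [1 / e] divided by it decreases from 0. *)
Lemma comparison e a n r (u u' : R -> R) (C : R) :
  0 < r < e -> 1 < e * INR n ->
  (forall x, 0 < x <= r -> is_derive u x (u' x) /\ x * (e - x) * u' x <= (1 + a * x) * u x) ->
  (forall x, 0 < x <= r -> u x <= C * x ^ n) ->
  forall x, 0 < x <= r -> u x <= 0.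
Proof.
  intros Hr Hn Hd HC x1 Hx1. apply Rnot_lt_le. intros Hpos.
  assert (He : 0 < e) by lra.
  set (al := / e). set (be := / e + a).
  set (Psi := fun x => exp (be * ln (e - x) - al * ln x)).
  set (P := fun x => u x * Psi x).
  assert (HP : forall x, 0 < x <= r -> is_derive P x
     (u' x * Psi x + u x * (Psi x * (- be / (e - x) - al / x)))).
  { intros x Hx. destruct (Hd x Hx) as [D _]. unfold P.
    apply (is_derive_mult u Psi x (u' x) (Psi x * (- be / (e - x) - al / x))); [exact D | | intros; apply Rmult_comm].
    unfold Psi. auto_derive; [repeat split; lra|].
    unfold Rdiv, Rminus. ring. }
  assert (HPd : forall x, 0 < x <= r -> u' x * Psi x + u x * (Psi x * (- be / (e - x) - al / x)) <= 0).
  { intros x Hx. destruct (Hd x Hx) as [_ D].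
    replace (u' x * Psi x + u x * (Psi x * (- be / (e - x) - al / x))) with
      (Psi x * / (x * (e - x)) * (x * (e - x) * u' x - (1 + a * x) * u x)).
    2:{ unfold be, al. field. lra. }
    assert (0 < Psi x * / (x * (e - x))).
    { apply Rmult_lt_0_compat; [apply exp_pos | apply Rinv_0_lt_compat; nra]. }
    nra. }
  assert (Hdec : forall x, 0 < x < x1 -> P x1 <= P x).
  { intros x Hx.
    destruct (MVT_gen P x x1 (fun y => u' y * Psi y + u y * (Psi y * (- be / (e - y) - al / y)))) as [c [Hc E]].
    - intros y Hy. rewrite Rmin_left, Rmax_right in Hy by lra. apply HP. lra.
    - intros y Hy. rewrite Rmin_left, Rmax_right in Hy by lra.
      apply continuity_pt_filterlim. apply (ex_derive_continuous P y).
      eexists. apply HP. lra.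
    - rewrite Rmin_left, Rmax_right in Hc by lra.
      assert (u' c * Psi c + u c * (Psi c * (- be / (e - c) - al / c)) <= 0) by (apply HPd; lra).
      nra. }
  assert (HP1 : 0 < P x1) by (apply Rmult_lt_0_compat; [exact Hpos | apply exp_pos]).
  set (dl := INR n - al).
  assert (Hdl : 0 < dl).
  { unfold dl, al. apply Rmult_lt_reg_l with e; [lra|]. rewrite Rmult_0_r, Rmult_minus_distr_l, Rinv_r; lra. }
  set (B := exp (Rabs be * (Rabs (ln e) + Rabs (ln (e - r))))).
  assert (HB : 0 < B) by apply exp_pos.
  assert (HPu : forall x, 0 < x <= r -> P x <= Rabs C * B * exp (dl * ln x)).
  { intros x Hx. unfold P.
    apply Rle_trans with (Rabs C * x ^ n * Psi x).
    - apply Rmult_le_compat_r; [left; apply exp_pos|]. apply Rle_trans with (1 := HC x Hx).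
      apply Rmult_le_compat_r; [apply pow_le; lra | apply Rle_abs].
    - rewrite <- (Rpower_pow n x) by lra. unfold Rpower, Psi.
      rewrite (Rmult_assoc _ (exp _) (exp _)), <- exp_plus.
      replace (INR n * ln x + (be * ln (e - x) - al * ln x)) with (be * ln (e - x) + dl * ln x)
        by (unfold dl; ring).
      rewrite exp_plus, <- Rmult_assoc. apply Rmult_le_compat_r; [left; apply exp_pos|].
      apply Rmult_le_compat_l; [apply Rabs_pos|]. apply exp_le_mono.
      apply Rle_trans with (1 := Rle_abs _). rewrite Rabs_mult.
      apply Rmult_le_compat_l; [apply Rabs_pos|].
      assert (L1 : ln (e - r) <= ln (e - x)) by (apply ln_le; lra).
      assert (L2 : ln (e - x) <= ln e) by (apply ln_le; lra).
      pose proof (Rle_abs (ln e)). pose proof (Rabs_pos (ln e)). pose proof (Rabs_pos (ln (e - r))).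
      pose proof (Rle_abs (- ln (e - r))) as L3. rewrite Rabs_Ropp in L3.
      apply Rabs_le. lra. }
  (* a point so close to 0 that the bound falls below P x1 *)
  set (t := Rmax (Rabs C * B / P x1 / dl) (1 - ln x1)).
  assert (Ht1 : Rabs C * B / P x1 / dl <= t) by apply Rmax_l.
  assert (Ht2 : 1 - ln x1 <= t) by apply Rmax_r.
  assert (Hxt : exp (- t) < x1).
  { rewrite <- (exp_ln x1) by lra. apply exp_increasing. lra. }
  pose proof (exp_pos (- t)) as Hxt0.
  pose proof (Hdec (exp (- t)) (conj Hxt0 Hxt)) as H1.
  pose proof (HPu (exp (- t)) ltac:(lra)) as H2. rewrite ln_exp in H2.
  assert (HCB : 0 <= Rabs C * B) by (apply Rmult_le_pos; [apply Rabs_pos | lra]).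
  assert (Hdt : Rabs C * B / P x1 <= dl * t).
  { apply Rmult_le_reg_r with (/ dl); [apply Rinv_0_lt_compat, Hdl|].
    replace (dl * t * / dl) with t by (field; lra). exact Ht1. }
  assert (Hdt0 : 0 <= dl * t).
  { apply Rle_trans with (2 := Hdt). apply Rmult_le_pos; [lra|]. left. apply Rinv_0_lt_compat, HP1. }
  assert (H3 : exp (dl * - t) <= / (1 + dl * t)).
  { replace (dl * - t) with (- (dl * t)) by ring. rewrite exp_Ropp.
    apply Rinv_le_contravar; [lra|]. apply exp_ineq1_le. }
  assert (H4 : Rabs C * B * exp (dl * - t) <= Rabs C * B * / (1 + dl * t))
    by (apply Rmult_le_compat_l; lra).
  assert (H5 : Rabs C * B <= P x1 * (dl * t)).
  { replace (Rabs C * B) with (P x1 * (Rabs C * B / P x1)) by (field; lra).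
    apply Rmult_le_compat_l; lra. }
  assert (H6 : Rabs C * B * / (1 + dl * t) < P x1).
  { apply Rmult_lt_reg_r with (1 + dl * t); [lra|].
    rewrite Rmult_assoc, Rinv_l by lra. lra. }
  lra.
Qed.

Definition tail (N : nat) (W : nat -> R) (k : nat) : R :=
  if le_dec N k then W k else 0.

Lemma growth_nonneg e a W k : growth e a W -> 0 <= W k.
Proof.
  intros (W0 & W1 & Wp & _). destruct k as [|[|k]]; [lra | lra | left; apply Wp; lia].
Qed.

(** The radius of convergence of [W] is [e]: the ratios of its
    terms tend to [1 / e]. *)
Lemma W_summable e a W q : 0 < e -> growth e a W -> 0 <= q < e ->
  exists M, forall L, psum W q L <= M.
Proof.
  intros He HW Hq. pose proof (growth_nonneg e a W) as Wn.
  destruct HW as (W0 & W1 & Wp & Wr) eqn:EW. clear EW.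
  assert (HWg : growth e a W) by (repeat split; auto).
  set (q' := (q + e) / 2). assert (Hq' : q < q' < e) by (unfold q'; lra).
  (* beyond this index the ratio of consecutive terms of W_k q'^k is below 1 *)
  destruct (nfloor_ex (Rmax 2 ((Rabs a * q' + 1) / (e - q')))) as [p Hp].
  { apply Rle_trans with (2 := Rmax_l _ _). lra. }
  set (K := S p).
  assert (HK2 : (2 <= K)%nat).
  { apply INR_le. unfold K. rewrite (S_INR p). change (INR 2) with (1 + 1). pose proof (Rmax_l 2 ((Rabs a * q' + 1) / (e - q'))). lra. }
  assert (HK : forall k, (K <= k)%nat -> W (S k) * q' ^ S k <= W k * q' ^ k).
  { intros k Hk. assert (Hk2 : (2 <= k)%nat) by lia.
    assert (Hk' : (Rabs a * q' + 1) / (e - q') <= INR k).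
    { apply le_INR in Hk. unfold K in Hk. rewrite S_INR in Hk.
      pose proof (Rmax_r 2 ((Rabs a * q' + 1) / (e - q'))). lra. }
    assert (Hk3 : Rabs a * q' + 1 <= INR k * (e - q')).
    { apply Rmult_le_reg_r with (/ (e - q')); [apply Rinv_0_lt_compat; lra|].
      replace (INR k * (e - q') * / (e - q')) with (INR k) by (field; lra). exact Hk'. }
    pose proof (Wr k Hk2) as HR. pose proof (Wn k HWg) as Wk. pose proof (Wn (S k) HWg) as WSk.
    pose proof (Rle_abs a) as Ha. pose proof (Rabs_pos a) as Ha0.
    rewrite S_INR in HR.
    assert (H1 : (INR k + a) * q' <= Rabs (1 - e * (INR k + 1))).
    { apply Rle_trans with (- (1 - e * (INR k + 1))).
      - assert (a * q' <= Rabs a * q') by (apply Rmult_le_compat_r; lra). lra.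
      - rewrite <- Rabs_Ropp. apply Rle_abs. }
    assert (H0 : 0 < Rabs (1 - e * (INR k + 1))).
    { rewrite <- Rabs_Ropp. apply Rlt_le_trans with (- (1 - e * (INR k + 1))); [|apply Rle_abs].
      pose proof (pos_INR k). assert (0 <= Rabs a * q') by (apply Rmult_le_pos; lra).
      assert (0 <= INR k * q') by (apply Rmult_le_pos; lra). lra. }
    assert (H2 : W (S k) * q' <= W k).
    { apply Rmult_le_reg_l with (Rabs (1 - e * (INR k + 1))); [exact H0|].
      rewrite <- Rmult_assoc, HR.
      replace ((INR k + a) * W k * q') with ((INR k + a) * q' * W k) by ring.
      apply Rmult_le_compat_r; lra. }
    simpl. rewrite <- Rmult_assoc. apply Rmult_le_compat_r; [apply pow_le; lra | exact H2]. }
  set (M1 := psum W q' K).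
  assert (HT : forall k, W k * q' ^ k <= M1).
  { intros k. destruct (le_lt_dec k K) as [Hk|Hk].
    - apply (sum_ge_term (fun k => W k * q' ^ k)); [|exact Hk].
      intros. apply Rmult_le_pos; [apply Wn; exact HWg | apply pow_le; lra].
    - assert (Hk' : (K <= k)%nat) by lia. clear Hk. induction Hk'.
      + apply (sum_ge_term (fun k => W k * q' ^ k)); [|lia].
        intros. apply Rmult_le_pos; [apply Wn; exact HWg | apply pow_le; lra].
      + apply Rle_trans with (2 := IHHk'). apply HK, Hk'. }
  set (t := q / q'). assert (Ht : 0 <= t < 1).
  { unfold t. split; [apply Rdiv_le_0_compat; lra|].
    apply Rmult_lt_reg_r with q'; [lra|]. unfold Rdiv. rewrite Rmult_assoc, Rinv_l; lra. }
  exists (M1 * / (1 - t)). intros L. unfold psum.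
  apply Rle_trans with (sum_f_R0 (fun k => M1 * t ^ k) L).
  - apply sum_Rle. intros k _.
    replace (q ^ k) with (q' ^ k * t ^ k).
    2:{ rewrite <- Rpow_mult_distr. f_equal. unfold t. field. lra. }
    rewrite <- Rmult_assoc. apply Rmult_le_compat_r; [apply pow_le; lra | apply HT].
  - rewrite sum_scal. apply Rmult_le_compat_l.
    + apply Rle_trans with (2 := HT 0%nat). apply Rmult_le_pos; [apply Wn; exact HWg | apply pow_le; lra].
    + rewrite tech3 by lra. unfold Rdiv. rewrite <- (Rmult_1_l (/ (1 - t))) at 2.
      apply Rmult_le_compat_r; [left; apply Rinv_0_lt_compat; lra|].
      assert (0 <= t ^ S L) by (apply pow_le; lra). lra.
Qed.

Lemma tail_bounds N W k : (forall k, 0 <= W k) -> 0 <= tail N W k <= W k.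
Proof. intros H. unfold tail. destruct (le_dec N k); pose proof (H k); lra. Qed.

Lemma tail_abs_bounded e a W N q : 0 < e -> growth e a W -> 0 <= q < e ->
  exists M, abs_bounded (tail N W) q M.
Proof.
  intros He HW Hq. destruct (W_summable e a W q He HW Hq) as [M HM]. exists M.
  apply abs_bounded_le with W; [lra | | exact HM].
  intros k. pose proof (tail_bounds N W k (fun k => growth_nonneg e a W k HW)).
  rewrite Rabs_pos_eq; lra.
Qed.

Lemma tail_radius e a W N x : 0 < e -> growth e a W -> Rabs x < e ->
  Rbar_lt (Rabs x) (CV_radius (tail N W)).
Proof.
  intros He HW Hx. pose proof (Rabs_pos x).
  destruct (tail_abs_bounded e a W N ((Rabs x + e) / 2) He HW) as [M HM]; [lra|].
  apply Rbar_lt_le_trans with (Finite ((Rabs x + e) / 2)); [simpl; lra|].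
  apply abs_bounded_radius with M; [lra | exact HM].
Qed.

(** The homogeneous recursion leaves only the term that enters at order
    [N + 1]. *)
Lemma tail_ode e a W N x : 0 < e -> growth e a W -> (2 <= N)%nat -> 1 < e * INR (S N) ->
  Rabs x < e ->
  x * (e - x) * Derive (PSeries (tail (S N) W)) x - (1 + a * x) * PSeries (tail (S N) W) x
  = (INR N + a) * W N * x ^ (S N).
Proof.
  intros He HW HN2 HN Hx.
  pose proof (L_pseries e a (tail (S N) W) x (tail_radius e a W (S N) x He HW Hx)) as HL.
  rewrite <- (is_pseries_unique _ _ _ HL).
  assert (Hc : forall k, Lcoef e a (tail (S N) W) k =
     if Nat.eq_dec k (S N) then (INR N + a) * W N else 0).
  { destruct HW as (_ & _ & _ & Wr). intros [|k].
    - unfold Lcoef, tail. destruct (le_dec (S N) 0); [lia|]. destruct (Nat.eq_dec 0 (S N)); [lia|]. ring.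
    - unfold Lcoef, tail.
      destruct (Nat.eq_dec (S k) (S N)) as [E|E].
      + injection E as ->. destruct (le_dec (S N) (S N)); [|lia]. destruct (le_dec (S N) N); [lia|].
        rewrite <- (Wr N HN2). rewrite Rabs_left by lra. ring.
      + destruct (le_dec (S N) (S k)), (le_dec (S N) k); try lia; [|ring].
        rewrite <- (Wr k) by lia. rewrite Rabs_left; [ring|].
        assert (INR (S N) <= INR (S k)) by (apply le_INR; lia). nra. }
  transitivity (PSeries (fun k => if Nat.eq_dec k (S N) then (INR N + a) * W N else 0) x).
  { apply PSeries_ext, Hc. }
  assert (HF : is_pseries (fun k => if Nat.eq_dec k (S N) then (INR N + a) * W N else 0) x
     (psum (fun k => if Nat.eq_dec k (S N) then (INR N + a) * W N else 0) x (S N))).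
  { apply psum_finite. intros k Hk. destruct (Nat.eq_dec k (S N)); [lia | reflexivity]. }
  etransitivity; [exact (is_pseries_unique _ _ _ HF)|].
  unfold psum. rewrite (sum_eq _ (fun k => if Nat.eq_dec k (S N) then (INR N + a) * W N * x ^ S N else 0)).
  - apply sum_indicator. lia.
  - intros i Hi. destruct (Nat.eq_dec i (S N)) as [->|]; ring.
Qed.

(** * Majorants of the nonlinear terms *)

(** Weighted sums of the majorant coefficients: [z l] stands for the [l]-th
    power of a series, or for the difference of two such powers. *)
Lemma hmaj_psum tau (z : nat -> nat -> R) X n :
  0 < tau -> 0 <= X -> (forall l i, (i <= n)%nat -> 0 <= z l i) ->
  psum (fun i => sum_f_R0 (fun k => sum_f_R0 (fun l => hmaj tau k l * z l (i - k)%nat) i) i) X n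
  <= sum_f_R0 (fun k => sum_f_R0 (fun l => hmaj tau k l * X ^ k * psum (z l) X n) n) n.
Proof.
  intros Ht HX Hz. unfold psum at 1.
  pose proof (fun k l => hmaj_nonneg tau k l Ht) as Hh.
  apply Rle_trans with (sum_f_R0 (fun i => sum_f_R0 (fun k =>
     (fun k j => sum_f_R0 (fun l => hmaj tau k l * X ^ k * (z l j * X ^ j)) n) k (i - k)%nat) i) n).
  - apply sum_Rle. intros i Hi. rewrite Rmult_comm, <- sum_scal. apply sum_Rle. intros k Hk.
    rewrite <- sum_scal.
    apply Rle_trans with (sum_f_R0 (fun l => hmaj tau k l * X ^ k * (z l (i - k)%nat * X ^ (i - k))) i).
    + right. apply sum_eq. intros l Hl.
      replace (X ^ i) with (X ^ k * X ^ (i - k)) by (rewrite <- pow_add; f_equal; lia). ring.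
    + apply sum_mono_len; [|exact Hi]. intros l _.
      apply Rmult_le_pos; apply Rmult_le_pos; try apply pow_le; auto. apply Hz. lia.
  - rewrite (sum_triangle (fun k j => sum_f_R0 (fun l => hmaj tau k l * X ^ k * (z l j * X ^ j)) n)).
    apply sum_Rle. intros k Hk. rewrite sum_swap. apply sum_Rle. intros l Hl.
    rewrite sum_scal. apply Rmult_le_compat_l; [apply Rmult_le_pos; [apply Hh | apply pow_le, HX]|].
    unfold psum. apply sum_mono_len; [|lia]. intros j Hj. apply Rmult_le_pos; [apply Hz; lia | apply pow_le, HX].
Qed.

(** Used with [b l = E^l], or with the bound [l E^(l-1) q] for the difference of
    two powers, when [th = 2 tau E]. *)
Lemma hmaj_double_sum tau X (b : nat -> R) Q th n :
  0 < tau -> 0 <= X -> tau * X <= 1 / 2 -> 0 <= th <= 1 / 2 -> 0 <= Q ->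
  (forall l, 0 <= b l) ->
  (forall l, tau ^ (S l) * b (S l) <= Q * th ^ l) ->
  sum_f_R0 (fun k => sum_f_R0 (fun l => hmaj tau k l * X ^ k * b l) n) n
  <= 2 * (tau * X) * (th + 2 * (tau * X)) * Q.
Proof.
  intros Ht HX HtX Hth HQ Hb0 Hb.
  pose proof (fun k l => hmaj_nonneg tau k l Ht) as Hh.
  set (w := tau * X) in *. assert (Hw : 0 <= w) by (unfold w; apply Rmult_le_pos; lra).
  assert (Hnn : forall k m, 0 <= sum_f_R0 (fun l => hmaj tau k l * X ^ k * b l) m).
  { intros k m. apply sum_nonneg. intros l _. apply Rmult_le_pos; [|apply Hb0].
    apply Rmult_le_pos; [apply Hh | apply pow_le, HX]. }
  apply Rle_trans with (sum_f_R0 (fun k => sum_f_R0 (fun l => hmaj tau k l * X ^ k * b l) (S (S n))) (S (S n))).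
  { apply Rle_trans with (sum_f_R0 (fun k => sum_f_R0 (fun l => hmaj tau k l * X ^ k * b l) (S (S n))) n).
    - apply sum_Rle. intros k _. apply sum_mono_len; [|lia]. intros l _.
      apply Rmult_le_pos; [|apply Hb0]. apply Rmult_le_pos; [apply Hh | apply pow_le, HX].
    - apply sum_mono_len; [|lia]. intros k _. apply Hnn. }
  assert (H1 : sum_f_R0 (fun l => hmaj tau 1 l * X ^ 1 * b l) (S (S n)) <= w * (2 * th) * Q).
  { rewrite sum_shift, (sum_shift _ n). simpl (hmaj tau 1 0). simpl (hmaj tau 1 1).
    rewrite !Rmult_0_l, !Rplus_0_l.
    apply Rle_trans with (w * th * Q * sum_f_R0 (fun l => th ^ l) n).
    - rewrite <- sum_scal. apply sum_Rle. intros l _.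
      specialize (Hb (S l)).
      replace (hmaj tau 1 (S (S l)) * X ^ 1 * b (S (S l))) with (w * (tau ^ (S (S l)) * b (S (S l))))
        by (unfold hmaj, w; simpl; ring).
      replace (w * th * Q * th ^ l) with (w * (Q * th ^ S l)) by (simpl; ring).
      apply Rmult_le_compat_l; lra.
    - pose proof (geom_sum_le2 th n Hth).
      replace (w * (2 * th) * Q) with (w * th * Q * 2) by ring.
      apply Rmult_le_compat_l; [|assumption]. repeat apply Rmult_le_pos; lra. }
  assert (H2 : forall k, sum_f_R0 (fun l => hmaj tau (S (S k)) l * X ^ (S (S k)) * b l) (S (S n))
              <= w * w * (2 * Q) * w ^ k).
  { intros k. rewrite sum_shift. simpl (hmaj tau (S (S k)) 0). rewrite !Rmult_0_l, !Rplus_0_l.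
    apply Rle_trans with (w * w * Q * w ^ k * sum_f_R0 (fun l => th ^ l) (S n)).
    - rewrite <- sum_scal. apply sum_Rle. intros l _.
      replace (hmaj tau (S (S k)) (S l) * X ^ S (S k) * b (S l)) with
        (w * w * w ^ k * (tau ^ (S l) * b (S l))).
      2:{ replace (hmaj tau (S (S k)) (S l)) with (tau ^ (S (S k) + S l)) by (destruct l; reflexivity).
          rewrite pow_add. unfold w. rewrite Rpow_mult_distr. simpl. ring. }
      replace (w * w * Q * w ^ k * th ^ l) with (w * w * w ^ k * (Q * th ^ l)) by ring.
      apply Rmult_le_compat_l; [|apply Hb]. repeat apply Rmult_le_pos; try lra. apply pow_le; lra.
    - pose proof (geom_sum_le2 th (S n) Hth).
      replace (w * w * (2 * Q) * w ^ k) with (w * w * Q * w ^ k * 2) by ring.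
      apply Rmult_le_compat_l; [|assumption]. repeat apply Rmult_le_pos; try lra. apply pow_le; lra. }
  rewrite sum_shift, (sum_shift _ n).
  rewrite (sum_zero (fun l => hmaj tau 0 l * X ^ 0 * b l)) by (intros; unfold hmaj; ring).
  assert (H3 : sum_f_R0 (fun k => sum_f_R0 (fun l => hmaj tau (S (S k)) l * X ^ (S (S k)) * b l) (S (S n))) n
     <= w * w * (2 * Q) * 2).
  { apply Rle_trans with (sum_f_R0 (fun k => w * w * (2 * Q) * w ^ k) n).
    - apply sum_Rle. intros k _. apply H2.
    - rewrite sum_scal. apply Rmult_le_compat_l; [repeat apply Rmult_le_pos; lra|].
      apply geom_sum_le2. lra. }
  lra.
Qed.

Lemma Hmaj_psum tau y X n E : 0 < tau -> 0 <= X -> tau * X <= 1 / 2 ->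
  (forall i, 0 <= y i) -> psum y X n <= E -> tau * E <= 1 / 4 ->
  psum (Hmaj tau y) X n <= 2 * (tau * X) * (2 * (tau * E) + 2 * (tau * X)) * (tau * E).
Proof.
  intros Ht HX HtX Hy HE HtE.
  assert (HE0 : 0 <= psum y X n) by (apply psum_nonneg; auto).
  assert (HtE0 : 0 <= tau * E) by (apply Rmult_le_pos; lra).
  unfold Hmaj.
  apply Rle_trans with (1 := hmaj_psum tau (PS_pow y) X n Ht HX
     (fun l i _ => PS_pow_nonneg y l i (fun j _ => Hy j))).
  apply hmaj_double_sum; auto; try lra.
  - intros l. apply psum_nonneg; auto. intros. apply PS_pow_nonneg. auto.
  - intros l.
    assert (Hab : abs_bounded (PS_pow (fun i => if le_dec i n then y i else 0) (S l)) X (E ^ S l)).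
    { apply PS_pow_abs_bounded; [exact HX|]. intros L.
      apply Rle_trans with (2 := HE).
      destruct (le_lt_dec L n) as [HL|HL].
      - apply Rle_trans with (psum y X L).
        + apply psum_le; auto. intros k Hk. destruct (le_dec k n); [|lia]. rewrite Rabs_pos_eq; auto. lra.
        + apply psum_mono_len; auto.
      - right. assert (HnL : (n <= L)%nat) by lia. clear HL. unfold psum. induction HnL.
        + apply sum_eq. intros k Hk. destruct (le_dec k n); [|lia]. rewrite Rabs_pos_eq; auto.
        + rewrite sum_S, IHHnL. destruct (le_dec (S m) n); [lia|]. rewrite Rabs_R0. ring. }
    apply Rle_trans with (tau ^ S l * E ^ S l).
    + apply Rmult_le_compat_l; [apply pow_le; lra|]. apply Rle_trans with (2 := Hab n).
      apply psum_le; auto. intros k Hk. apply Rle_trans with (2 := Rle_abs _).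
      apply Rle_trans with (1 := Rle_abs _). apply PS_pow_abs. intros i Hi.
      destruct (le_dec i n); [|lia]. rewrite Rabs_pos_eq; auto. lra.
    + rewrite <- Rpow_mult_distr. simpl. apply Rmult_le_compat_l; [exact HtE0|].
      apply pow_incr. lra.
Qed.

Lemma PS_pow_psum y X n E l : 0 <= X -> (forall i, 0 <= y i) -> psum y X n <= E ->
  psum (PS_pow y l) X n <= E ^ l.
Proof.
  intros HX Hy HE.
  assert (HE0 : 0 <= psum y X n) by (apply psum_nonneg; auto).
  induction l.
  - simpl. unfold psum. destruct n; [simpl; lra|]. rewrite sum_shift, sum_zero; [simpl; lra|].
    intros; simpl; ring.
  - rewrite PS_pow_S. simpl pow.
    apply Rle_trans with (1 := psum_mult_le y (PS_pow y l) X n HX Hy (fun k => PS_pow_nonneg y l k (fun j _ => Hy j))).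
    apply Rmult_le_compat; auto. apply psum_nonneg; auto. intros. apply PS_pow_nonneg; auto.
Qed.

(** Telescoping [y^(l+1) - p^(l+1) = y (y^l - p^l) + (y - p) p^l]. *)
Lemma PS_pow_diff y p X n E l : 0 <= X -> (forall i, 0 <= p i <= y i) -> psum y X n <= E ->
  (forall k, 0 <= PS_pow y l k - PS_pow p l k) /\
  psum (fun k => PS_pow y (S l) k - PS_pow p (S l) k) X n
    <= INR (S l) * E ^ l * psum (fun k => y k - p k) X n.
Proof.
  intros HX Hp HE.
  assert (Hy0 : forall i, 0 <= y i) by (intros i; pose proof (Hp i); lra).
  assert (Hp0 : forall i, 0 <= p i) by (intros i; pose proof (Hp i); lra).
  assert (Hq0 : forall i, 0 <= y i - p i) by (intros i; pose proof (Hp i); lra).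
  assert (HE0 : 0 <= psum y X n) by (apply psum_nonneg; auto).
  assert (Hq : 0 <= psum (fun k => y k - p k) X n) by (apply psum_nonneg; auto).
  assert (HD : forall l k, 0 <= PS_pow y l k - PS_pow p l k).
  { intros l' k. pose proof (PS_pow_abs p y l' k) as H.
    rewrite Rabs_pos_eq in H by (apply PS_pow_nonneg; auto).
    assert (PS_pow p l' k <= PS_pow y l' k) by (apply H; intros; rewrite Rabs_pos_eq; [apply Hp | auto]). lra. }
  split; [apply HD|].
  assert (HpE : psum p X n <= E).
  { apply Rle_trans with (2 := HE). apply psum_le; auto. intros; apply Hp. }
  assert (Hsp : forall l', psum (fun k => PS_pow y (S l') k - PS_pow p (S l') k) X n <=
     E * psum (fun k => PS_pow y l' k - PS_pow p l' k) X n + E ^ l' * psum (fun k => y k - p k) X n).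
  { intros l'.
    replace (psum (fun k => PS_pow y (S l') k - PS_pow p (S l') k) X n) with
      (psum (PS_mult y (fun k => PS_pow y l' k - PS_pow p l' k)) X n
       + psum (PS_mult (fun k => y k - p k) (PS_pow p l')) X n).
    2:{ rewrite <- psum_plus. unfold psum. apply sum_eq. intros i Hi. f_equal.
        rewrite !PS_pow_S. unfold PS_mult. rewrite <- plus_sum.
        rewrite <- minus_sum. apply sum_eq. intros; ring. }
    apply Rplus_le_compat.
    - apply Rle_trans with (1 := psum_mult_le _ _ X n HX Hy0 (HD l')).
      apply Rmult_le_compat_r; [apply psum_nonneg; auto | exact HE].
    - apply Rle_trans with (1 := psum_mult_le _ _ X n HX Hq0 (fun k => PS_pow_nonneg p l' k (fun j _ => Hp0 j))).
      rewrite Rmult_comm. apply Rmult_le_compat_r; [exact Hq|]. apply PS_pow_psum; auto. }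
  induction l.
  - apply Rle_trans with (1 := Hsp 0%nat).
    replace (psum (fun k => PS_pow y 0 k - PS_pow p 0 k) X n) with 0.
    + simpl. lra.
    + unfold psum. rewrite sum_zero; [reflexivity|]. intros. simpl. ring.
  - apply Rle_trans with (1 := Hsp (S l)).
    assert (HEl : 0 <= E) by lra.
    apply Rle_trans with (E * (INR (S l) * E ^ l * psum (fun k => y k - p k) X n) + E ^ S l * psum (fun k => y k - p k) X n).
    + apply Rplus_le_compat_r. apply Rmult_le_compat_l; auto.
    + right. rewrite (S_INR (S l)). simpl pow. ring.
Qed.

Lemma INR_le_pow2 l : INR (S l) <= 2 ^ l.
Proof.
  induction l; [simpl; lra|]. rewrite S_INR. change (2 ^ S l) with (2 * 2 ^ l).
  assert (1 <= 2 ^ l) by (apply pow_R1_Rle; lra). lra.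
Qed.

Lemma Hmaj_diff tau y p X n E : 0 < tau -> 0 <= X -> tau * X <= 1 / 2 ->
  (forall i, 0 <= p i <= y i) -> psum y X n <= E -> tau * E <= 1 / 4 ->
  (forall i, 0 <= Hmaj tau y i - Hmaj tau p i) /\
  psum (fun i => Hmaj tau y i - Hmaj tau p i) X n
  <= 2 * (tau * X) * (2 * (tau * E) + 2 * (tau * X)) * (tau * psum (fun k => y k - p k) X n).
Proof.
  intros Ht HX HtX Hp HE HtE.
  assert (Hq0 : forall i, 0 <= y i - p i) by (intros i; pose proof (Hp i); lra).
  assert (HE0 : 0 <= psum y X n) by (apply psum_nonneg; auto; intros i; pose proof (Hp i); lra).
  assert (HtE0 : 0 <= tau * E) by (apply Rmult_le_pos; lra).
  assert (Hq : 0 <= psum (fun k => y k - p k) X n) by (apply psum_nonneg; auto).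
  assert (Heq : forall i, Hmaj tau y i - Hmaj tau p i =
     sum_f_R0 (fun k => sum_f_R0 (fun l => hmaj tau k l * (PS_pow y l (i - k) - PS_pow p l (i - k))) i) i).
  { intros i. unfold Hmaj. rewrite <- minus_sum. apply sum_eq. intros k Hk.
    rewrite <- minus_sum. apply sum_eq. intros; ring. }
  split.
  - intros i. rewrite Heq. apply sum_nonneg. intros k _. apply sum_nonneg. intros l _.
    apply Rmult_le_pos; [apply hmaj_nonneg, Ht|]. apply (PS_pow_diff y p X n E l HX Hp HE).
  - unfold psum at 1.
    rewrite (sum_eq _ (fun i => sum_f_R0 (fun k => sum_f_R0 (fun l => hmaj tau k l * (PS_pow y l (i - k) - PS_pow p l (i - k))) i) i * X ^ i))
      by (intros; rewrite Heq; reflexivity).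
    apply Rle_trans with (1 := hmaj_psum tau (fun l i => PS_pow y l i - PS_pow p l i) X n Ht HX
        (fun l i _ => proj1 (PS_pow_diff y p X n E l HX Hp HE) i)).
    apply hmaj_double_sum; auto; try lra.
    + apply Rmult_le_pos; lra.
    + intros l. apply psum_nonneg; auto. apply (PS_pow_diff y p X n E l HX Hp HE).
    + intros l. destruct (PS_pow_diff y p X n E l HX Hp HE) as [_ HD].
      apply Rle_trans with (tau ^ S l * (INR (S l) * E ^ l * psum (fun k => y k - p k) X n)).
      * apply Rmult_le_compat_l; [apply pow_le; lra | exact HD].
      * apply Rle_trans with (tau ^ S l * (2 ^ l * E ^ l * psum (fun k => y k - p k) X n)).
        -- apply Rmult_le_compat_l; [apply pow_le; lra|]. apply Rmult_le_compat_r; [exact Hq|].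
           apply Rmult_le_compat_r; [|apply INR_le_pow2].
           apply pow_le. apply Rmult_le_reg_l with tau; lra.
        -- right. rewrite !Rpow_mult_distr. simpl pow. ring.
Qed.

(** * The solution above the resonance *)

Definition above (N : nat) (z : nat -> R) (k : nat) : R :=
  if lt_dec N k then z k else 0.

Definition below (N : nat) (z : nat -> R) (k : nat) : R :=
  if lt_dec k N then z k else 0.

(** A series of order above [N] gains the factor [(X / Y)^(N+1)] when the
    radius shrinks from [Y] to [X]. *)
Lemma above_psum N z X Y n : 0 <= X <= Y -> 0 < Y -> (forall k, 0 <= z k) ->
  psum (above N z) X n <= X ^ S N / Y ^ S N * psum z Y n.
Proof.
  intros HX HY Hz. assert (HYN : 0 < Y ^ S N) by (apply pow_lt, HY).
  rewrite <- psum_scal with (y := z). unfold psum. apply sum_Rle. intros k _. unfold above.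
  assert (HXN : 0 <= X ^ S N / Y ^ S N) by (apply Rdiv_le_0_compat; [apply pow_le; lra | exact HYN]).
  destruct (lt_dec N k).
  - replace k with (S N + (k - S N))%nat at 2 4 by lia. rewrite !pow_add.
    replace (X ^ S N / Y ^ S N * z k * (Y ^ S N * Y ^ (k - S N))) with
      (z k * (X ^ S N * Y ^ (k - S N))) by (field; lra).
    apply Rmult_le_compat_l; [apply Hz|]. apply Rmult_le_compat_l; [apply pow_le; lra|].
    apply pow_incr; lra.
  - rewrite Rmult_0_l. apply Rmult_le_pos; [apply Rmult_le_pos; [exact HXN | apply Hz] | apply pow_le; lra].
Qed.

Lemma tail_split N W X L : (forall k, 0 <= W k) -> 0 <= X ->
  psum (tail N W) X L <= W N * X ^ N + psum (tail (S N) W) X L /\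
  W N * X ^ N + psum (tail (S N) W) X L <= psum (tail N W) X (N + L).
Proof.
  intros HW HX.
  assert (HWX : 0 <= W N * X ^ N) by (apply Rmult_le_pos; [apply HW | apply pow_le, HX]).
  assert (E : forall M, (N <= M)%nat -> psum (tail N W) X M = W N * X ^ N + psum (tail (S N) W) X M).
  { intros M HM. rewrite <- (sum_indicator (W N * X ^ N) N M HM). unfold psum.
    rewrite <- plus_sum. apply sum_eq. intros k Hk. unfold tail.
    destruct (Nat.eq_dec k N) as [->|Hne].
    - destruct (le_dec N N), (le_dec (S N) N); try lia. ring.
    - destruct (le_dec N k), (le_dec (S N) k); try lia; ring. }
  assert (Hn : forall M, 0 <= psum (tail (S N) W) X M).
  { intros. apply psum_nonneg; auto. intros k. apply (tail_bounds (S N) W k HW). }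
  split.
  - destruct (le_lt_dec N L) as [H|H].
    + rewrite E by exact H. lra.
    + apply Rle_trans with 0; [|specialize (Hn L); lra].
      right. unfold psum. apply sum_zero. intros k Hk. unfold tail. destruct (le_dec N k); [lia | ring].
  - rewrite E by lia. apply Rplus_le_compat_l. apply psum_mono_len; auto; [|lia].
    intros k. apply (tail_bounds (S N) W k HW).
Qed.

Lemma tail_value_bounds N W X M : (forall k, 0 <= W k) -> 0 <= X ->
  (forall L, psum (tail N W) X L <= M) ->
  (forall L, psum (tail (S N) W) X L <= PSeries (tail (S N) W) X) /\
  W N * X ^ N + PSeries (tail (S N) W) X <= M.
Proof.
  intros HW HX HM.
  assert (Hnn : forall k, 0 <= tail (S N) W k * X ^ k).
  { intros k. apply Rmult_le_pos; [apply (tail_bounds (S N) W k HW) | apply pow_le, HX]. }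
  assert (Hb : forall L, sum_f_R0 (fun k => tail (S N) W k * X ^ k) L <= M - W N * X ^ N).
  { intros L. destruct (tail_split N W X L HW HX) as [_ H]. specialize (HM (N + L)%nat). unfold psum in *. lra. }
  split.
  - intros L. apply (nonneg_series_bounds _ _ L Hnn Hb).
  - destruct (nonneg_series_bounds _ _ 0 Hnn Hb) as [_ H]. unfold PSeries. lra.
Qed.

Section HighOrder.

Variables c0 A g0 g1 tau B C0 K2 C5 C9 CW : R.
Hypothesis Hc0 : 0 < c0 <= 1.
Hypothesis Htau : 0 < tau.
Hypothesis HB : 0 < B.
Hypothesis HC0 : 0 < C0.
Hypothesis HK2 : 0 < K2.
Hypothesis HC5 : 0 < C5.
Hypothesis HC9 : 0 < C9.
Hypothesis HCW : 0 < CW.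

Let C6 := C0 * C5 + (C0 + 1) * K2.
Let C7 := 4 * tau ^ 3 * (C6 + 1).
Let Kp := 4 * tau ^ 3 * (C0 * C5 + 1) * (C0 * C5).
Let C8 := 4 * B * tau * CW + Kp * C9.
Let c := 5 * (C7 * (C0 + 1)) + 2 * C8.
Let e1 := Rmin (Rmin (1 / 6) (/ (4 * tau))) (Rmin (/ (2 * c)) (/ (4 * (tau * C6)))).

Lemma const_pos : 0 < C6 /\ 0 < C7 /\ 0 < Kp /\ 0 < C8 /\ 0 < c.
Proof.
  assert (H3 : 0 < tau ^ 3) by (apply pow_lt, Htau).
  assert (H05 : 0 < C0 * C5) by (apply Rmult_lt_0_compat; assumption).
  assert (H1 : 0 < C6).
  { unfold C6. apply Rplus_lt_0_compat; [exact H05|]. apply Rmult_lt_0_compat; lra. }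
  assert (H2 : 0 < C7) by (unfold C7; repeat apply Rmult_lt_0_compat; lra).
  assert (H4 : 0 < Kp) by (unfold Kp; repeat apply Rmult_lt_0_compat; lra).
  assert (H5 : 0 < C8).
  { unfold C8. apply Rplus_lt_0_compat; repeat apply Rmult_lt_0_compat; lra. }
  assert (H6 : 0 < C7 * (C0 + 1)) by (apply Rmult_lt_0_compat; lra).
  repeat split; auto. unfold c. lra.
Qed.

Lemma small_pos : 0 < e1.
Proof.
  destruct const_pos as (H6 & H7 & HK & H8 & Hc).
  unfold e1. repeat apply Rmin_pos; try lra; apply Rinv_0_lt_compat; try lra.
  repeat apply Rmult_lt_0_compat; lra.
Qed.

Lemma small_facts e : 0 < e < e1 ->
  e < 1 / 6 /\ tau * e <= 1 / 4 /\ 2 * c * e <= 1 /\ tau * (C6 * e) <= 1 / 4.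
Proof.
  intros He. destruct const_pos as (H6 & H7 & HK & H8 & Hc).
  assert (HtC : 0 < tau * C6) by (apply Rmult_lt_0_compat; lra).
  unfold e1 in He.
  pose proof (Rmin_l (Rmin (1 / 6) (/ (4 * tau))) (Rmin (/ (2 * c)) (/ (4 * (tau * C6))))).
  pose proof (Rmin_r (Rmin (1 / 6) (/ (4 * tau))) (Rmin (/ (2 * c)) (/ (4 * (tau * C6))))).
  pose proof (Rmin_l (1 / 6) (/ (4 * tau))). pose proof (Rmin_r (1 / 6) (/ (4 * tau))).
  pose proof (Rmin_l (/ (2 * c)) (/ (4 * (tau * C6)))). pose proof (Rmin_r (/ (2 * c)) (/ (4 * (tau * C6)))).
  split; [lra|]. split; [|split].
  - apply Rle_trans with (tau * / (4 * tau)); [apply Rmult_le_compat_l; lra|]. right. field. lra.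
  - apply Rle_trans with (2 * c * / (2 * c)); [apply Rmult_le_compat_l; lra|]. right. field. lra.
  - rewrite <- Rmult_assoc. apply Rle_trans with (tau * C6 * / (4 * (tau * C6))); [apply Rmult_le_compat_l; lra|].
    right. field. lra.
Qed.

Section OneParameter.

Variables (e a : R) (W f : nat -> R) (h : nat -> nat -> R) (mu : R) (m : nat -> R)
  (N : nat) (s r Y : R).
Hypothesis HT : tame c0 A g0 g1 e a W.
Hypothesis He : 0 < e < e1.
Hypothesis HN2 : (2 <= N)%nat.
Hypothesis HN : e * INR N < 1 < e * INR (S N).
Hypothesis Hmu : 0 <= mu <= 1.
Hypothesis Hf : forall k, Rabs (f k) <= B * tau ^ k.
Hypothesis Hh : forall k l, Rabs (h k l) <= hmaj tau k l.
Hypothesis Hrec : recursion e a f h mu m.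
Hypothesis Hlow : forall k, (k < N)%nat -> Rabs (m k) <= C0 * W k.
Hypothesis HmN : m N = s * W N.
Hypothesis Hs : Rabs s <= C0.
Hypothesis Hr : 0 < r <= 4 / 5 * e.
Hypothesis HV : forall L, psum (tail N W) r L <= e * K2.
Hypothesis HY : 4 / 5 * e <= Y <= e.
Hypothesis HP : forall L, psum (below N W) Y L <= C5 * e ^ 2.
Hypothesis HYN : e ^ 4 <= C9 * W N * Y ^ S N.
Hypothesis HWN : (2 * tau) ^ N <= CW * W N.

Let d := fun k => if lt_dec k N then 0 else m k - s * W k.
Let V1 := PSeries (tail (S N) W).

Let Wn : forall k, 0 <= W k.
Proof. exact (W_nonneg _ _ _ _ _ _ _ HT). Qed.

Let Hgr : growth e a W.
Proof. apply HT. Qed.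

Let dN0 : forall k, (k <= N)%nat -> d k = 0.
Proof.
  intros k Hk. unfold d. destruct (lt_dec k N); [reflexivity|].
  replace k with N by lia. rewrite HmN. ring.
Qed.

(** Above the resonance all the coefficients have a definite sign, so absolute
    values obey the recursion as an inequality. *)
Lemma d_recursion k : (N <= k)%nat ->
  (e * INR (S k) - 1) * Rabs (d (S k)) - (INR k + a) * Rabs (d k)
  <= Rabs (PS_g f h mu m (S k)).
Proof.
  intros Hk. destruct k as [|k]; [lia|].
  destruct Hrec as (_ & _ & HR). specialize (HR k).
  assert (He1 : 1 < e * INR (S (S k))).
  { apply Rlt_le_trans with (1 := proj2 HN). apply Rmult_le_compat_l; [lra|]. apply le_INR. lia. }
  assert (Hd1 : d (S (S k)) = m (S (S k)) - s * W (S (S k))).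
  { unfold d. destruct (lt_dec (S (S k)) N); [lia | reflexivity]. }
  assert (Hd0 : d (S k) = m (S k) - s * W (S k)).
  { unfold d. destruct (lt_dec (S k) N); [lia | reflexivity]. }
  assert (HW : (e * INR (S (S k)) - 1) * W (S (S k)) = (INR (S k) + a) * W (S k)).
  { destruct Hgr as (_ & _ & _ & Wr). rewrite <- (Wr (S k)) by lia. rewrite Rabs_left by lra. ring. }
  destruct (index_pos _ _ _ _ _ _ _ HT (S k) ltac:(lia)) as [_ Hi].
  assert (E : (e * INR (S (S k)) - 1) * d (S (S k)) = (INR (S k) + a) * d (S k) - PS_g f h mu m (S (S k))).
  { rewrite Hd1, Hd0, <- HR.
    replace ((e * INR (S (S k)) - 1) * (m (S (S k)) - s * W (S (S k)))) with
      ((e * INR (S (S k)) - 1) * m (S (S k)) - s * ((e * INR (S (S k)) - 1) * W (S (S k)))) by ring.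
    rewrite HW. ring. }
  assert (E2 : (e * INR (S (S k)) - 1) * Rabs (d (S (S k))) = Rabs ((INR (S k) + a) * d (S k) - PS_g f h mu m (S (S k)))).
  { rewrite <- E, Rabs_mult, (Rabs_pos_eq (e * INR (S (S k)) - 1)); lra. }
  rewrite E2.
  pose proof (Rabs_triang ((INR (S k) + a) * d (S k)) (- PS_g f h mu m (S (S k)))) as HTr.
  rewrite Rabs_Ropp, Rabs_mult, (Rabs_pos_eq (INR (S k) + a)) in HTr by lra. unfold Rminus in *. lra.
Qed.

(** The forcing terms of order above [N], given a bound on [d].  Products of the low-order part alone are
    estimated at the larger radius [Y], everything else at [X]. *)
Lemma forcing_bound n X : (N <= n)%nat -> 0 < X <= r ->
  psum (fun k => Rabs (d k)) X n <= V1 X ->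
  psum (above N (fun k => Rabs (PS_g f h mu m k))) X (S n) <=
    C8 * (W N * X ^ S N) + C7 * (C0 + 1) * (e * X * (W N * X ^ N + V1 X)).
Proof.
  intros Hn HX HD.
  destruct const_pos as (H6 & H7 & HK & H8 & Hc).
  destruct (small_facts e He) as (Se & Ste & Sc & St6).
  assert (HXX : forall L, psum (tail N W) X L <= e * K2).
  { intros L. apply Rle_trans with (2 := HV L). apply psum_mono_X; [lra|]. intros k. apply (tail_bounds N W k Wn). }
  destruct (tail_value_bounds N W X (e * K2) Wn ltac:(lra) HXX) as [HV1 HVX]. fold V1 in HV1, HVX.
  assert (HtX : tau * X <= 1 / 2).
  { apply Rle_trans with (tau * e); [apply Rmult_le_compat_l; lra | lra]. }
  assert (HtY : tau * Y <= 1 / 2).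
  { apply Rle_trans with (tau * e); [apply Rmult_le_compat_l; lra | lra]. }
  set (p := fun i => C0 * below N W i).
  set (y := fun i => if lt_dec i N then C0 * W i else if le_dec i n then Rabs (m i) else 0).
  assert (Hbel : forall i, 0 <= below N W i).
  { intros i. unfold below. destruct (lt_dec i N); [apply Wn | lra]. }
  assert (Hp0 : forall i, 0 <= p i) by (intros i; apply Rmult_le_pos; [lra | apply Hbel]).
  assert (Hpy : forall i, 0 <= p i <= y i).
  { intros i. split; [apply Hp0|]. unfold p, y, below. destruct (lt_dec i N); [lra|].
    destruct (le_dec i n); [pose proof (Rabs_pos (m i)); lra | lra]. }
  assert (HWX0 : 0 <= W N * X ^ N) by (apply Rmult_le_pos; [apply Wn | apply pow_le; lra]).
  assert (HV10 : 0 <= V1 X).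
  { apply Rle_trans with (2 := HV1 0%nat). apply psum_nonneg; [lra|]. intros k. apply (tail_bounds (S N) W k Wn). }
  set (Q := psum (fun k => y k - p k) X (S n)).
  assert (HQ : Q <= (C0 + 1) * (W N * X ^ N + V1 X)).
  { unfold Q. apply Rle_trans with (psum (fun k => C0 * tail N W k + (if le_dec k n then Rabs (d k) else 0)) X (S n)).
    - apply psum_le; [lra|]. intros k Hk. unfold y, p, below, tail, d.
      destruct (lt_dec k N); destruct (le_dec N k); try lia.
      + destruct (le_dec k n); rewrite ?Rabs_R0; lra.
      + destruct (le_dec k n); [|pose proof (Wn k); assert (0 <= C0 * W k) by (apply Rmult_le_pos; lra); lra].
        replace (m k) with (s * W k + (m k - s * W k)) at 1 by ring.
        pose proof (Rabs_triang (s * W k) (m k - s * W k)) as HTr.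
        rewrite Rabs_mult, (Rabs_pos_eq (W k)) in HTr by apply Wn.
        assert (Rabs s * W k <= C0 * W k) by (apply Rmult_le_compat_r; [apply Wn | exact Hs]). lra.
    - rewrite psum_plus, psum_scal.
      assert (E : psum (fun k => if le_dec k n then Rabs (d k) else 0) X (S n) = psum (fun k => Rabs (d k)) X n).
      { unfold psum. rewrite sum_S. destruct (le_dec (S n) n); [lia|]. rewrite Rmult_0_l, Rplus_0_r.
        apply sum_eq. intros k Hk. destruct (le_dec k n); [reflexivity | lia]. }
      rewrite E.
      assert (psum (tail N W) X (S n) <= W N * X ^ N + V1 X).
      { apply Rle_trans with (1 := proj1 (tail_split N W X (S n) Wn ltac:(lra))).
        apply Rplus_le_compat_l, HV1. }
      assert (C0 * psum (tail N W) X (S n) <= C0 * (W N * X ^ N + V1 X)) by (apply Rmult_le_compat_l; lra).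
      lra. }
  assert (HQ0 : 0 <= Q).
  { apply psum_nonneg; [lra|]. intros k. pose proof (Hpy k). lra. }
  assert (HpY : psum p Y (S n) <= C0 * C5 * e ^ 2).
  { unfold p. rewrite psum_scal, Rmult_assoc. apply Rmult_le_compat_l; [lra | apply HP]. }
  assert (He2 : e ^ 2 <= e) by (simpl; rewrite Rmult_1_r; nra).
  assert (H05 : 0 < C0 * C5) by (apply Rmult_lt_0_compat; assumption).
  assert (Hy : psum y X (S n) <= C6 * e).
  { replace (psum y X (S n)) with (psum p X (S n) + Q).
    2:{ unfold Q. rewrite <- psum_plus. unfold psum. apply sum_eq. intros; ring. }
    assert (psum p X (S n) <= psum p Y (S n)) by (apply psum_mono_X; [lra | exact Hp0]).
    assert (C0 * C5 * e ^ 2 <= C0 * C5 * e) by (apply Rmult_le_compat_l; lra).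
    assert ((C0 + 1) * (W N * X ^ N + V1 X) <= (C0 + 1) * (e * K2)) by (apply Rmult_le_compat_l; lra).
    unfold C6. lra. }
  assert (HEp : tau * (C0 * C5 * e ^ 2) <= 1 / 4).
  { apply Rle_trans with (2 := St6). apply Rmult_le_compat_l; [lra|].
    assert (C0 * C5 * e ^ 2 <= C0 * C5 * e) by (apply Rmult_le_compat_l; lra).
    assert (0 <= (C0 + 1) * K2 * e) by (repeat apply Rmult_le_pos; lra). unfold C6. lra. }
  (* in order: the forcing by f, products of low-order terms alone, and the
     terms that contain a factor of order at least N *)
  set (F1 := psum (above N (fun k => B * tau ^ k)) X (S n)).
  set (F2 := psum (above N (Hmaj tau p)) X (S n)).
  set (F3 := psum (fun k => Hmaj tau y k - Hmaj tau p k) X (S n)).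
  assert (HX0 : 0 <= X) by lra.
  destruct (Hmaj_diff tau y p X (S n) (C6 * e) Htau HX0 HtX Hpy Hy St6) as [Hd0 Hd3]. fold F3 Q in Hd3.
  assert (Hsum : psum (above N (fun k => Rabs (PS_g f h mu m k))) X (S n) <= F1 + F2 + F3).
  { unfold F1, F2, F3. rewrite <- !psum_plus. apply psum_le; [lra|]. intros k Hk.
    unfold above. destruct (lt_dec N k); [|specialize (Hd0 k); lra].
    assert (Hmy : forall i, (i < k)%nat -> Rabs (m i) <= y i).
    { intros i Hi. unfold y. destruct (lt_dec i N); [apply Hlow; assumption|].
      destruct (le_dec i n); [lra | lia]. }
    apply Rle_trans with (1 := PS_g_majorant f h mu tau m y k Htau (proj1 Hmu) Hh Hmy).
    assert (0 <= Hmaj tau y k).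
    { unfold Hmaj. apply sum_nonneg. intros j _. apply sum_nonneg. intros i' _.
      apply Rmult_le_pos; [apply hmaj_nonneg, Htau|]. apply PS_pow_nonneg. intros i _. pose proof (Hpy i). lra. }
    assert (mu * Hmaj tau y k <= 1 * Hmaj tau y k) by (apply Rmult_le_compat_r; lra).
    pose proof (Hf k). lra. }
  assert (HXN : 0 < X ^ S N) by (apply pow_lt; lra).
  assert (HF1 : F1 <= 4 * B * tau * CW * (W N * X ^ S N)).
  { unfold F1. set (Z := / (2 * tau)).
    assert (HZ : 0 < Z) by (apply Rinv_0_lt_compat; lra).
    assert (HXZ : X <= Z).
    { apply Rmult_le_reg_l with (2 * tau); [lra|]. unfold Z. rewrite Rinv_r; lra. }
    apply Rle_trans with (1 := above_psum N (fun k => B * tau ^ k) X Z (S n) ltac:(lra) HZ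
       (fun k => Rmult_le_pos _ _ (Rlt_le _ _ HB) (pow_le _ _ (Rlt_le _ _ Htau)))).
    assert (E : psum (fun k => B * tau ^ k) Z (S n) <= B * 2).
    { rewrite psum_scal. apply Rmult_le_compat_l; [lra|].
      apply Rle_trans with (sum_f_R0 (fun k => (1/2) ^ k) (S n)).
      - right. apply sum_eq. intros k Hk. rewrite <- Rpow_mult_distr. f_equal. unfold Z. field. lra.
      - apply geom_sum_le2. lra. }
    replace (X ^ S N / Z ^ S N) with (X ^ S N * (2 * tau * (2 * tau) ^ N)).
    2:{ unfold Z. rewrite pow_inv. simpl. field. split; [apply pow_nonzero |]; lra. }
    assert (H2t : 0 <= 2 * tau * (2 * tau) ^ N) by (apply Rmult_le_pos; [lra | apply pow_le; lra]).
    apply Rle_trans with (X ^ S N * (2 * tau * (2 * tau) ^ N) * (B * 2)).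
    - apply Rmult_le_compat_l; [|exact E]. apply Rmult_le_pos; lra.
    - replace (4 * B * tau * CW * (W N * X ^ S N)) with (X ^ S N * (2 * tau * (CW * W N)) * (B * 2)) by ring.
      apply Rmult_le_compat_r; [lra|]. apply Rmult_le_compat_l; [lra|]. apply Rmult_le_compat_l; lra. }
  assert (HF2 : F2 <= Kp * C9 * (W N * X ^ S N)).
  { unfold F2.
    assert (HY0 : 0 < Y) by lra.
    assert (Hhp : forall k, 0 <= Hmaj tau p k).
    { intros k. unfold Hmaj. apply sum_nonneg. intros j _. apply sum_nonneg. intros i' _.
      apply Rmult_le_pos; [apply hmaj_nonneg, Htau|]. apply PS_pow_nonneg. auto. }
    apply Rle_trans with (1 := above_psum N (Hmaj tau p) X Y (S n) ltac:(lra) HY0 Hhp).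
    assert (HYp : 0 < Y ^ S N) by (apply pow_lt, HY0).
    pose proof (Hmaj_psum tau p Y (S n) _ Htau (Rlt_le _ _ HY0) HtY Hp0 HpY HEp) as HM.
    assert (HM2 : psum (Hmaj tau p) Y (S n) <= Kp * e ^ 4).
    { apply Rle_trans with (1 := HM).
      apply Rle_trans with (2 * (tau * e) * (2 * (tau * (C0 * C5 * e)) + 2 * (tau * e)) * (tau * (C0 * C5 * e ^ 2))).
      - assert (HtYe : tau * Y <= tau * e) by (apply Rmult_le_compat_l; lra).
        assert (0 <= tau * Y) by (apply Rmult_le_pos; lra).
        assert (0 <= tau * (C0 * C5 * e ^ 2)).
        { apply Rmult_le_pos; [lra|]. apply Rmult_le_pos; [lra|]. apply pow_le; lra. }
        assert (tau * (C0 * C5 * e ^ 2) <= tau * (C0 * C5 * e)).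
        { apply Rmult_le_compat_l; [lra|]. apply Rmult_le_compat_l; lra. }
        apply Rmult_le_compat_r; [assumption|]. apply Rmult_le_compat; lra.
      - right. unfold Kp. ring. }
    apply Rle_trans with (X ^ S N / Y ^ S N * (Kp * e ^ 4)).
    - apply Rmult_le_compat_l; [|exact HM2]. apply Rdiv_le_0_compat; lra.
    - apply Rle_trans with (X ^ S N / Y ^ S N * (Kp * (C9 * W N * Y ^ S N))).
      + apply Rmult_le_compat_l; [apply Rdiv_le_0_compat; lra|]. apply Rmult_le_compat_l; lra.
      + right. field. lra. }
  assert (HF3 : F3 <= C7 * (C0 + 1) * (e * X * (W N * X ^ N + V1 X))).
  { apply Rle_trans with (1 := Hd3).
    apply Rle_trans with (2 * (tau * X) * (2 * (tau * (C6 * e)) + 2 * (tau * e)) * (tau * Q)).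
    - assert (tau * X <= tau * e) by (apply Rmult_le_compat_l; lra).
      assert (0 <= tau * X) by (apply Rmult_le_pos; lra).
      assert (0 <= tau * Q) by (apply Rmult_le_pos; lra).
      apply Rmult_le_compat_r; [assumption|]. apply Rmult_le_compat_l; lra.
    - replace (2 * (tau * X) * (2 * (tau * (C6 * e)) + 2 * (tau * e)) * (tau * Q)) with (C7 * (e * X) * Q)
        by (unfold C7; ring).
      replace (C7 * (C0 + 1) * (e * X * (W N * X ^ N + V1 X))) with (C7 * (e * X) * ((C0 + 1) * (W N * X ^ N + V1 X))) by ring.
      apply Rmult_le_compat_l; [|exact HQ]. repeat apply Rmult_le_pos; lra. }
  unfold C8. lra.
Qed.

(** [c (e + x) V1] is a supersolution for the partial sums of [|d|]: its
    factor [e + x] increases, which makes up for the forcing proportional to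
    [V1], and [V1] itself is driven at order [N + 1]. *)
Lemma deviation_bound n X : 0 < X <= r ->
  psum (fun k => Rabs (d k)) X n <= c * (e + X) * V1 X.
Proof.
  destruct const_pos as (H6 & H7 & HK & H8 & Hc).
  destruct (small_facts e He) as (Se & Ste & Sc & St6).
  assert (HV10 : forall x, 0 < x <= r -> 0 <= V1 x).
  { intros x Hx.
    assert (HXX : forall L, psum (tail N W) x L <= e * K2).
    { intros L. apply Rle_trans with (2 := HV L). apply psum_mono_X; [lra|]. intros k. apply (tail_bounds N W k Wn). }
    destruct (tail_value_bounds N W x (e * K2) Wn ltac:(lra) HXX) as [HV1 HVX].
    apply Rle_trans with (2 := HV1 0%nat). apply psum_nonneg; [lra|]. intros k. apply (tail_bounds (S N) W k Wn). }
  revert X. induction n as [|n IH]; intros X HX.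
  { unfold psum. simpl. rewrite dN0 by lia. rewrite Rabs_R0, Rmult_0_l.
    pose proof (HV10 X HX). apply Rmult_le_pos; [apply Rmult_le_pos; lra | lra]. }
  destruct (le_lt_dec N n) as [Hn|Hn].
  2:{ unfold psum. rewrite sum_zero.
      - pose proof (HV10 X HX). apply Rmult_le_pos; [apply Rmult_le_pos; lra | lra].
      - intros k Hk. rewrite dN0 by lia. rewrite Rabs_R0. ring. }
  set (b := fun k => if le_dec k (S n) then Rabs (d k) else 0).
  assert (Hb0 : forall k, (S n < k)%nat -> b k = 0).
  { intros k Hk. unfold b. destruct (le_dec k (S n)); [lia | reflexivity]. }
  assert (Hbs : forall x, PSeries b x = psum (fun k => Rabs (d k)) x (S n)).
  { intros x. etransitivity; [exact (is_pseries_unique _ _ _ (psum_finite b x (S n) Hb0))|].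
    unfold psum. apply sum_eq. intros k Hk. unfold b. destruct (le_dec k (S n)); [reflexivity | lia]. }
  assert (Hrad : forall x, Rbar_lt (Rabs x) (CV_radius b)) by (intros x; apply finite_radius with (S n), Hb0).
  assert (HLb : forall x, 0 < x <= r ->
     x * (e - x) * Derive (PSeries b) x - (1 + a * x) * PSeries b x <=
     psum (above N (fun k => Rabs (PS_g f h mu m k))) x (S n)).
  { intros x Hx. pose proof (L_pseries e a b x (Hrad x)) as HL.
    assert (HLz : forall k, (S (S n) < k)%nat -> Lcoef e a b k = 0).
    { intros [|k] Hk; [lia|]. unfold Lcoef. rewrite !Hb0 by lia. ring. }
    rewrite <- (is_pseries_unique _ _ _ HL).
    apply Rle_trans with (psum (Lcoef e a b) x (S (S n))).
    { right. exact (is_pseries_unique _ _ _ (psum_finite (Lcoef e a b) x (S (S n)) HLz)). }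
    unfold psum. rewrite sum_S.
    assert (Hlast : Lcoef e a b (S (S n)) * x ^ S (S n) <= 0).
    { unfold Lcoef. rewrite (Hb0 (S (S n))) by lia. unfold b. destruct (le_dec (S n) (S n)); [|lia].
      destruct (index_pos _ _ _ _ _ _ _ HT (S n) ltac:(lia)) as [_ Hi].
      assert (0 <= (INR (S n) + a) * Rabs (d (S n)) * x ^ S (S n)).
      { apply Rmult_le_pos; [apply Rmult_le_pos; [lra | apply Rabs_pos] | apply pow_le; lra]. }
      lra. }
    assert (Hrest : sum_f_R0 (fun k => Lcoef e a b k * x ^ k) (S n) <=
       sum_f_R0 (fun k => above N (fun k => Rabs (PS_g f h mu m k)) k * x ^ k) (S n)).
    { apply sum_Rle. intros k Hk. apply Rmult_le_compat_r; [apply pow_le; lra|].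
      unfold above. destruct k as [|k].
      - unfold Lcoef, b. simpl le_dec. destruct (le_dec 0 (S n)); [|lia]. rewrite dN0, Rabs_R0 by lia.
        destruct (lt_dec N 0); [lia | lra].
      - unfold Lcoef, b. destruct (le_dec (S k) (S n)); [|lia]. destruct (le_dec k (S n)); [|lia].
        destruct (lt_dec N (S k)) as [HNk|HNk].
        + apply d_recursion. lia.
        + rewrite !dN0, Rabs_R0 by lia. lra. }
    lra. }
  set (C := psum (fun k => Rabs (d k)) r (S n) / r ^ S N).
  assert (Hcmp : PSeries b X - c * (e + X) * V1 X <= 0).
  { apply (comparison e a (S N) r (fun x => PSeries b x - c * (e + x) * V1 x)
      (fun x => Derive (PSeries b) x - (c * V1 x + c * (e + x) * Derive V1 x)) C);
      [lra | exact (proj2 HN) | | | exact HX].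
    - intros x Hx.
      assert (Hxe : Rabs x < e) by (rewrite Rabs_pos_eq; lra).
      assert (HdV : ex_derive V1 x) by (apply ex_derive_PSeries, (tail_radius e a W (S N) x); [lra | exact Hgr | exact Hxe]).
      assert (Hdb : ex_derive (PSeries b) x) by (apply ex_derive_PSeries, Hrad).
      split.
      + apply is_derive_Reals. apply is_derive_Reals.
        apply (is_derive_minus (PSeries b) (fun x => c * (e + x) * V1 x) x (Derive (PSeries b) x) (c * V1 x + c * (e + x) * Derive V1 x)).
        * apply Derive_correct, Hdb.
        * apply (is_derive_mult (fun x => c * (e + x)) V1 x c (Derive V1 x)).
          -- auto_derive; [exact I | ring].
          -- apply Derive_correct, HdV.
          -- intros; apply Rmult_comm.
      + pose proof (tail_ode e a W N x ltac:(lra) Hgr HN2 (proj2 HN) Hxe) as Hode. fold V1 in Hode.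
        pose proof (HLb x Hx) as HL.
        assert (HDn : psum (fun k => Rabs (d k)) x n <= V1 x).
        { apply Rle_trans with (1 := IH x Hx). rewrite <- (Rmult_1_l (V1 x)) at 2.
          apply Rmult_le_compat_r; [apply HV10, Hx|].
          apply Rle_trans with (2 := Sc). replace (2 * c * e) with (c * (2 * e)) by ring.
          apply Rmult_le_compat_l; lra. }
        pose proof (forcing_bound n x Hn Hx HDn) as HF.
        pose proof (HV10 x Hx) as Hv.
        set (v := V1 x) in *. set (w := W N * x ^ S N) in *.
        assert (Hw : 0 <= w) by (apply Rmult_le_pos; [apply Wn | apply pow_le; lra]).
        assert (HcC : 0 < C7 * (C0 + 1)) by (apply Rmult_lt_0_compat; lra).
        set (cc := C7 * (C0 + 1)) in *.
        replace (e * x * (W N * x ^ N + v)) with (e * w + e * x * v) in HF by (unfold w; simpl; ring).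
        assert (H1 : cc * (e * x * v) <= c * (x * (e - x)) * v).
        { assert (Hex : e / 5 <= e - x) by lra.
          apply Rle_trans with (c * (x * (e / 5)) * v).
          - assert (0 <= 2 * C8 * (x * (e / 5)) * v) by (repeat apply Rmult_le_pos; lra).
            unfold c. fold cc. lra.
          - apply Rmult_le_compat_r; [exact Hv|]. apply Rmult_le_compat_l; [lra|].
            apply Rmult_le_compat_l; lra. }
        assert (HeN : 1 / 2 <= e * (INR N + a)).
        { rewrite S_INR in HN. assert (Ha : c0 - 2 <= a <= A) by apply HT.
          assert (e * (-3) <= e * (a - 1)) by (apply Rmult_le_compat_l; lra). lra. }
        assert (H2 : C8 * w + cc * (e * w) <= c * (e + x) * ((INR N + a) * w)).
        { apply Rle_trans with (c * (1 / 2) * w).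
          - assert (cc * (e * w) <= cc * (1 * w)).
            { apply Rmult_le_compat_l; [lra|]. apply Rmult_le_compat_r; lra. }
            assert (0 <= cc * w) by (apply Rmult_le_pos; lra).
            unfold c. fold cc. lra.
          - replace (c * (e + x) * ((INR N + a) * w)) with (c * ((e + x) * (INR N + a)) * w) by ring.
            apply Rmult_le_compat_r; [exact Hw|]. apply Rmult_le_compat_l; [lra|].
            assert (0 <= x * (INR N + a)).
            { apply Rmult_le_pos; [lra|]. destruct (index_pos _ _ _ _ _ _ _ HT N HN2). lra. }
            lra. }
        replace ((INR N + a) * W N * x ^ S N) with ((INR N + a) * w) in Hode by (unfold w; ring).
        apply Rminus_le.
        replace (_ - _) with ((x * (e - x) * Derive (PSeries b) x - (1 + a * x) * PSeries b x)
           - (c * (x * (e - x)) * v + c * (e + x) * (x * (e - x) * Derive V1 x - (1 + a * x) * v))) by ring.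
        rewrite Hode. lra.
    - intros x Hx. rewrite Hbs.
      assert (0 <= c * (e + x) * V1 x) by (apply Rmult_le_pos; [apply Rmult_le_pos; lra | apply HV10, Hx]).
      apply Rle_trans with (psum (above N (fun k => Rabs (d k))) x (S n)).
      + assert (E : psum (fun k => Rabs (d k)) x (S n) = psum (above N (fun k => Rabs (d k))) x (S n)).
        { unfold psum. apply sum_eq. intros k Hk. unfold above. destruct (lt_dec N k); [reflexivity|].
          rewrite dN0 by lia. rewrite Rabs_R0. reflexivity. }
        rewrite E. lra.
      + apply Rle_trans with (1 := above_psum N (fun k => Rabs (d k)) x r (S n) ltac:(lra) ltac:(lra) (fun k => Rabs_pos _)).
        right. unfold C. field. apply pow_nonzero. lra. }
  rewrite Hbs in Hcmp. lra.
Qed.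

Lemma solution_abs_bounded : abs_bounded m r (C6 * e).
Proof.
  destruct const_pos as (H6 & H7 & HK & H8 & Hc).
  destruct (small_facts e He) as (Se & Ste & Sc & St6).
  destruct (tail_value_bounds N W r (e * K2) Wn ltac:(lra) HV) as [HV1 HVr]. fold V1 in HV1, HVr.
  assert (HWr : 0 <= W N * r ^ N) by (apply Rmult_le_pos; [apply Wn | apply pow_le; lra]).
  assert (HV10 : 0 <= V1 r).
  { apply Rle_trans with (2 := HV1 0%nat). apply psum_nonneg; [lra|]. intros k. apply (tail_bounds (S N) W k Wn). }
  intros L. apply Rle_trans with (psum (fun k => C0 * below N W k + (C0 * tail N W k + Rabs (d k))) r L).
  - apply psum_le; [lra|]. intros k _. unfold below, tail, d.
    destruct (lt_dec k N); destruct (le_dec N k); try lia.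
    + pose proof (Hlow k ltac:(assumption)). rewrite Rabs_R0. lra.
    + replace (m k) with (s * W k + (m k - s * W k)) at 1 by ring.
      pose proof (Rabs_triang (s * W k) (m k - s * W k)) as HTr.
      rewrite Rabs_mult, (Rabs_pos_eq (W k)) in HTr by apply Wn.
      assert (Rabs s * W k <= C0 * W k) by (apply Rmult_le_compat_r; [apply Wn | exact Hs]). lra.
  - rewrite !psum_plus, !psum_scal.
    assert (B1 : psum (below N W) r L <= C5 * e ^ 2).
    { apply Rle_trans with (2 := HP L). apply psum_mono_X; [lra|]. intros k. unfold below. destruct (lt_dec k N); [apply Wn | lra]. }
    pose proof (HV L) as B2. pose proof (deviation_bound L r ltac:(lra)) as B3.
    assert (B4 : c * (e + r) * V1 r <= 1 * V1 r).
    { apply Rmult_le_compat_r; [exact HV10|]. apply Rle_trans with (2 := Sc).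
      replace (2 * c * e) with (c * (2 * e)) by ring. apply Rmult_le_compat_l; lra. }
    assert (B5 : C0 * psum (below N W) r L <= C0 * (C5 * e)).
    { apply Rmult_le_compat_l; [lra|]. apply Rle_trans with (1 := B1). apply Rmult_le_compat_l; [lra|].
      simpl. rewrite Rmult_1_r. rewrite <- (Rmult_1_r e) at 3. apply Rmult_le_compat_l; lra. }
    assert (B6 : C0 * psum (tail N W) r L <= C0 * (e * K2)) by (apply Rmult_le_compat_l; lra).
    unfold C6. lra.
Qed.

(** [m - s W] consists of the low-order part, which is small at the radius [Y],
    and of [d]. *)
Lemma solution_approx X : Rabs X <= r ->
  Rabs (PSeries m X - s * PSeries (tail N W) X) <= (C0 * C5 + 2 * c * K2) * e ^ 2.
Proof.
  intros HX. pose proof (Rabs_pos X) as HX0.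
  destruct const_pos as (H6 & H7 & HK & H8 & Hc).
  destruct (small_facts e He) as (Se & Ste & Sc & St6).
  assert (He2 : 0 <= e ^ 2) by (apply pow_le; lra).
  assert (HCC : 0 < C0 * C5) by (apply Rmult_lt_0_compat; assumption).
  assert (HCK : 0 < 2 * c * K2) by (repeat apply Rmult_lt_0_compat; lra).
  destruct (Req_dec X 0) as [->|HXn].
  { rewrite !PSeries_0. destruct Hrec as (m0 & _). rewrite m0. unfold tail. destruct (le_dec N 0); [lia|].
    rewrite Rmult_0_r, Rminus_0_r, Rabs_R0. apply Rmult_le_pos; lra. }
  assert (HXp : 0 < Rabs X) by (apply Rabs_pos_lt, HXn).
  assert (HVX : forall L, psum (tail N W) (Rabs X) L <= e * K2).
  { intros L. apply Rle_trans with (2 := HV L). apply psum_mono_X; [lra|]. intros k. apply (tail_bounds N W k Wn). }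
  destruct (tail_value_bounds N W (Rabs X) (e * K2) Wn ltac:(lra) HVX) as [HV1 HVr]. fold V1 in HV1, HVr.
  assert (HWr : 0 <= W N * Rabs X ^ N) by (apply Rmult_le_pos; [apply Wn | apply pow_le; lra]).
  assert (HV10 : 0 <= V1 (Rabs X)).
  { apply Rle_trans with (2 := HV1 0%nat). apply psum_nonneg; [lra|]. intros k. apply (tail_bounds (S N) W k Wn). }
  assert (Hm : ex_pseries m X).
  { eexists. apply abs_bounded_is_pseries with (C6 * e). intros L.
    apply Rle_trans with (2 := solution_abs_bounded L). apply psum_mono_X; [lra|]. intros; apply Rabs_pos. }
  assert (Ht : ex_pseries (tail N W) X).
  { eexists. apply abs_bounded_is_pseries with (e * K2). intros L. apply Rle_trans with (2 := HVX L).
    apply psum_le; [lra|]. intros k _. pose proof (tail_bounds N W k Wn). rewrite Rabs_pos_eq; lra. }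
  assert (E : PSeries m X - s * PSeries (tail N W) X = PSeries (fun k => below N m k + d k) X).
  { rewrite <- (PSeries_scal s (tail N W)). rewrite <- PSeries_minus; [|exact Hm|].
    - apply PSeries_ext. intros k. unfold PS_minus, PS_opp, PS_plus, PS_scal, plus, opp, scal; simpl.
      unfold mult; simpl. unfold below, tail, d. destruct (lt_dec k N), (le_dec N k); try lia; ring.
    - apply ex_pseries_scal; [apply Rmult_comm | exact Ht]. }
  rewrite E. apply abs_bounded_PSeries_le. intros L.
  apply Rle_trans with (psum (fun k => C0 * below N W k + Rabs (d k)) (Rabs X) L).
  - apply psum_le; [lra|]. intros k _. unfold below. destruct (lt_dec k N).
    + pose proof (Hlow k ltac:(assumption)). apply Rle_trans with (1 := Rabs_triang _ _). lra.
    + rewrite Rplus_0_l. lra.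
  - rewrite psum_plus, psum_scal.
    assert (B1 : psum (below N W) (Rabs X) L <= C5 * e ^ 2).
    { apply Rle_trans with (2 := HP L). apply psum_mono_X; [lra|]. intros k. unfold below. destruct (lt_dec k N); [apply Wn | lra]. }
    pose proof (deviation_bound L (Rabs X) ltac:(lra)) as B3.
    assert (B4 : c * (e + Rabs X) * V1 (Rabs X) <= c * (2 * e) * (e * K2)).
    { apply Rmult_le_compat; try lra; [apply Rmult_le_pos; lra|]. apply Rmult_le_compat_l; lra. }
    assert (B5 : C0 * psum (below N W) (Rabs X) L <= C0 * (C5 * e ^ 2)) by (apply Rmult_le_compat_l; lra).
    replace ((C0 * C5 + 2 * c * K2) * e ^ 2) with (C0 * (C5 * e ^ 2) + c * (2 * e) * (e * K2)) by ring. lra.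
Qed.

End OneParameter.

(** The bounds of this part with constants that do not depend on [e]. *)
Lemma high_order : exists C6' C10 e1', 0 < C6' /\ 0 < C10 /\ 0 < e1' /\
  forall e a W f h mu m N s r Y,
    tame c0 A g0 g1 e a W -> 0 < e < e1' -> (2 <= N)%nat ->
    e * INR N < 1 < e * INR (S N) -> 0 <= mu <= 1 ->
    (forall k, Rabs (f k) <= B * tau ^ k) ->
    (forall k l, Rabs (h k l) <= hmaj tau k l) ->
    recursion e a f h mu m ->
    (forall k, (k < N)%nat -> Rabs (m k) <= C0 * W k) ->
    m N = s * W N -> Rabs s <= C0 ->
    0 < r <= 4 / 5 * e -> (forall L, psum (tail N W) r L <= e * K2) ->
    4 / 5 * e <= Y <= e -> (forall L, psum (below N W) Y L <= C5 * e ^ 2) ->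
    e ^ 4 <= C9 * W N * Y ^ S N -> (2 * tau) ^ N <= CW * W N ->
    tau * e <= 1 / 4 /\ tau * (C6' * e) <= 1 / 4 /\
    abs_bounded m r (C6' * e) /\
    forall X, Rabs X <= r ->
      Rabs (PSeries m X - s * PSeries (tail N W) X) <= C10 * e ^ 2.
Proof.
  destruct const_pos as (H6 & H7 & HK & H8 & Hc).
  exists C6, (C0 * C5 + 2 * c * K2), e1.
  split; [exact H6|]. split.
  { apply Rplus_lt_0_compat; repeat apply Rmult_lt_0_compat; lra. }
  split; [apply small_pos|].
  intros e a W f h mu m N s r Y HT He HN2 HN Hmu Hf Hh Hrec Hlow HmN Hs Hr HV HY HP HYN HWN.
  destruct (small_facts e He) as (Se & Ste & Sc & St6).
  split; [exact Ste|]. split; [exact St6|]. split.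
  - apply (solution_abs_bounded e a W f h mu m N s r Y); assumption.
  - intros X HX. apply (solution_approx e a W f h mu m N s r Y); assumption.
Qed.

End HighOrder.

(** * Size of the growth sequence near the resonance *)

Lemma sum_indicator_le c p n : 0 <= c ->
  sum_f_R0 (fun i => if Nat.eq_dec i p then c else 0) n <= c.
Proof.
  intros Hc. destruct (le_lt_dec p n) as [H|H]; [rewrite sum_indicator by exact H; lra|].
  rewrite sum_zero; [exact Hc|]. intros k Hk. destruct (Nat.eq_dec k p); [lia | reflexivity].
Qed.

Lemma sum_below_const c N n : 0 <= c ->
  sum_f_R0 (fun i => if lt_dec i N then c else 0) n <= INR N * c.
Proof.
  intros Hc.
  assert (H : sum_f_R0 (fun i => if lt_dec i N then c else 0) n <= INR (min N (S n)) * c).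
  { induction n.
    - simpl sum_f_R0. destruct (lt_dec 0 N).
      + replace (min N 1) with 1%nat by lia. simpl. lra.
      + replace (min N 1) with 0%nat by lia. simpl. lra.
    - rewrite sum_S. destruct (lt_dec (S n) N).
      + replace (min N (S (S n))) with (S (min N (S n))) by lia. rewrite S_INR. lra.
      + replace (min N (S (S n))) with (min N (S n)) by lia. lra. }
  apply Rle_trans with (1 := H). apply Rmult_le_compat_r; [exact Hc|]. apply le_INR. lia.
Qed.

Lemma poly_geom_small p q C : 0 <= q < 1 ->
  exists n0, forall n, (n0 <= n)%nat -> C * INR n ^ p * q ^ n <= 1.
Proof.
  intros Hq.
  assert (HE : exists M, 0 < M /\ forall n, INR n ^ p * ((1 + q) / 2) ^ n <= M).
  {
    (* the ratio of consecutive terms tends to (1 + q) / 2 < 1 *)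
    set (t := (1 + q) / 2). assert (Ht : 0 < t < 1) by (unfold t; lra).
    assert (Hl : is_lim_seq (fun n => (1 + / INR (S n)) ^ p * t) (1 ^ p * t)).
    { apply is_lim_seq_mult'; [|apply is_lim_seq_const].
      assert (HL1 : is_lim_seq (fun n => 1 + / INR (S n)) (1 + 0)).
      { apply is_lim_seq_plus'; [apply is_lim_seq_const|].
        apply -> (is_lim_seq_incr_1 (fun n => / INR n) 0).
        replace (Finite 0) with (Rbar_inv p_infty) by reflexivity.
        apply is_lim_seq_inv; [apply is_lim_seq_INR | discriminate]. }
      rewrite Rplus_0_r in HL1.
      induction p; [simpl; apply is_lim_seq_const|]. simpl. apply is_lim_seq_mult'; assumption. }
    rewrite pow1, Rmult_1_l in Hl. apply is_lim_seq_spec in Hl.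
    destruct (Hl (mkposreal (1 - t) ltac:(lra))) as [n1 H1]. simpl in H1.
    set (u := fun n => INR n ^ p * t ^ n).
    assert (Hu0 : forall n, 0 <= u n).
    { intros n. apply Rmult_le_pos; apply pow_le; [apply pos_INR | lra]. }
    assert (Hu : forall n, (S n1 <= n)%nat -> u (S n) <= u n).
    { intros n Hn. destruct n as [|n]; [lia|].
      specialize (H1 n ltac:(lia)). apply Rabs_def2 in H1. destruct H1 as [H1 _].
      fold (INR (S n)) in H1.
      assert (HS : 0 < INR (S n)) by (apply lt_0_INR; lia).
      assert (E : u (S (S n)) = (1 + / INR (S n)) ^ p * t * u (S n)).
      { unfold u. rewrite (S_INR (S n)).
        replace (INR (S n) + 1) with ((1 + / INR (S n)) * INR (S n)) by (field; lra).
        rewrite Rpow_mult_distr. simpl. ring. }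
      rewrite E. rewrite <- (Rmult_1_l (u (S n))) at 2. apply Rmult_le_compat_r; [apply Hu0|].
      change ((1 + / INR (S n)) ^ p * t - t < 1 - t) in H1. lra. }
    exists (sum_f_R0 u (S n1) + 1).
    assert (Hs : 0 <= sum_f_R0 u (S n1)) by (apply sum_nonneg; intros; apply Hu0).
    split; [lra|]. intros n. fold (u n).
    destruct (le_lt_dec n (S n1)) as [Hn|Hn].
    - pose proof (sum_ge_term u (S n1) n (fun j _ => Hu0 j) Hn). lra.
    - assert (Hn' : (S n1 <= n)%nat) by lia. clear Hn. induction Hn'.
      + pose proof (sum_ge_term u (S n1) (S n1) (fun j _ => Hu0 j) (le_n _)). lra.
      + apply Rle_trans with (2 := IHHn'). apply Hu, Hn'. }
  destruct HE as [M [HM HE]].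
  set (t := (1 + q) / 2) in *. set (s := q / t).
  assert (Ht : 0 < t < 1) by (unfold t; lra).
  assert (Hs : 0 <= s < 1).
  { unfold s. split; [apply Rdiv_le_0_compat; lra|].
    apply Rmult_lt_reg_r with t; [lra|]. unfold Rdiv. rewrite Rmult_assoc, Rinv_l by lra. unfold t. lra. }
  assert (HL : is_lim_seq (fun n => Rabs C * M * s ^ n) (Rabs C * M * 0)).
  { apply is_lim_seq_mult'; [apply is_lim_seq_const|]. apply is_lim_seq_geom. rewrite Rabs_pos_eq; lra. }
  rewrite Rmult_0_r in HL. apply is_lim_seq_spec in HL. destruct (HL (mkposreal 1 Rlt_0_1)) as [n0 H0].
  exists n0. intros n Hn. specialize (H0 n Hn). apply Rabs_def2 in H0. simpl in H0.
  assert (Hsn : 0 <= s ^ n) by (apply pow_le; lra).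
  replace (q ^ n) with (t ^ n * s ^ n).
  2:{ rewrite <- Rpow_mult_distr. f_equal. unfold s. field. lra. }
  apply Rle_trans with (Rabs C * (INR n ^ p * t ^ n) * s ^ n).
  - rewrite <- Rmult_assoc. apply Rmult_le_compat_r; [exact Hsn|]. rewrite Rmult_assoc.
    apply Rmult_le_compat_r; [|apply Rle_abs].
    apply Rmult_le_pos; apply pow_le; [apply pos_INR | lra].
  - apply Rle_trans with (Rabs C * M * s ^ n); [|lra].
    apply Rmult_le_compat_r; [exact Hsn|]. apply Rmult_le_compat_l; [apply Rabs_pos | apply HE].
Qed.

Lemma exp_root z n : 0 < z -> (0 < n)%nat -> exp (ln z / INR n) ^ n = z.
Proof.
  intros Hz Hn. rewrite <- Rpower_pow by apply exp_pos. unfold Rpower. rewrite ln_exp.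
  assert (0 < INR n) by (apply lt_0_INR, Hn).
  replace (INR n * (ln z / INR n)) with (ln z) by (field; lra). apply exp_ln, Hz.
Qed.

Lemma pow_lt_inv x y n : 0 <= y -> x ^ n < y ^ n -> 0 <= x -> x < y.
Proof.
  intros Hy H Hx. apply Rnot_le_lt. intros C.
  assert (y ^ n <= x ^ n) by (apply pow_incr; lra). lra.
Qed.

Section Resonance.

Variables c0 g0 g1 : R.
Variable A : nat.
Hypothesis Hc0 : 0 < c0 <= 1.
Hypothesis Hg0 : 0 < g0 <= g1.

Section OneSequence.

Variables (e a : R) (W : nat -> R) (N : nat).
Hypothesis HT : tame c0 (INR A) g0 g1 e a W.
Hypothesis He : 0 < e <= 1 / 16.
Hypothesis HN : e * INR N < 1 < e * INR (S N).

Let Wn : forall k, 0 <= W k.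
Proof. exact (W_nonneg _ _ _ _ _ _ _ HT). Qed.

Lemma N_large : (15 <= N)%nat.
Proof.
  apply INR_le. rewrite S_INR in HN. simpl INR at 1.
  assert (H : e * (INR N + 1) <= 1 / 16 * (INR N + 1)).
  { apply Rmult_le_compat_r; [pose proof (pos_INR N); lra | lra]. }
  lra.
Qed.

Lemma low_index k : (k <= N)%nat -> e * INR k < 1.
Proof. intros Hk. apply (low_le _ _ _ _ _ _ _ HT) with N; [exact Hk | apply HN]. Qed.

(** [1 - e k] is [e] times the distance from [k] to [1 / e], which lies between
    [N] and [N + 1]. *)
Lemma gap k : (k <= N)%nat ->
  e * (INR N - INR k) <= 1 - e * INR k <= e * (INR N + 1 - INR k).
Proof. intros Hk. rewrite S_INR in HN. lra. Qed.

(** Up to a power of [N], [W (N - 1)] is [e^(3-N)]: the ratios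
    [(k + a) / (1/e - k - 1)] multiply to a quotient of factorials. *)
Lemma scaled_upper k : (2 <= k)%nat -> (k <= N - 1)%nat ->
  W k * e ^ (k - 2) * INR (fact (N - 3)) <= g1 * INR (fact (k - 1 + A)) * INR (fact (N - 1 - k)).
Proof.
  pose proof N_large as HNl.
  intros Hk. induction Hk; intros HkN.
  - simpl (2 - 2)%nat. simpl pow. replace (N - 1 - 2)%nat with (N - 3)%nat by lia.
    assert (1 <= INR (fact (2 - 1 + A))) by (apply (le_INR 1); pose proof (lt_O_fact (2 - 1 + A)); lia).
    pose proof (INR_fact_lt_0 (N - 3)). assert (W 2%nat <= g1) by apply HT.
    apply Rmult_le_compat_r; [lra|]. rewrite Rmult_1_r.
    apply Rle_trans with (g1 * 1); [lra | apply Rmult_le_compat_l; lra].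
  - specialize (IHHk ltac:(lia)).
    pose proof (W_rec_low _ _ _ _ _ _ _ HT m Hk (low_index (S m) ltac:(lia))) as HR.
    destruct (gap (S m) ltac:(lia)) as [HG _].
    destruct (index_pos _ _ _ _ _ _ _ HT m Hk) as [_ Hi].
    assert (HaA : a <= INR A) by apply HT.
    replace (S m - 2)%nat with (S (m - 2)) by lia.
    replace (S m - 1 + A)%nat with (S (m - 1 + A)) by lia.
    replace (N - 1 - m)%nat with (S (N - 1 - S m)) in IHHk by lia.
    rewrite fact_simpl, mult_INR in IHHk. rewrite (fact_simpl (m - 1 + A)), mult_INR.
    assert (E1 : INR (S (m - 1 + A)) = INR m + INR A) by (rewrite <- plus_INR; f_equal; lia).
    assert (E2 : INR (S (N - 1 - S m)) = INR N - INR (S m)) by (rewrite <- minus_INR by lia; f_equal; lia).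
    rewrite E1. rewrite E2 in IHHk. simpl pow.
    set (F := INR (fact (m - 1 + A))) in *. set (F2 := INR (fact (N - 1 - S m))) in *.
    set (F3 := INR (fact (N - 3))) in *. set (g := INR N - INR (S m)) in *.
    assert (Hg : 0 < g) by (rewrite <- E2; apply lt_0_INR; lia).
    set (x := W m * e ^ (m - 2) * F3) in *.
    assert (HF : 0 < F) by apply INR_fact_lt_0. assert (HF2 : 0 < F2) by apply INR_fact_lt_0.
    assert (HF3 : 0 < F3) by apply INR_fact_lt_0.
    apply Rmult_le_reg_l with g; [exact Hg|].
    apply Rle_trans with ((INR m + INR A) * x).
    + assert (He2 : 0 <= e ^ (m - 2)) by (apply pow_le; lra).
      replace (g * (W (S m) * (e * e ^ (m - 2)) * F3)) with (e * g * W (S m) * (e ^ (m - 2) * F3)) by ring.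
      unfold x. replace ((INR m + INR A) * (W m * e ^ (m - 2) * F3)) with ((INR m + INR A) * W m * (e ^ (m - 2) * F3)) by ring.
      apply Rmult_le_compat_r; [apply Rmult_le_pos; lra|].
      apply Rle_trans with ((1 - e * INR (S m)) * W (S m)).
      * apply Rmult_le_compat_r; [apply Wn | exact HG].
      * rewrite HR. apply Rmult_le_compat_r; [apply Wn | lra].
    + replace (g * (g1 * ((INR m + INR A) * F) * F2)) with ((INR m + INR A) * (g1 * F * (g * F2))) by ring.
      apply Rmult_le_compat_l; [|exact IHHk].
      pose proof (pos_INR m). pose proof (pos_INR A). lra.
Qed.

(** The same quotient from below, with [k + a] replaced by [k - 2], because [a]
    may be close to -2. *)
Lemma scaled_lower k : (3 <= k)%nat -> (k <= N - 1)%nat ->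
  g0 * c0 * INR (fact (k - 3)) * INR (fact (N - k)) <= W k * e ^ (k - 2) * INR (fact (N - 2)).
Proof.
  pose proof N_large as HNl.
  intros Hk. induction Hk; intros HkN.
  - simpl (3 - 3)%nat. replace (3 - 2)%nat with 1%nat by lia. rewrite pow_1.
    change (INR (fact 0)) with 1.
    replace (N - 2)%nat with (S (N - 3)) by lia. rewrite (fact_simpl (N - 3)), mult_INR.
    pose proof (INR_fact_lt_0 (N - 3)) as HF. set (F := INR (fact (N - 3))) in *.
    pose proof (W_rec_low _ _ _ _ _ _ _ HT 2 (le_n _) (low_index 3 ltac:(lia))) as HR.
    destruct (index_pos _ _ _ _ _ _ _ HT 2 (le_n _)) as [_ Hi].
    destruct (gap 3 ltac:(lia)) as [_ HG].
    assert (E2 : INR (S (N - 3)) = INR N + 1 - INR 3).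
    { replace (S (N - 3)) with (N - 2)%nat by lia. rewrite minus_INR by lia. simpl; ring. }
    assert (H2 : g0 <= W 2%nat) by apply HT.
    replace (W 3%nat * e * (INR (S (N - 3)) * F)) with (e * INR (S (N - 3)) * W 3%nat * F) by ring.
    rewrite Rmult_1_r. apply Rmult_le_compat_r; [lra|].
    apply Rle_trans with ((1 - e * INR 3) * W 3%nat).
    + rewrite HR. rewrite Rmult_comm. apply Rmult_le_compat; lra.
    + rewrite E2. apply Rmult_le_compat_r; [apply Wn | exact HG].
  - specialize (IHHk ltac:(lia)).
    pose proof (W_rec_low _ _ _ _ _ _ _ HT m ltac:(lia) (low_index (S m) ltac:(lia))) as HR.
    destruct (gap (S m) ltac:(lia)) as [_ HG].
    destruct (index_pos _ _ _ _ _ _ _ HT m ltac:(lia)) as [Hi _].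
    replace (S m - 2)%nat with (S (m - 2)) by lia.
    replace (S m - 3)%nat with (S (m - 3)) by lia.
    replace (N - m)%nat with (S (N - S m)) in IHHk by lia.
    rewrite (fact_simpl (N - S m)), mult_INR in IHHk. rewrite (fact_simpl (m - 3)), mult_INR.
    assert (E1 : INR (S (m - 3)) = INR m - 2).
    { replace (S (m - 3)) with (m - 2)%nat by lia. rewrite minus_INR by lia. simpl; ring. }
    assert (E2 : INR (S (N - S m)) = INR N + 1 - INR (S m)) by (rewrite S_INR, minus_INR by lia; ring).
    rewrite E1. rewrite E2 in IHHk. simpl pow.
    set (F := INR (fact (m - 3))) in *. set (F2 := INR (fact (N - S m))) in *.
    set (F3 := INR (fact (N - 2))) in *. set (g := INR N + 1 - INR (S m)) in *.
    assert (Hg : 0 < g) by (rewrite <- E2; apply lt_0_INR; lia).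
    set (x := W m * e ^ (m - 2) * F3) in *.
    assert (HF : 0 < F) by apply INR_fact_lt_0. assert (HF2 : 0 < F2) by apply INR_fact_lt_0.
    assert (HF3 : 0 < F3) by apply INR_fact_lt_0.
    assert (Hm2 : 0 < INR m - 2) by (rewrite <- E1; apply lt_0_INR; lia).
    apply Rmult_le_reg_l with g; [exact Hg|].
    apply Rle_trans with ((INR m - 2) * x).
    + replace (g * (g0 * c0 * ((INR m - 2) * F) * F2)) with ((INR m - 2) * (g0 * c0 * F * (g * F2))) by ring.
      apply Rmult_le_compat_l; lra.
    + assert (He2 : 0 <= e ^ (m - 2)) by (apply pow_le; lra).
      replace (g * (W (S m) * (e * e ^ (m - 2)) * F3)) with (e * g * W (S m) * (e ^ (m - 2) * F3)) by ring.
      unfold x. replace ((INR m - 2) * (W m * e ^ (m - 2) * F3)) with ((INR m - 2) * W m * (e ^ (m - 2) * F3)) by ring.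
      apply Rmult_le_compat_r; [apply Rmult_le_pos; lra|].
      apply Rle_trans with ((1 - e * INR (S m)) * W (S m)).
      * rewrite HR. apply Rmult_le_compat_r; [apply Wn | lra].
      * apply Rmult_le_compat_r; [apply Wn | exact HG].
Qed.

Lemma fact_quotient_le n p : INR (fact (n + p)) <= INR (n + p) ^ p * INR (fact n).
Proof.
  induction p.
  - rewrite Nat.add_0_r. simpl. lra.
  - rewrite Nat.add_succ_r, fact_simpl, mult_INR.
    change (INR (S (n + p)) ^ S p) with (INR (S (n + p)) * INR (S (n + p)) ^ p). rewrite Rmult_assoc.
    apply Rmult_le_compat_l; [apply pos_INR|].
    apply Rle_trans with (1 := IHp). apply Rmult_le_compat_r; [left; apply INR_fact_lt_0|].
    apply pow_incr. split; [apply pos_INR | apply le_INR; lia].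
Qed.

Lemma last_upper : W (N - 1)%nat * e ^ (N - 3) <= g1 * INR (N + A) ^ (S A).
Proof.
  pose proof N_large as HNl.
  pose proof (scaled_upper (N - 1) ltac:(lia) (le_n _)) as H.
  replace (N - 1 - (N - 1))%nat with 0%nat in H by lia. change (INR (fact 0)) with 1 in H.
  replace (N - 1 - 2)%nat with (N - 3)%nat in H by lia.
  replace (N - 1 - 1 + A)%nat with (N - 3 + S A)%nat in H by lia.
  pose proof (INR_fact_lt_0 (N - 3)) as HF.
  apply Rmult_le_reg_r with (INR (fact (N - 3))); [exact HF|].
  apply Rle_trans with (1 := H). rewrite Rmult_1_r, Rmult_assoc. apply Rmult_le_compat_l; [lra|].
  apply Rle_trans with (1 := fact_quotient_le (N - 3) (S A)).
  apply Rmult_le_compat_r; [lra|]. apply pow_incr. split; [apply pos_INR | apply le_INR; lia].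
Qed.

Lemma last_lower : g0 * c0 * e ^ 2 <= W (N - 1)%nat * e ^ (N - 3).
Proof.
  pose proof N_large as HNl.
  pose proof (scaled_lower (N - 1) ltac:(lia) (le_n _)) as H.
  replace (N - (N - 1))%nat with 1%nat in H by lia. change (INR (fact 1)) with 1 in H.
  replace (N - 1 - 2)%nat with (N - 3)%nat in H by lia.
  replace (N - 1 - 3)%nat with (N - 4)%nat in H by lia.
  replace (N - 2)%nat with (S (S (N - 4))) in H by lia.
  rewrite !fact_simpl, !mult_INR, Rmult_1_r in H.
  pose proof (INR_fact_lt_0 (N - 4)) as HF. set (F := INR (fact (N - 4))) in *.
  assert (Hi : forall k, (k <= N)%nat -> 0 <= e * INR k <= 1).
  { intros k Hk. split; [apply Rmult_le_pos; [lra | apply pos_INR] | left; apply low_index, Hk]. }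
  pose proof (Hi (S (S (N - 4))) ltac:(lia)) as H1. pose proof (Hi (S (N - 4)) ltac:(lia)) as H2.
  set (n1 := INR (S (S (N - 4)))) in *. set (n2 := INR (S (N - 4))) in *.
  set (w := W (N - 1)%nat * e ^ (N - 3)) in *.
  assert (Hw : 0 <= w) by (apply Rmult_le_pos; [apply Wn | apply pow_le; lra]).
  apply Rmult_le_reg_r with F; [exact HF|].
  replace (g0 * c0 * e ^ 2 * F) with (e ^ 2 * (g0 * c0 * F)) by ring.
  apply Rle_trans with (e ^ 2 * (w * (n1 * (n2 * F)))).
  - apply Rmult_le_compat_l; [apply pow_le; lra | exact H].
  - replace (e ^ 2 * (w * (n1 * (n2 * F)))) with ((e * n1) * (e * n2) * (w * F)) by ring.
    rewrite <- (Rmult_1_l (w * F)) at 2. apply Rmult_le_compat_r; [apply Rmult_le_pos; lra|].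
    rewrite <- (Rmult_1_l 1). apply Rmult_le_compat; lra.
Qed.

Lemma index_large k : (N <= k + 5)%nat -> (2 <= k)%nat -> / (2 * e) <= INR k + a.
Proof.
  intros Hk Hk2. destruct (index_pos _ _ _ _ _ _ _ HT k Hk2) as [Hi _].
  assert (H1 : / e < INR N + 1).
  { rewrite S_INR in HN. apply Rmult_lt_reg_l with e; [lra|]. rewrite Rinv_r; lra. }
  assert (H2 : 16 <= / e).
  { apply Rmult_le_reg_l with e; [lra|]. rewrite Rinv_r; lra. }
  apply le_INR in Hk. rewrite plus_INR in Hk. simpl (INR 5) in Hk.
  replace (/ (2 * e)) with (/ e / 2) by (field; lra). lra.
Qed.

(** [1 - e N < e], so the step to the index [N] multiplies by at least
    [1 / (2 e^2)]. *)
Lemma W_resonant : W (N - 1)%nat <= 2 * e ^ 2 * W N.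
Proof.
  pose proof N_large as HNl.
  pose proof (W_rec_low _ _ _ _ _ _ _ HT (N - 1) ltac:(lia)) as HR.
  replace (S (N - 1)) with N in HR by lia. specialize (HR (proj1 HN)).
  destruct (gap N (le_n _)) as [_ HG]. replace (INR N + 1 - INR N) with 1 in HG by ring.
  pose proof (index_large (N - 1) ltac:(lia) ltac:(lia)) as HI.
  assert (H1 : (INR (N - 1) + a) * W (N - 1)%nat <= e * W N).
  { rewrite <- HR. apply Rmult_le_compat_r; [apply Wn | lra]. }
  assert (H2 : / (2 * e) * W (N - 1)%nat <= e * W N).
  { apply Rle_trans with (2 := H1). apply Rmult_le_compat_r; [apply Wn | exact HI]. }
  apply Rmult_le_reg_l with (/ (2 * e)); [apply Rinv_0_lt_compat; lra|].
  apply Rle_trans with (1 := H2). right. field. lra.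
Qed.

Section Radius.

Variable Y : R.
Hypothesis HY : 4 / 5 * e <= Y <= e.
Hypothesis Hlast : W (N - 1)%nat * Y ^ (N - 1) <= e ^ 2.

Let t := fun k => W k * Y ^ k.

Let t_pos : forall k, 0 <= t k.
Proof. intros k. apply Rmult_le_pos; [apply Wn | apply pow_le; lra]. Qed.

Lemma t_rec k : (2 <= k)%nat -> (S k <= N)%nat ->
  (1 - e * INR (S k)) * t (S k) = (INR k + a) * Y * t k.
Proof.
  intros Hk HkN. pose proof (W_rec_low _ _ _ _ _ _ _ HT k Hk (low_index _ HkN)) as HR.
  unfold t. simpl pow. rewrite <- Rmult_assoc, HR. ring.
Qed.

(** Log-convexity: the ratio [(k + a) Y / (1 - e (k + 1))] increases with [k]. *)
Lemma t_turn k : (3 <= k)%nat -> (S k <= N)%nat -> t (S k) <= t k -> t k <= t (pred k).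
Proof.
  intros Hk HkN H. destruct k as [|k]; [lia|]. simpl pred.
  pose proof (t_rec k ltac:(lia) ltac:(lia)) as R1.
  pose proof (t_rec (S k) ltac:(lia) HkN) as R2.
  pose proof (low_index (S (S k)) HkN) as L2. pose proof (low_index (S k) ltac:(lia)) as L1.
  destruct (index_pos _ _ _ _ _ _ _ HT k ltac:(lia)) as [_ Hi].
  rewrite (S_INR (S k)) in *. rewrite (S_INR k) in *.
  pose proof (t_pos (S k)) as P1. pose proof (t_pos k) as P0.
  set (x := INR k) in *.
  assert (Hc : (x + 1 + a) * Y * t (S k) <= (1 - e * (x + 1 + 1)) * t (S k)).
  { rewrite <- R2. apply Rmult_le_compat_l; lra. }
  destruct (Rle_lt_or_eq_dec _ _ P1) as [P1'|P1'].
  2:{ rewrite <- P1'. exact P0. }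
  assert (Hq : (x + 1 + a) * Y <= 1 - e * (x + 1 + 1)).
  { apply Rmult_le_reg_r with (t (S k)); assumption. }
  assert (Hq2 : (x + a) * Y <= 1 - e * (x + 1)).
  { assert ((x + a) * Y <= (x + 1 + a) * Y) by (apply Rmult_le_compat_r; lra). lra. }
  apply Rmult_le_reg_l with (1 - e * (x + 1)); [lra|].
  rewrite R1. apply Rmult_le_compat_r; assumption.
Qed.

Lemma t_down k j : (2 <= j <= k)%nat -> (S k <= N)%nat -> t (S k) <= t k -> t k <= t j.
Proof.
  intros [H2 Hj]. induction Hj; intros HkN H; [lra|].
  pose proof (t_turn (S m) ltac:(lia) HkN H) as H'. simpl pred in H'.
  apply Rle_trans with (1 := H'). apply IHHj; [lia | exact H'].
Qed.

Lemma t_up k j : (2 <= k < j)%nat -> (j <= N)%nat -> t k < t (S k) -> t k < t j.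
Proof.
  intros Hk HjN H.
  assert (G : forall i, (i + S k <= N)%nat -> t k < t (i + S k)%nat /\ t (i + k)%nat < t (i + S k)%nat).
  { induction i; intros Hi; [simpl; auto|].
    destruct (IHi ltac:(lia)) as [A1 A2].
    assert (A3 : t (i + S k)%nat < t (S i + S k)%nat).
    { apply Rnot_le_lt. intros C. pose proof (t_turn (i + S k) ltac:(lia) Hi C) as C'.
      replace (pred (i + S k)) with (i + k)%nat in C' by lia. lra. }
    split; [lra|]. replace (S i + k)%nat with (i + S k)%nat by lia. exact A3. }
  replace j with ((j - S k) + S k)%nat by lia. apply G. lia.
Qed.

(** By log-convexity the terms of orders 4 to [N - 3] are at most
    [t 4 + t (N - 3) = O(e^4)], and there are fewer than [1 / e] of them; the
    two terms at each end are geometric in [e]. *)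
Lemma low_sum L : psum (below N W) Y L <= (g1 + 8 * (2 + INR A) * g1 + 16 * (2 + INR A) * (3 + INR A) * g1 + 100) * e ^ 2.
Proof.
  pose proof N_large as HNl. pose proof (pos_INR A) as HA0.
  assert (HaA : c0 - 2 <= a <= INR A) by apply HT.
  assert (Hg1 : W 2%nat <= g1) by apply HT.
  assert (T2 : t 2%nat <= g1 * e ^ 2).
  { unfold t. apply Rmult_le_compat; [apply Wn | apply pow_le; lra | exact Hg1 | apply pow_incr; lra]. }
  assert (T3 : t 3%nat <= 2 * (2 + INR A) * e * t 2%nat).
  { pose proof (t_rec 2 (le_n _) ltac:(lia)) as HR. simpl INR in HR.
    assert (HYa : (1 + 1 + a) * Y <= (2 + INR A) * e) by (apply Rmult_le_compat; lra).
    assert ((1 + 1 + a) * Y * t 2%nat <= (2 + INR A) * e * t 2%nat) by (apply Rmult_le_compat_r; auto).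
    assert (1 / 2 * t 3%nat <= (1 - e * (1 + 1 + 1)) * t 3%nat) by (apply Rmult_le_compat_r; [auto | lra]).
    lra. }
  assert (T4 : t 4%nat <= 2 * (3 + INR A) * e * t 3%nat).
  { pose proof (t_rec 3 ltac:(lia) ltac:(lia)) as HR. simpl INR in HR.
    assert (HYa : (1 + 1 + 1 + a) * Y <= (3 + INR A) * e) by (apply Rmult_le_compat; lra).
    assert ((1 + 1 + 1 + a) * Y * t 3%nat <= (3 + INR A) * e * t 3%nat) by (apply Rmult_le_compat_r; auto).
    assert (1 / 2 * t 4%nat <= (1 - e * (1 + 1 + 1 + 1)) * t 4%nat) by (apply Rmult_le_compat_r; [auto | lra]).
    lra. }
  assert (TN1 : t (N - 1)%nat <= e ^ 2) by exact Hlast.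
  assert (Tdown : forall k i, (2 <= k)%nat -> (N - S k = i)%nat -> (S k <= N)%nat -> (N <= k + 5)%nat ->
     t k <= 5 / 2 * (INR i + 1) * e * t (S k)).
  { intros k i Hk Hi HkN Hk5. pose proof (t_rec k Hk HkN) as HR.
    destruct (gap (S k) HkN) as [_ HG].
    replace (INR N + 1 - INR (S k)) with (INR i + 1) in HG.
    2:{ rewrite <- Hi, minus_INR by lia. ring. }
    pose proof (index_large k Hk5 Hk) as HI.
    assert (HIY : 2 / 5 <= (INR k + a) * Y).
    { apply Rle_trans with (/ (2 * e) * (4 / 5 * e)); [right; field; lra|].
      apply Rmult_le_compat; try lra. left. apply Rinv_0_lt_compat. lra. }
    assert (H1 : 2 / 5 * t k <= (INR k + a) * Y * t k) by (apply Rmult_le_compat_r; auto).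
    assert (H2 : (1 - e * INR (S k)) * t (S k) <= e * (INR i + 1) * t (S k)) by (apply Rmult_le_compat_r; auto).
    lra. }
  pose proof (Tdown (N - 2)%nat 1%nat ltac:(lia) ltac:(lia) ltac:(lia) ltac:(lia)) as TN2.
  replace (S (N - 2)) with (N - 1)%nat in TN2 by lia. simpl INR in TN2.
  pose proof (Tdown (N - 3)%nat 2%nat ltac:(lia) ltac:(lia) ltac:(lia) ltac:(lia)) as TN3.
  replace (S (N - 3)) with (N - 2)%nat in TN3 by lia. simpl INR in TN3.
  set (cm := t 4%nat + t (N - 3)%nat).
  assert (Hcm : 0 <= cm) by (unfold cm; pose proof (t_pos 4); pose proof (t_pos (N - 3)); lra).
  assert (Hmid : forall k, (4 <= k <= N - 3)%nat -> t k <= cm).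
  { intros k Hk. unfold cm. pose proof (t_pos 4) as P4. pose proof (t_pos (N - 3)) as P3.
    destruct (Nat.eq_dec k (N - 3)) as [->|Hne]; [lra|].
    destruct (Rle_lt_dec (t (S k)) (t k)) as [H|H].
    - pose proof (t_down k 4 ltac:(lia) ltac:(lia) H). lra.
    - pose proof (t_up k (N - 3) ltac:(lia) ltac:(lia) H). lra. }
  assert (Hsum : psum (below N W) Y L <= t 2%nat + t 3%nat + t (N - 2)%nat + t (N - 1)%nat + INR N * cm).
  { apply Rle_trans with (sum_f_R0 (fun k =>
      ((((if Nat.eq_dec k 2 then t 2%nat else 0) + (if Nat.eq_dec k 3 then t 3%nat else 0))
       + (if Nat.eq_dec k (N - 2) then t (N - 2)%nat else 0)) + (if Nat.eq_dec k (N - 1) then t (N - 1)%nat else 0))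
       + (if lt_dec k N then cm else 0)) L).
    - apply sum_Rle. intros k _. unfold below.
      pose proof (t_pos 2). pose proof (t_pos 3). pose proof (t_pos (N - 2)). pose proof (t_pos (N - 1)).
      assert (Hz : forall j, (j < 2)%nat -> W j = 0).
      { intros j Hj. destruct HT as (_ & _ & (W0 & W1 & _) & _). destruct j as [|[|]]; auto; lia. }
      destruct (lt_dec k N) as [HkN|HkN].
      + fold (t k).
        destruct (Nat.eq_dec k 2) as [->|N2]; [destruct (Nat.eq_dec 2 3), (Nat.eq_dec 2 (N - 2)), (Nat.eq_dec 2 (N - 1)); lra|].
        destruct (Nat.eq_dec k 3) as [->|N3]; [destruct (Nat.eq_dec 3 (N - 2)), (Nat.eq_dec 3 (N - 1)); lra|].
        destruct (Nat.eq_dec k (N - 2)) as [->|N4]; [destruct (Nat.eq_dec (N - 2) (N - 1)); lra|].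
        destruct (Nat.eq_dec k (N - 1)) as [->|N5]; [lra|].
        rewrite !Rplus_0_l. destruct (le_lt_dec 4 k) as [H4|H4]; [apply Hmid; lia|].
        unfold t. rewrite Hz by lia. lra.
      + rewrite Rmult_0_l.
        destruct (Nat.eq_dec k 2), (Nat.eq_dec k 3), (Nat.eq_dec k (N - 2)), (Nat.eq_dec k (N - 1)); lra.
    - rewrite !plus_sum.
      pose proof (sum_indicator_le (t 2%nat) 2 L (t_pos _)).
      pose proof (sum_indicator_le (t 3%nat) 3 L (t_pos _)).
      pose proof (sum_indicator_le (t (N - 2)%nat) (N - 2) L (t_pos _)).
      pose proof (sum_indicator_le (t (N - 1)%nat) (N - 1) L (t_pos _)).
      pose proof (sum_below_const cm N L Hcm). lra. }
  apply Rle_trans with (1 := Hsum).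
  pose proof (t_pos 2) as P2. pose proof (t_pos 3) as P3. pose proof (t_pos (N - 1)) as PN1. pose proof (t_pos (N - 2)) as PN2.
  assert (HeN : e * INR N <= 1) by (left; apply HN).
  assert (He2 : 0 < e ^ 2) by (apply pow_lt; lra).
  assert (B3 : t 3%nat <= 2 * (2 + INR A) * e * (g1 * e ^ 2)).
  { apply Rle_trans with (1 := T3). apply Rmult_le_compat_l; [|exact T2]. apply Rmult_le_pos; lra. }
  assert (Bsm : forall z, 0 <= z -> e * z <= z).
  { intros z Hz. rewrite <- (Rmult_1_l z) at 2. apply Rmult_le_compat_r; lra. }
  assert (G2 : 0 <= (2 + INR A) * (g1 * e ^ 2)) by (apply Rmult_le_pos; [lra | apply Rmult_le_pos; lra]).
  assert (B3' : t 3%nat <= 2 * ((2 + INR A) * (g1 * e ^ 2))).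
  { pose proof (Bsm _ G2). lra. }
  assert (BN4 : INR N * t 4%nat <= 2 * (3 + INR A) * (2 * ((2 + INR A) * (g1 * e ^ 2)))).
  { apply Rle_trans with (INR N * (2 * (3 + INR A) * e * t 3%nat)).
    - apply Rmult_le_compat_l; [apply pos_INR | exact T4].
    - replace (INR N * (2 * (3 + INR A) * e * t 3%nat)) with (e * INR N * (2 * (3 + INR A) * t 3%nat)) by ring.
      apply Rle_trans with (1 * (2 * (3 + INR A) * t 3%nat)).
      + apply Rmult_le_compat_r; [apply Rmult_le_pos; lra | exact HeN].
      + rewrite Rmult_1_l. apply Rmult_le_compat_l; lra. }
  assert (BN2 : t (N - 2)%nat <= 5 * e ^ 2).
  { pose proof (Bsm _ PN1). lra. }
  assert (BN3 : INR N * t (N - 3)%nat <= 15 / 2 * (5 * e ^ 2)).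
  { apply Rle_trans with (INR N * (5 / 2 * (1 + 1 + 1) * e * t (N - 2)%nat)).
    - apply Rmult_le_compat_l; [apply pos_INR | exact TN3].
    - replace (INR N * (5 / 2 * (1 + 1 + 1) * e * t (N - 2)%nat)) with (e * INR N * (15 / 2 * t (N - 2)%nat)) by field.
      apply Rle_trans with (1 * (15 / 2 * t (N - 2)%nat)).
      + apply Rmult_le_compat_r; [lra | exact HeN].
      + lra. }
  assert (G3 : 0 <= (3 + INR A) * ((2 + INR A) * (g1 * e ^ 2))) by (apply Rmult_le_pos; lra).
  unfold cm. rewrite Rmult_plus_distr_l. lra.
Qed.

End Radius.
End OneSequence.

(** [Y] is the radius at which the last low-order term [W (N - 1) Y^(N-1)]
    equals [e^2], or [e] if that is smaller.  A smaller radius would lose the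
    lower bound on [W N Y^(N+1)], a larger one the bound on the sum. *)
Lemma radius_choice : exists C5 C9 e2, 0 < C5 /\ 0 < C9 /\ 0 < e2 <= 1 / 16 /\
  forall e a W N, tame c0 (INR A) g0 g1 e a W -> 0 < e < e2 ->
    e * INR N < 1 < e * INR (S N) ->
    W (N - 1)%nat * (4 / 5 * e) ^ (N - 1) <= e ^ 2 /\
    exists Y, 4 / 5 * e <= Y <= e /\
      (forall L, psum (below N W) Y L <= C5 * e ^ 2) /\
      e ^ 4 <= C9 * W N * Y ^ S N.
Proof.
  destruct (poly_geom_small (S A) (4 / 5) (g1 * (2 ^ S A * (5 / 4))) ltac:(lra)) as [n0 Hn0].
  set (nA := (n0 + A)%nat).
  pose proof (pos_INR A) as HA0. pose proof (pos_INR nA) as HnA0.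
  exists (g1 + 8 * (2 + INR A) * g1 + 16 * (2 + INR A) * (3 + INR A) * g1 + 100),
    (2 / (g0 * c0) + 8), (Rmin (1 / 16) (/ (INR nA + 1))).
  assert (Hgc : 0 < g0 * c0) by (apply Rmult_lt_0_compat; lra).
  assert (Hgi : 0 < 2 / (g0 * c0)) by (apply Rdiv_lt_0_compat; lra).
  split; [|split; [lra|split; [split; [apply Rmin_pos; [lra | apply Rinv_0_lt_compat; lra] | apply Rmin_l]|]]].
  { assert (0 <= (2 + INR A) * g1) by (apply Rmult_le_pos; lra).
    assert (0 <= 16 * (2 + INR A) * (3 + INR A) * g1) by (repeat apply Rmult_le_pos; lra). lra. }
  intros e a W N HT He HN.
  pose proof (Rmin_l (1 / 16) (/ (INR nA + 1))) as M1. pose proof (Rmin_r (1 / 16) (/ (INR nA + 1))) as M2.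
  assert (He16 : 0 < e <= 1 / 16) by lra.
  pose proof (N_large e N He16 HN) as HNl.
  assert (HNA : (nA <= N)%nat).
  { assert (H : INR nA < INR (S N)).
    { apply Rmult_lt_reg_l with e; [lra|].
      apply Rle_lt_trans with 1; [|apply HN].
      apply Rle_trans with (/ (INR nA + 1) * (INR nA + 1)); [|right; field; lra].
      apply Rmult_le_compat; lra. }
    apply INR_lt in H. lia. }
  assert (Wn : forall k, 0 <= W k) by exact (W_nonneg _ _ _ _ _ _ _ HT).
  pose proof (last_upper e a W N HT He16 HN) as HU.
  pose proof (last_lower e a W N HT He16 HN) as HL.
  pose proof (W_resonant e a W N HT He16 HN) as HW.
  assert (Hsplit : forall x, x ^ (N - 1) = x ^ 2 * x ^ (N - 3)) by (intros x; rewrite <- pow_add; f_equal; lia).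
  assert (Hsm : W (N - 1)%nat * (4 / 5 * e) ^ (N - 1) <= e ^ 2).
  { rewrite Rpow_mult_distr, (Hsplit e).
    replace (W (N - 1)%nat * ((4 / 5) ^ (N - 1) * (e ^ 2 * e ^ (N - 3)))) with
      (e ^ 2 * ((4 / 5) ^ (N - 1) * (W (N - 1)%nat * e ^ (N - 3)))) by ring.
    rewrite <- (Rmult_1_r (e ^ 2)) at 2. apply Rmult_le_compat_l; [apply pow_le; lra|].
    apply Rle_trans with (2 := Hn0 N ltac:(unfold nA in *; lia)).
    assert (H45 : (4 / 5) ^ (N - 1) = 5 / 4 * (4 / 5) ^ N).
    { replace N with (S (N - 1)) at 2 by lia. simpl. field. }
    rewrite H45.
    assert (Hp : 0 < (4 / 5) ^ N) by (apply pow_lt; lra).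
    apply Rle_trans with (5 / 4 * (4 / 5) ^ N * (g1 * INR (N + A) ^ S A)).
    - apply Rmult_le_compat_l; [lra | exact HU].
    - assert (HNA2 : INR (N + A) ^ S A <= (2 * INR N) ^ S A).
      { apply pow_incr. split; [apply pos_INR|]. rewrite plus_INR.
        assert (INR A <= INR N) by (apply le_INR; unfold nA in *; lia). lra. }
      rewrite Rpow_mult_distr in HNA2.
      replace (g1 * (2 ^ S A * (5 / 4)) * INR N ^ S A * (4 / 5) ^ N) with
        (5 / 4 * (4 / 5) ^ N * (g1 * (2 ^ S A * INR N ^ S A))) by ring.
      apply Rmult_le_compat_l; [lra|]. apply Rmult_le_compat_l; lra. }
  split; [exact Hsm|].
  assert (He2 : 0 < e ^ 2) by (apply pow_lt; lra).
  assert (He4 : 0 < e ^ 4) by (apply pow_lt; lra).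
  assert (HWp : 0 < W (N - 1)%nat).
  { destruct HT as (_ & _ & (_ & _ & Wp & _) & _). apply Wp. lia. }
  destruct (Rle_lt_dec (W (N - 1)%nat * e ^ (N - 1)) (e ^ 2)) as [Hc|Hc].
  - exists e. split; [lra|]. split.
    + intros L. apply (low_sum e a W N HT He16 HN e); [lra | exact Hc].
    + assert (H1 : W (N - 1)%nat * e ^ (N - 1) <= 2 * (W N * e ^ S N)).
      { replace (2 * (W N * e ^ S N)) with (2 * e ^ 2 * W N * e ^ (N - 1)).
        - apply Rmult_le_compat_r; [apply pow_le; lra | exact HW].
        - replace (S N) with (2 + (N - 1))%nat by lia. rewrite pow_add. ring. }
      assert (H2 : g0 * c0 * e ^ 4 <= W (N - 1)%nat * e ^ (N - 1)).
      { rewrite Hsplit. replace (W (N - 1)%nat * (e ^ 2 * e ^ (N - 3))) with (e ^ 2 * (W (N - 1)%nat * e ^ (N - 3))) by ring.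
        replace (g0 * c0 * e ^ 4) with (e ^ 2 * (g0 * c0 * e ^ 2)) by ring.
        apply Rmult_le_compat_l; lra. }
      assert (HX : 0 <= W N * e ^ S N) by (apply Rmult_le_pos; [apply Wn | apply pow_le; lra]).
      apply Rle_trans with (2 / (g0 * c0) * (W N * e ^ S N)).
      * apply Rmult_le_reg_l with (g0 * c0); [exact Hgc|].
        replace (g0 * c0 * (2 / (g0 * c0) * (W N * e ^ S N))) with (2 * (W N * e ^ S N)) by (field; lra). lra.
      * rewrite (Rmult_assoc (2 / (g0 * c0) + 8)). apply Rmult_le_compat_r; lra.
  - set (z := e ^ 2 / W (N - 1)%nat). assert (Hz : 0 < z) by (apply Rdiv_lt_0_compat; assumption).
    set (Y := exp (ln z / INR (N - 1))).
    assert (HYp : Y ^ (N - 1) = z) by (apply exp_root; [exact Hz | lia]).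
    assert (HY0 : 0 < Y) by apply exp_pos.
    assert (HWz : W (N - 1)%nat * z = e ^ 2) by (unfold z; field; lra).
    assert (HY1 : Y < e).
    { apply pow_lt_inv with (N - 1)%nat; [lra | | lra]. rewrite HYp.
      apply Rmult_lt_reg_l with (W (N - 1)%nat); [exact HWp|]. lra. }
    assert (HY2 : 4 / 5 * e <= Y).
    { apply Rnot_lt_le. intros C.
      assert (Y ^ (N - 1) < (4 / 5 * e) ^ (N - 1)).
      { assert (Hpm : forall n, (0 < n)%nat -> Y ^ n < (4 / 5 * e) ^ n).
        { induction n as [|[|n] IH]; intros Hn; [lia | simpl; lra |].
          specialize (IH ltac:(lia)). change (Y * Y ^ S n < 4 / 5 * e * (4 / 5 * e) ^ S n).
          apply Rmult_gt_0_lt_compat; [apply Rlt_gt, pow_lt; lra | lra | lra | exact IH]. }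
        apply Hpm. lia. }
      rewrite HYp in H.
      apply (Rmult_lt_compat_l (W (N - 1)%nat)) in H; [|exact HWp]. lra. }
    exists Y. split; [lra|]. split.
    + intros L. apply (low_sum e a W N HT He16 HN Y); [lra|]. rewrite HYp, HWz. lra.
    + assert (H1 : W (N - 1)%nat * Y ^ (N - 1) * Y ^ 2 <= 2 * e ^ 2 * (W N * Y ^ S N)).
      { replace (2 * e ^ 2 * (W N * Y ^ S N)) with (2 * e ^ 2 * W N * (Y ^ (N - 1) * Y ^ 2)).
        - rewrite Rmult_assoc. apply Rmult_le_compat_r; [|exact HW].
          apply Rmult_le_pos; apply pow_le; lra.
        - replace (S N) with (2 + (N - 1))%nat by lia. rewrite pow_add. ring. }
      rewrite HYp, HWz in H1.
      assert (HYY : (4 / 5 * e) ^ 2 <= Y ^ 2) by (apply pow_incr; lra).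
      assert (H2 : Y ^ 2 <= 2 * (W N * Y ^ S N)).
      { apply Rmult_le_reg_l with (e ^ 2); [exact He2|]. lra. }
      assert (H3 : 16 / 25 * e ^ 2 <= 2 * (W N * Y ^ S N)).
      { apply Rle_trans with (2 := H2). apply Rle_trans with (2 := HYY). right. field. }
      assert (H4 : e ^ 4 <= e ^ 2).
      { replace (e ^ 4) with (e ^ 2 * e ^ 2) by ring.
        rewrite <- (Rmult_1_r (e ^ 2)) at 3. apply Rmult_le_compat_l; [lra|].
        rewrite <- (pow1 2). apply pow_incr. lra. }
      assert (HX : 0 <= W N * Y ^ S N) by (apply Rmult_le_pos; [apply Wn | apply pow_le; lra]).
      assert (0 <= 2 / (g0 * c0) * (W N * Y ^ S N)) by (apply Rmult_le_pos; lra).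
      rewrite Rmult_assoc, Rmult_plus_distr_r. lra.
Qed.

End Resonance.

(** * Negative arguments *)

(** The sequence [(b)_n / (c)_n] of the hypergeometric series 2F1(1, b; c). *)
Fixpoint poch_ratio (b c : R) (n : nat) : R :=
  match n with
  | O => 1
  | S n => poch_ratio b c n * ((b + INR n) / (c + INR n))
  end.

(** The geometric ratio test with a constant that does not depend on the
    sequence. *)
Lemma ratio_sums (rho : nat -> R) K : (forall n, 0 <= rho n) ->
  (forall n, (K <= n)%nat -> rho n <= 1 / 2) ->
  exists C, 0 < C /\ forall (v : nat -> R), (forall n, 0 <= v n) ->
    (forall n, v (S n) <= rho n * v n) -> forall L, sum_f_R0 v L <= C * v 0%nat.
Proof.
  intros Hr0 Hr.
  set (g := fix g n := match n with O => 1 | S k => rho k * g k end).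
  assert (Hg : forall n, 0 <= g n).
  { induction n; [simpl; lra|]. simpl. apply Rmult_le_pos; auto. }
  assert (HS : forall n, sum_f_R0 g (n + K) + g (n + K)%nat <= sum_f_R0 g K + g K).
  { induction n; [simpl; lra|]. change (S n + K)%nat with (S (n + K)). rewrite sum_S.
    change (g (S (n + K))) with (rho (n + K)%nat * g (n + K)%nat).
    pose proof (Hg (n + K)%nat).
    assert (rho (n + K)%nat * g (n + K)%nat <= 1 / 2 * g (n + K)%nat) by (apply Rmult_le_compat_r; [auto | apply Hr; lia]).
    lra. }
  exists (sum_f_R0 g K + g K + 1).
  assert (0 <= sum_f_R0 g K) by (apply sum_nonneg; auto). pose proof (Hg K).
  split; [lra|]. intros v Hv0 Hv L.
  assert (Hvg : forall n, v n <= g n * v 0%nat).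
  { induction n; [simpl; lra|]. simpl g. apply Rle_trans with (1 := Hv n).
    rewrite Rmult_assoc. apply Rmult_le_compat_l; auto. }
  apply Rle_trans with (sum_f_R0 (fun n => v 0%nat * g n) L).
  - apply sum_Rle. intros n _. rewrite Rmult_comm. apply Hvg.
  - rewrite sum_scal, Rmult_comm. apply Rmult_le_compat_r; [apply Hv0|].
    apply Rle_trans with (sum_f_R0 g (L + K)); [apply sum_mono_len; [intros; apply Hg | lia]|].
    pose proof (HS L). pose proof (Hg (L + K)%nat). lra.
Qed.

(** For [c] close to 1 the function 2F1(1, b; c; -x) is close to
    [(1 + x)^(-b)], which is at least [exp (- b x)]: the product of the two is
    1 at the origin and has derivative proportional to [c - 1]. *)
Lemma hypergeometric_bounds Z : 0 < Z -> exists C, 0 < C /\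
  forall b c s, 1 <= b -> 1 / 2 <= c -> 0 <= s <= 1 / 8 -> b * s <= Z ->
    (exists s', s < s' /\ exists M, abs_bounded (poch_ratio b c) s' M) /\
    PSeries (poch_ratio b c) s <= C /\
    exp (- Z) - C * Rabs (c - 1) <= Rabs (PSeries (poch_ratio b c) (- s)).
Proof.
  intros HZ.
  destruct (nfloor_ex (16 * Z)) as [K0 HK0]; [lra|].
  (* bounds the ratios of consecutive terms as long as b x <= 2 Z + 1, which
     leaves room for a radius of convergence beyond s *)
  set (rho := fun n => (2 * Z + INR (S n) / 4 + 1) / (INR (S n) + 1 / 2)).
  destruct (ratio_sums rho (S K0 + 8)) as [CG0 [HCG0 HG0]].
  { intros n. unfold rho. pose proof (pos_INR (S n)). apply Rdiv_le_0_compat; lra. }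
  { intros n Hn. unfold rho. apply le_INR in Hn. rewrite plus_INR, (S_INR K0) in Hn. simpl (INR 8) in Hn.
    rewrite (S_INR n). pose proof (pos_INR n). apply Rmult_le_reg_r with (INR n + 1 + 1 / 2); [lra|].
    unfold Rdiv at 1. rewrite Rmult_assoc, Rinv_l by lra. lra. }
  set (CG := CG0 + 1). assert (HCG : 1 < CG) by (unfold CG; lra).
  assert (HG : forall v, (forall n, 0 <= v n) -> (forall n, v (S n) <= rho n * v n) ->
     forall L, sum_f_R0 v L <= CG * v 0%nat).
  { intros v Hv0 Hv L. apply Rle_trans with (1 := HG0 v Hv0 Hv L).
    apply Rmult_le_compat_r; [apply Hv0 | unfold CG; lra]. }
  clearbody CG.
  exists (1 + 4 * Z * CG + CG * 2 * exp Z * Z + 1).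
  assert (HeZ : 0 < exp Z) by apply exp_pos.
  assert (HZC : 0 <= Z * CG) by (apply Rmult_le_pos; lra).
  assert (HZCe : 0 <= CG * 2 * exp Z * Z) by (repeat apply Rmult_le_pos; lra).
  split; [lra|]. intros b c s Hb Hc Hs Hbs.
  set (q := poch_ratio b c).
  assert (Hq0 : forall n, 0 <= q n).
  { induction n; [unfold q; simpl; lra|]. unfold q. simpl. apply Rmult_le_pos; [exact IHn|].
    pose proof (pos_INR n). apply Rdiv_le_0_compat; lra. }
  assert (Hsum : forall x L, 0 <= x -> b * x <= 2 * Z + 1 -> x <= 1 / 4 ->
     sum_f_R0 (fun n => q (S n) * x ^ S n) L <= CG * (2 * (b * x))).
  { intros x L Hx Hbx Hx4.
    apply Rle_trans with (CG * (q 1%nat * x ^ 1)).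
    - apply (HG (fun n => q (S n) * x ^ S n)).
      + intros n. apply Rmult_le_pos; [apply Hq0 | apply pow_le, Hx].
      + intros n. pose proof (pos_INR (S n)) as HnS.
        replace (q (S (S n)) * x ^ S (S n)) with ((b + INR (S n)) / (c + INR (S n)) * x * (q (S n) * x ^ S n)).
        2:{ change (q (S (S n))) with (q (S n) * ((b + INR (S n)) / (c + INR (S n)))). simpl pow. ring. }
        apply Rmult_le_compat_r; [apply Rmult_le_pos; [apply Hq0 | apply pow_le, Hx]|].
        unfold rho.
        replace ((b + INR (S n)) / (c + INR (S n)) * x) with ((b * x + INR (S n) * x) * / (c + INR (S n))) by (field; lra).
        apply Rmult_le_compat.
        * apply Rplus_le_le_0_compat; apply Rmult_le_pos; lra.
        * left. apply Rinv_0_lt_compat. lra.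
        * assert (INR (S n) * x <= INR (S n) * (1 / 4)) by (apply Rmult_le_compat_l; lra). lra.
        * apply Rinv_le_contravar; lra.
    - apply Rmult_le_compat_l; [lra|]. unfold q. simpl. rewrite Rmult_1_l, !Rplus_0_r, Rmult_1_r.
      rewrite <- Rmult_assoc. apply Rmult_le_compat_r; [lra|].
      apply Rmult_le_reg_r with c; [lra|]. unfold Rdiv. rewrite Rmult_assoc, Rinv_l by lra.
      assert (b * 1 <= b * (2 * c)) by (apply Rmult_le_compat_l; lra). lra. }
  assert (Habs : forall x, 0 <= x -> b * x <= 2 * Z + 1 -> x <= 1 / 4 -> forall L, psum q x L <= 1 + CG * (2 * (b * x))).
  { intros x Hx Hbx Hx4 L. apply Rle_trans with (psum q x (S L)); [apply psum_mono_len; auto|].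
    unfold psum. rewrite sum_shift. change (q 0%nat) with 1. simpl pow at 1. rewrite Rmult_1_l.
    apply Rplus_le_compat_l, Hsum; auto. }
  set (s' := Rmin (1 / 4) (s + s + / b)).
  assert (Hib : 0 < / b <= 1).
  { split; [apply Rinv_0_lt_compat; lra|]. rewrite <- Rinv_1. apply Rinv_le_contravar; lra. }
  assert (Hs' : s < s') by (unfold s'; apply Rmin_glb_lt; lra).
  assert (Hs'4 : s' <= 1 / 4) by apply Rmin_l.
  assert (Hbs' : b * s' <= 2 * Z + 1).
  { apply Rle_trans with (b * (s + s + / b)); [apply Rmult_le_compat_l; [lra | apply Rmin_r]|].
    replace (b * (s + s + / b)) with (2 * (b * s) + 1) by (field; lra). lra. }
  assert (Hab : forall x, 0 <= x -> x <= s -> abs_bounded q x (1 + CG * (2 * (b * x)))).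
  { intros x Hx Hxs L. assert (b * x <= b * s) by (apply Rmult_le_compat_l; lra).
    apply Rle_trans with (psum q x L); [|apply Habs; lra].
    apply psum_le; [exact Hx|]. intros k _. rewrite Rabs_pos_eq; auto. lra. }
  assert (Hab' : abs_bounded q s' (1 + CG * (2 * (b * s')))).
  { intros L. apply Rle_trans with (psum q s' L); [|apply Habs; lra].
    apply psum_le; [lra|]. intros k _. rewrite Rabs_pos_eq; auto. lra. }
  split; [exists s'; split; [exact Hs' | exists (1 + CG * (2 * (b * s'))); exact Hab']|].
  split.
  { apply Rle_trans with (1 := Rle_abs _).
    apply Rle_trans with (1 + CG * (2 * (b * s))).
    - apply abs_bounded_PSeries_le. rewrite Rabs_pos_eq by lra. apply Hab; lra.
    - assert (CG * (2 * (b * s)) <= CG * (2 * Z)) by (apply Rmult_le_compat_l; lra). lra. }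
  destruct (Req_dec s 0) as [Hs0|Hs0].
  { rewrite Hs0, Ropp_0, PSeries_0. change (q 0%nat) with 1. rewrite Rabs_R1.
    assert (exp (- Z) <= 1) by (rewrite <- exp_0; apply exp_le_mono; lra).
    assert (0 <= (1 + 4 * Z * CG + CG * 2 * exp Z * Z + 1) * Rabs (c - 1)) by (apply Rmult_le_pos; [lra | apply Rabs_pos]).
    lra. }
  assert (Hrad : forall x, 0 <= x <= s -> Rbar_lt (Rabs (- x)) (CV_radius q)).
  { intros x Hx. rewrite Rabs_Ropp, Rabs_pos_eq by lra.
    apply Rbar_lt_le_trans with (Finite s'); [simpl; lra|]. apply abs_bounded_radius with (2 := Hab'). lra. }
  set (F := PSeries q).
  assert (HFode : forall x, 0 <= x <= s ->
     x * (1 + x) * Derive F (- x) = (b * x + (c - 1)) * F (- x) - (c - 1)).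
  { intros x Hx.
    pose proof (L_pseries 1 b q (- x) (Hrad x Hx)) as HL. fold F in HL.
    (* by its recursion, Lcoef 1 b q is - c q except for the term of order 0 *)
    assert (HLc : is_pseries (Lcoef 1 b q) (- x) (- c * F (- x) + (c - 1))).
    { pose proof (PSeries_correct q (- x) (CV_radius_inside q (- x) (Hrad x Hx))) as HP.
      apply is_pseries_R in HP. apply is_pseries_R.
      pose proof (is_series_scal_l (- c) _ _ HP) as S1.
      assert (S2 : is_series (fun n => (if Nat.eq_dec n 0 then c - 1 else 0) * (- x) ^ n) (c - 1)).
      { pose proof (psum_finite (fun n => if Nat.eq_dec n 0 then c - 1 else 0) (- x) 0) as HF.
        assert (E : psum (fun n => if Nat.eq_dec n 0 then c - 1 else 0) (- x) 0 = c - 1).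
        { unfold psum. simpl. ring. }
        rewrite E in HF. apply is_pseries_R. apply HF. intros k Hk. destruct (Nat.eq_dec k 0); [lia | reflexivity]. }
      pose proof (is_series_plus _ _ _ _ S1 S2) as S3. revert S3. apply is_series_ext.
      intros [|n].
      - change (- c * (1 * (- x) ^ 0) + (c - 1) * (- x) ^ 0 = - 1 * (- x) ^ 0). ring.
      - change (- c * (q (S n) * (- x) ^ S n) + 0 * (- x) ^ S n =
           ((1 * INR (S n) - 1) * q (S n) - (INR n + b) * q n) * (- x) ^ S n).
        assert (Hq : (c + INR n) * q (S n) = (b + INR n) * q n).
        { unfold q. simpl poch_ratio. field. pose proof (pos_INR n). lra. }
        rewrite S_INR.
        replace ((INR n + b) * q n) with ((c + INR n) * q (S n)) by (rewrite Hq; ring). ring. }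
    assert (E : - x * (1 - - x) * Derive F (- x) - (1 + b * - x) * F (- x) = - c * F (- x) + (c - 1)).
    { rewrite <- (is_pseries_unique _ _ _ HL). exact (is_pseries_unique _ _ _ HLc). }
    lra. }
  set (E := fun x => F (- x) * exp (b * ln (1 + x))).
  set (E' := fun x => - Derive F (- x) * exp (b * ln (1 + x)) + F (- x) * (exp (b * ln (1 + x)) * (b / (1 + x)))).
  assert (HE : forall x, 0 <= x <= s -> is_derive E x (E' x)).
  { intros x Hx. unfold E, E'.
    apply (is_derive_mult (fun x => F (- x)) (fun x => exp (b * ln (1 + x))) x).
    - assert (HD : is_derive F (- x) (Derive F (- x))) by (apply Derive_correct, ex_derive_PSeries, Hrad, Hx).
      pose proof (is_derive_comp F (fun x => - x) x (Derive F (- x)) (-1) HD) as HDc.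
      replace (- Derive F (- x)) with (scal (-1) (Derive F (- x))) by (unfold scal; simpl; unfold mult; simpl; ring).
      apply HDc. auto_derive; [exact I | ring].
    - auto_derive; [lra | unfold Rdiv; ring].
    - intros; apply Rmult_comm. }
  assert (HE'b : forall x, 0 < x <= s -> Rabs (E' x) <= exp Z * Rabs (c - 1) * (CG * (2 * b))).
  { intros x Hx. specialize (HFode x ltac:(lra)).
    assert (E1 : E' x = exp (b * ln (1 + x)) * ((c - 1) * (1 - F (- x)) / (x * (1 + x)))).
    { unfold E'.
      assert (HD : Derive F (- x) = ((b * x + (c - 1)) * F (- x) - (c - 1)) / (x * (1 + x))).
      { rewrite <- HFode. field. lra. }
      rewrite HD. field. lra. }
    assert (Hx1 : 0 < x * (1 + x)) by (apply Rmult_lt_0_compat; lra).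
    assert (H1F : Rabs (1 - F (- x)) <= CG * (2 * (b * x))).
    { assert (Hbx : b * x <= b * s) by (apply Rmult_le_compat_l; lra).
      replace (1 - F (- x)) with (- (F (- x) - 1)) by ring. rewrite Rabs_Ropp.
      assert (HF1 : F (- x) = 1 + - x * PSeries (PS_decr_1 q) (- x)).
      { unfold F. rewrite (PSeries_decr_1 q); [reflexivity|]. apply CV_radius_inside, Hrad. lra. }
      rewrite HF1. replace (1 + - x * PSeries (PS_decr_1 q) (- x) - 1) with (- (x * PSeries (PS_decr_1 q) (- x))) by ring.
      rewrite Rabs_Ropp, Rabs_mult, (Rabs_pos_eq x) by lra.
      replace (CG * (2 * (b * x))) with (x * (CG * (2 * b))) by ring.
      apply Rmult_le_compat_l; [lra|]. apply abs_bounded_PSeries_le. intros L.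
      rewrite Rabs_Ropp, (Rabs_pos_eq x) by lra.
      apply Rmult_le_reg_l with x; [lra|].
      apply Rle_trans with (sum_f_R0 (fun n => q (S n) * x ^ S n) L).
      - right. unfold psum. rewrite <- sum_scal. apply sum_eq. intros k _. unfold PS_decr_1.
        rewrite Rabs_pos_eq by apply Hq0. simpl. ring.
      - replace (x * (CG * (2 * b))) with (CG * (2 * (b * x))) by ring. apply Hsum; lra. }
    rewrite E1. unfold Rdiv. rewrite !Rabs_mult.
    rewrite (Rabs_pos_eq (exp _)) by (left; apply exp_pos).
    rewrite (Rabs_pos_eq (/ (x * (1 + x)))) by (left; apply Rinv_0_lt_compat, Hx1).
    rewrite !Rmult_assoc. apply Rmult_le_compat.
    - left; apply exp_pos.
    - apply Rmult_le_pos; [apply Rabs_pos | apply Rmult_le_pos; [apply Rabs_pos | left; apply Rinv_0_lt_compat, Hx1]].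
    - apply exp_le_mono. apply Rle_trans with (b * x).
      + apply Rmult_le_compat_l; [lra|]. apply ln_1p_bounds. lra.
      + apply Rle_trans with (b * s); [apply Rmult_le_compat_l; lra | exact Hbs].
    - apply Rmult_le_compat_l; [apply Rabs_pos|].
      apply Rmult_le_reg_r with (x * (1 + x)); [exact Hx1|].
      rewrite Rmult_assoc, Rinv_l, Rmult_1_r by lra. apply Rle_trans with (1 := H1F).
      replace (CG * (2 * b) * (x * (1 + x))) with (CG * (2 * (b * x)) * (1 + x)) by ring.
      rewrite <- (Rmult_1_r (CG * (2 * (b * x)))) at 1. apply Rmult_le_compat_l; [|lra].
      apply Rmult_le_pos; [lra|]. apply Rmult_le_pos; [lra|]. apply Rmult_le_pos; lra. }
  destruct (MVT_gen E 0 s E') as [t [Ht HEq]].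
  { intros x Hx. rewrite Rmin_left, Rmax_right in Hx by lra. apply HE. lra. }
  { intros x Hx. rewrite Rmin_left, Rmax_right in Hx by lra. apply continuity_pt_filterlim.
    apply (ex_derive_continuous E x). eexists. apply HE. lra. }
  rewrite Rmin_left, Rmax_right in Ht by lra.
  assert (E0 : E 0 = 1).
  { unfold E, F. rewrite Ropp_0, PSeries_0, Rplus_0_r, ln_1, Rmult_0_r, exp_0. change (q 0%nat) with 1. ring. }
  assert (HE't : Rabs (E' t) <= exp Z * Rabs (c - 1) * (CG * (2 * b))).
  { destruct (Req_dec t 0) as [->|Ht0]; [|apply HE'b; lra].
    assert (HD0 : Derive F (- 0) = b / c).
    { unfold F. rewrite Derive_PSeries by (apply Hrad; lra). rewrite Ropp_0, PSeries_0.
      unfold PS_derive, q. simpl. rewrite !Rplus_0_r. ring. }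
    unfold E'. rewrite HD0, Ropp_0. unfold F. rewrite PSeries_0. change (q 0%nat) with 1.
    rewrite Rplus_0_r, ln_1, Rmult_0_r, exp_0.
    replace (- (b / c) * 1 + 1 * (1 * (b / 1))) with ((c - 1) * (b * / c)) by (field; lra).
    rewrite Rabs_mult, (Rmult_comm (exp Z)), Rmult_assoc. apply Rmult_le_compat_l; [apply Rabs_pos|].
    assert (Hic : 0 < / c <= 2).
    { split; [apply Rinv_0_lt_compat; lra|]. replace 2 with (/ (1 / 2)) by field. apply Rinv_le_contravar; lra. }
    rewrite Rabs_pos_eq by (apply Rmult_le_pos; lra).
    apply Rle_trans with (1 * (CG * (2 * b))).
    - assert (b * / c <= b * 2) by (apply Rmult_le_compat_l; lra).
      assert (1 * (2 * b) <= CG * (2 * b)) by (apply Rmult_le_compat_r; lra). lra.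
    - apply Rmult_le_compat_r; [apply Rmult_le_pos; lra|]. rewrite <- exp_0. apply exp_le_mono. lra. }
  assert (HEs : 1 - CG * 2 * exp Z * Z * Rabs (c - 1) <= Rabs (E s)).
  { apply Rle_trans with (2 := Rle_abs _). rewrite E0, Rminus_0_r in HEq.
    assert (H1 : Rabs (E' t * s) <= exp Z * Rabs (c - 1) * (CG * (2 * b)) * s).
    { rewrite Rabs_mult, (Rabs_pos_eq s) by lra. apply Rmult_le_compat_r; lra. }
    replace (exp Z * Rabs (c - 1) * (CG * (2 * b)) * s) with (CG * 2 * exp Z * Rabs (c - 1) * (b * s)) in H1 by ring.
    assert (H2 : CG * 2 * exp Z * Rabs (c - 1) * (b * s) <= CG * 2 * exp Z * Rabs (c - 1) * Z).
    { apply Rmult_le_compat_l; [|exact Hbs]. apply Rmult_le_pos; [repeat apply Rmult_le_pos; lra | apply Rabs_pos]. }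
    pose proof (Rle_abs (- (E' t * s))) as H3. rewrite Rabs_Ropp in H3. lra. }
  assert (HFE : Rabs (E s) <= exp Z * Rabs (F (- s))).
  { unfold E. rewrite Rabs_mult, (Rabs_pos_eq (exp _)) by (left; apply exp_pos). rewrite Rmult_comm.
    apply Rmult_le_compat_r; [apply Rabs_pos|]. apply exp_le_mono.
    apply Rle_trans with (2 := Hbs). apply Rmult_le_compat_l; [lra|]. apply ln_1p_bounds. lra. }
  assert (HZi : exp (- Z) * exp Z = 1) by (rewrite <- exp_plus, Rplus_opp_l; apply exp_0).
  assert (HZ1 : 0 < exp (- Z) <= 1).
  { split; [apply exp_pos|]. rewrite <- exp_0. apply exp_le_mono. lra. }
  fold F. apply Rmult_le_reg_l with (exp Z); [exact HeZ|].
  apply Rle_trans with (2 := HFE). apply Rle_trans with (2 := HEs).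
  pose proof (Rabs_pos (c - 1)) as Hc1.
  assert (H5 : CG * 2 * exp Z * Z * Rabs (c - 1) <= exp Z * ((1 + 4 * Z * CG + CG * 2 * exp Z * Z + 1) * Rabs (c - 1))).
  { rewrite <- Rmult_assoc. apply Rmult_le_compat_r; [exact Hc1|].
    assert (1 <= exp Z) by (rewrite <- exp_0; apply exp_le_mono; lra).
    apply Rle_trans with (1 * (1 + 4 * Z * CG + CG * 2 * exp Z * Z + 1)); [lra|].
    apply Rmult_le_compat_r; lra. }
  lra.
Qed.

Lemma tail_hypergeometric e W N b c (x : R) :
  0 < e -> (forall n, W (S (N + n)) * (e * (c + INR n)) = (b + INR n) * W (N + n)%nat) ->
  (forall n, 0 < c + INR n) ->
  PSeries (tail N W) x = W N * x ^ N * PSeries (poch_ratio b c) (x / e).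
Proof.
  intros He HW Hc.
  assert (HWq : forall n, W (N + n)%nat = W N * poch_ratio b c n * (/ e) ^ n).
  { induction n; [rewrite Nat.add_0_r; simpl; ring|].
    rewrite Nat.add_succ_r. specialize (HW n). specialize (Hc n).
    apply Rmult_eq_reg_r with (e * (c + INR n)); [|apply Rgt_not_eq, Rmult_lt_0_compat; lra].
    rewrite HW, IHn. simpl poch_ratio. simpl pow. field. lra. }
  transitivity (PSeries (PS_incr_n (fun n => W (N + n)%nat) N) x).
  { apply PSeries_ext. intros n. rewrite PS_incr_n_simplify. unfold tail.
    destruct (le_dec N n), (le_lt_dec N n); try lia; [|reflexivity].
    f_equal. lia. }
  rewrite PSeries_incr_n.
  assert (E : PSeries (fun n => W (N + n)%nat) x = W N * PSeries (poch_ratio b c) (x / e)).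
  { unfold PSeries. rewrite <- Series_scal_l. apply Series_ext. intros n. rewrite HWq.
    unfold Rdiv. rewrite Rpow_mult_distr. ring. }
  rewrite E. ring.
Qed.

(** On the negative side cancellations in [sum_(k >= N) W_k x^k] are harmless:
    if [1/e] is well away from the integers the whole sum is tiny there, and
    otherwise one of the two resonant factors dominates and multiplies a
    hypergeometric function with parameter [c] close to 1. *)
Lemma negative_side c0 A g0 g1 delta2 : 0 < c0 <= 1 -> 1 <= A -> 0 < g0 -> 0 < delta2 ->
  exists C3 e3, 0 < C3 /\ 0 < e3 /\
  forall e a W N s, tame c0 A g0 g1 e a W -> 0 < e < e3 -> (3 <= N)%nat ->
    e * INR N < 1 < e * INR (S N) ->
    W (N - 1)%nat * (4 / 5 * e) ^ (N - 1) <= e ^ 2 -> 0 <= s <= delta2 * e ^ 2 ->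
    PSeries (tail N W) s <= C3 * (Rabs (PSeries (tail N W) (- s)) + e).
Proof.
  intros Hc0 HA Hg0 Hd.
  set (Z := 4 * delta2). assert (HZ : 0 < Z) by (unfold Z; lra).
  destruct (hypergeometric_bounds Z HZ) as [C [HC HH]].
  assert (HeZ : 1 <= exp Z) by (rewrite <- exp_0; apply exp_le_mono; lra).
  assert (HZi : exp (- Z) * exp Z = 1) by (rewrite <- exp_plus, Rplus_opp_l; apply exp_0).
  set (D := 1 + C * (1 + Z)).
  exists ((1 + C) * exp Z * (1 + 8 * delta2 * (1 + D))),
    (Rmin (1 / 16) (Rmin (/ (2 * A)) (/ (8 * delta2)))).
  assert (HD : 0 < D) by (unfold D; assert (0 < C * (1 + Z)) by (apply Rmult_lt_0_compat; lra); lra).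
  assert (HdD : 0 < 8 * delta2 * (1 + D)) by (apply Rmult_lt_0_compat; lra).
  split; [repeat apply Rmult_lt_0_compat; lra|].
  split; [repeat apply Rmin_pos; try apply Rinv_0_lt_compat; lra|].
  intros e a W N s HT He HN3 HN Hlast Hs.
  pose proof (Rmin_l (1 / 16) (Rmin (/ (2 * A)) (/ (8 * delta2)))) as M1.
  pose proof (Rmin_r (1 / 16) (Rmin (/ (2 * A)) (/ (8 * delta2)))) as M2.
  pose proof (Rmin_l (/ (2 * A)) (/ (8 * delta2))) as M3. pose proof (Rmin_r (/ (2 * A)) (/ (8 * delta2))) as M4.
  assert (HeA : e * A <= 1 / 2).
  { apply Rle_trans with (/ (2 * A) * A); [apply Rmult_le_compat_r; lra | right; field; lra]. }
  assert (Hed : delta2 * e <= 1 / 8).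
  { apply Rle_trans with (delta2 * / (8 * delta2)); [apply Rmult_le_compat_l; lra | right; field; lra]. }
  assert (Wn : forall k, 0 <= W k) by exact (W_nonneg _ _ _ _ _ _ _ HT).
  assert (HaA : c0 - 2 <= a <= A) by apply HT.
  assert (HN3' : 3 <= INR N) by (replace 3 with (INR 3) by (simpl; ring); apply le_INR, HN3).
  assert (HS1 : INR (S N) = INR N + 1) by apply S_INR.
  assert (HN' : 1 < e * (INR N + 1)) by (rewrite <- HS1; apply HN).
  set (al := / e - INR N).
  assert (Hal : 0 < al < 1).
  { unfold al. split; apply Rmult_lt_reg_l with e; try lra; rewrite Rmult_minus_distr_l, Rinv_r by lra; lra. }
  assert (Heal : 1 - e * INR N = e * al) by (unfold al; field; lra).
  assert (HRec : forall n, (N <= n)%nat -> (e * INR (S n) - 1) * W (S n) = (INR n + a) * W n).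
  { intros n Hn. destruct HT as (_ & _ & (_ & _ & _ & Wr) & _). rewrite <- (Wr n) by lia.
    rewrite Rabs_left; [ring|]. assert (INR (S N) <= INR (S n)) by (apply le_INR; lia).
    assert (e * INR (S N) <= e * INR (S n)) by (apply Rmult_le_compat_l; lra). lra. }
  assert (Hhyp : forall M, (N <= M)%nat -> forall n,
     W (S (M + n)) * (e * (1 - al + (INR M - INR N) + INR n)) = (INR M + a + INR n) * W (M + n)%nat).
  { intros M HM n. pose proof (HRec (M + n)%nat ltac:(lia)) as HR.
    replace (INR M + a + INR n) with (INR (M + n) + a) by (rewrite plus_INR; ring).
    rewrite <- HR, S_INR, plus_INR. unfold al. field. lra. }
  set (sb := s / e).
  assert (Hsb : 0 <= sb <= delta2 * e).
  { unfold sb. split; [apply Rdiv_le_0_compat; lra|].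
    apply Rmult_le_reg_r with e; [lra|]. unfold Rdiv. rewrite Rmult_assoc, Rinv_l by lra. simpl in Hs. lra. }
  assert (Hs1 : s <= 4 / 5 * e).
  { assert (delta2 * e * e <= 1 / 8 * e) by (apply Rmult_le_compat_r; lra). simpl in Hs. lra. }
  assert (HbZ : forall M, (N <= M <= S N)%nat -> 1 <= INR M + a /\ (INR M + a) * sb <= Z).
  { intros M [HM1 HM2]. apply le_INR in HM1. apply le_INR in HM2. split; [lra|].
    apply Rle_trans with ((INR N + 1 + A) * (delta2 * e)).
    - apply Rmult_le_compat; lra.
    - unfold Z. assert (e * (INR N + 1 + A) <= 2) by lra.
      replace ((INR N + 1 + A) * (delta2 * e)) with (delta2 * (e * (INR N + 1 + A))) by ring.
      apply Rle_trans with (delta2 * 2); [apply Rmult_le_compat_l; lra | lra]. }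
  set (w := W N * s ^ N).
  assert (Hw : 0 <= w) by (apply Rmult_le_pos; [apply Wn | apply pow_le; lra]).
  assert (Htiny : al * w <= 2 * delta2 * e).
  { assert (H1 : (1 - e * INR N) * W N = (INR (N - 1) + a) * W (N - 1)%nat).
    { pose proof (W_rec_low _ _ _ _ _ _ _ HT (N - 1) ltac:(lia)) as HR.
      replace (S (N - 1)) with N in HR by lia. apply HR, HN. }
    assert (HN1 : INR (N - 1) = INR N - 1) by (rewrite minus_INR by lia; simpl; ring).
    assert (E : al * w = (e * (INR (N - 1) + a)) * (W (N - 1)%nat * s ^ (N - 1)) * (sb / e)).
    { replace (al * w) with ((1 - e * INR N) * W N * s ^ N / e) by (rewrite Heal; unfold w; field; lra).
      rewrite H1. replace (s ^ N) with (s * s ^ (N - 1)) by (replace N with (S (N - 1)) at 2 by lia; reflexivity).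
      unfold sb. field. lra. }
    rewrite E.
    assert (Hea : e * a <= e * A) by (apply Rmult_le_compat_l; lra).
    assert (B1 : 0 <= e * (INR (N - 1) + a) <= 2) by (rewrite HN1; split; [apply Rmult_le_pos; lra | lra]).
    assert (B2 : 0 <= W (N - 1)%nat * s ^ (N - 1) <= e ^ 2).
    { split; [apply Rmult_le_pos; [apply Wn | apply pow_le; lra]|].
      apply Rle_trans with (2 := Hlast). apply Rmult_le_compat_l; [apply Wn|]. apply pow_incr. lra. }
    assert (B3 : 0 <= sb / e <= delta2).
    { split; [apply Rdiv_le_0_compat; lra|]. apply Rmult_le_reg_r with e; [lra|].
      unfold Rdiv. rewrite Rmult_assoc, Rinv_l by lra. lra. }
    apply Rle_trans with (2 * e ^ 2 * delta2).
    - apply Rmult_le_compat; try lra; [apply Rmult_le_pos; lra|]. apply Rmult_le_compat; lra.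
    - assert (e ^ 2 <= e) by (simpl; rewrite Rmult_1_r; rewrite <- (Rmult_1_r e) at 3; apply Rmult_le_compat_l; lra).
      replace (2 * e ^ 2 * delta2) with (2 * delta2 * e ^ 2) by ring. apply Rmult_le_compat_l; lra. }
  assert (Hpm : forall n x, Rabs ((- x) ^ n) = Rabs (x ^ n)).
  { intros n x. rewrite <- !RPow_abs, Rabs_Ropp. reflexivity. }
  set (V := Rabs (PSeries (tail N W) (- s))).
  assert (HV0 : 0 <= V) by apply Rabs_pos.
  assert (HsN : 0 <= s ^ N) by (apply pow_le; lra).
  destruct (Rle_lt_dec al (1 / 2)) as [Hal2|Hal2].
  -
    (* the factor 1 / al of W N dominates *)
    destruct (HbZ N ltac:(lia)) as [Hb1 Hb2].
    destruct (HH (INR N + a) (1 - al) sb Hb1 ltac:(lra) ltac:(lra) Hb2) as (_ & HF & HFm).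
    assert (Hcn : forall n, 0 < 1 - al + INR n) by (intros n; pose proof (pos_INR n); lra).
    assert (Hr : forall n, W (S (N + n)) * (e * (1 - al + INR n)) = (INR N + a + INR n) * W (N + n)%nat).
    { intros n. rewrite <- (Hhyp N (le_n _) n). f_equal. f_equal. ring. }
    rewrite (tail_hypergeometric e W N (INR N + a) (1 - al) s ltac:(lra) Hr Hcn). fold w sb.
    assert (HVe : V = w * Rabs (PSeries (poch_ratio (INR N + a) (1 - al)) (- sb))).
    { unfold V. rewrite (tail_hypergeometric e W N (INR N + a) (1 - al) (- s) ltac:(lra) Hr Hcn).
      replace (- s / e) with (- sb) by (unfold sb; field; lra).
      rewrite !Rabs_mult, Hpm, (Rabs_pos_eq (W N)), (Rabs_pos_eq (s ^ N)); auto. }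
    replace (1 - al - 1) with (- al) in HFm by ring. rewrite Rabs_Ropp, (Rabs_pos_eq al) in HFm by lra.
    assert (H1 : w * (exp (- Z) - C * al) <= V) by (rewrite HVe; apply Rmult_le_compat_l; lra).
    assert (H2 : w <= exp Z * (V + C * (2 * delta2 * e))).
    { replace w with (exp Z * (w * exp (- Z))) by (rewrite (Rmult_comm w), <- Rmult_assoc, (Rmult_comm (exp Z)), HZi; ring).
      apply Rmult_le_compat_l; [lra|].
      assert (C * (al * w) <= C * (2 * delta2 * e)) by (apply Rmult_le_compat_l; lra). lra. }
    apply Rle_trans with (w * C); [apply Rmult_le_compat_l; lra|].
    apply Rle_trans with (exp Z * (V + C * (2 * delta2 * e)) * (1 + C)).
    + apply Rmult_le_compat; lra.
    + replace ((1 + C) * exp Z * (1 + 8 * delta2 * (1 + D)) * (V + e)) with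
        (exp Z * ((1 + 8 * delta2 * (1 + D)) * (V + e)) * (1 + C)) by ring.
      apply Rmult_le_compat_r; [lra|]. apply Rmult_le_compat_l; [lra|].
      assert (HCD : C <= D).
      { unfold D. assert (0 <= C * Z) by (apply Rmult_le_pos; lra). lra. }
      assert (Hde : 0 <= delta2 * e) by (apply Rmult_le_pos; lra).
      assert (C * (delta2 * e) <= D * (delta2 * e)) by (apply Rmult_le_compat_r; lra).
      assert (0 <= 8 * delta2 * (1 + D) * V) by (apply Rmult_le_pos; lra).
      assert (0 <= D * (delta2 * e)) by (apply Rmult_le_pos; lra). lra.
  -
    (* the factor 1 / (1 - al) of W (N + 1) dominates *)
    destruct (HbZ (S N) ltac:(lia)) as [Hb1 Hb2]. destruct (HbZ N ltac:(lia)) as [Hb1' Hb2'].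
    destruct (HH (INR (S N) + a) (2 - al) sb Hb1 ltac:(lra) ltac:(lra) Hb2) as (_ & HF & HFm).
    assert (Hcn : forall n, 0 < 2 - al + INR n) by (intros n; pose proof (pos_INR n); lra).
    assert (Hr : forall n, W (S (S N + n)) * (e * (2 - al + INR n)) = (INR (S N) + a + INR n) * W (S N + n)%nat).
    { intros n. rewrite <- (Hhyp (S N) ltac:(lia) n). rewrite HS1. f_equal. f_equal. ring. }
    assert (Hgr : growth e a W) by apply HT.
    assert (Hsplit : forall x, Rabs x <= s -> PSeries (tail N W) x = W N * x ^ N + PSeries (tail (S N) W) x).
    { intros x Hx.
      assert (Hr2 : Rabs x < e) by lra.
      pose proof (PSeries_correct _ _ (CV_radius_inside _ _ (tail_radius e a W (S N) x ltac:(lra) Hgr Hr2))) as P1.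
      pose proof (psum_finite (fun k => if Nat.eq_dec k N then W N else 0) x N) as P2.
      assert (P2' : is_pseries (fun k => if Nat.eq_dec k N then W N else 0) x (W N * x ^ N)).
      { replace (W N * x ^ N) with (psum (fun k => if Nat.eq_dec k N then W N else 0) x N).
        - apply P2. intros k Hk. destruct (Nat.eq_dec k N); [lia | reflexivity].
        - unfold psum. rewrite (sum_eq _ (fun k => if Nat.eq_dec k N then W N * x ^ N else 0)).
          + apply sum_indicator. lia.
          + intros k Hk. destruct (Nat.eq_dec k N) as [->|]; ring. }
      pose proof (is_pseries_plus _ _ _ _ _ P2' P1) as P3.
      apply is_pseries_unique in P3. unfold plus in P3; simpl in P3. rewrite <- P3.
      apply PSeries_ext. intros k. unfold PS_plus, plus, tail; simpl.
      destruct (Nat.eq_dec k N) as [->|].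
      - destruct (le_dec N N), (le_dec (S N) N); try lia. ring.
      - destruct (le_dec N k), (le_dec (S N) k); try lia; ring. }
    set (w1 := W (S N) * s ^ S N).
    assert (HsSN : 0 <= s ^ S N) by (apply pow_le; lra).
    assert (Hw1 : 0 <= w1) by (apply Rmult_le_pos; [apply Wn | exact HsSN]).
    set (be := 1 - al).
    assert (Hw1b : be * w1 <= Z * w).
    { pose proof (Hhyp N (le_n _) 0%nat) as HR. rewrite Nat.add_0_r in HR. simpl (INR 0) in HR.
      replace (1 - al + (INR N - INR N) + 0) with be in HR by (unfold be; ring).
      assert (E : be * w1 = (INR N + a) * sb * w).
      { apply Rmult_eq_reg_r with e; [|lra]. unfold w1, w, sb. simpl pow.
        replace (be * (W (S N) * (s * s ^ N)) * e) with (W (S N) * (e * be) * (s * s ^ N)) by ring.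
        rewrite HR. field. lra. }
      rewrite E. apply Rmult_le_compat_r; assumption. }
    rewrite (Hsplit s) by (rewrite Rabs_pos_eq; lra).
    rewrite (tail_hypergeometric e W (S N) (INR (S N) + a) (2 - al) s ltac:(lra) Hr Hcn). fold w w1 sb.
    assert (HVe : w1 * Rabs (PSeries (poch_ratio (INR (S N) + a) (2 - al)) (- sb)) <= V + w).
    { unfold V. rewrite (Hsplit (- s)) by (rewrite Rabs_Ropp, Rabs_pos_eq; lra).
      rewrite (tail_hypergeometric e W (S N) (INR (S N) + a) (2 - al) (- s) ltac:(lra) Hr Hcn).
      replace (- s / e) with (- sb) by (unfold sb; field; lra).
      set (F := PSeries (poch_ratio (INR (S N) + a) (2 - al)) (- sb)).
      assert (E1 : w1 * Rabs F = Rabs (W (S N) * (- s) ^ S N * F)).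
      { rewrite !Rabs_mult, Hpm, (Rabs_pos_eq (W (S N))), (Rabs_pos_eq (s ^ S N)); auto. }
      assert (E2 : w = Rabs (W N * (- s) ^ N)).
      { rewrite !Rabs_mult, Hpm, (Rabs_pos_eq (W N)), (Rabs_pos_eq (s ^ N)); auto. }
      pose proof (Rabs_triang (W N * (- s) ^ N + W (S N) * (- s) ^ S N * F) (- (W N * (- s) ^ N))) as HTr.
      rewrite Rabs_Ropp, <- E2 in HTr.
      replace (W N * (- s) ^ N + W (S N) * (- s) ^ S N * F + - (W N * (- s) ^ N)) with (W (S N) * (- s) ^ S N * F) in HTr by ring.
      rewrite <- E1 in HTr. exact HTr. }
    replace (2 - al - 1) with be in HFm by (unfold be; ring).
    rewrite (Rabs_pos_eq be) in HFm by (unfold be; lra).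
    assert (Hwe : w <= 4 * delta2 * e).
    { assert (1 / 2 * w <= al * w) by (apply Rmult_le_compat_r; lra). lra. }
    assert (H1 : w1 * (exp (- Z) - C * be) <= V + w).
    { apply Rle_trans with (2 := HVe). apply Rmult_le_compat_l; lra. }
    assert (H2 : w1 <= exp Z * (V + D * w)).
    { replace w1 with (exp Z * (w1 * exp (- Z))) by (rewrite (Rmult_comm w1), <- Rmult_assoc, (Rmult_comm (exp Z)), HZi; ring).
      apply Rmult_le_compat_l; [lra|].
      assert (C * (be * w1) <= C * (Z * w)) by (apply Rmult_le_compat_l; lra).
      assert (0 <= C * w) by (apply Rmult_le_pos; lra).
      unfold D. lra. }
    assert (HDw : 0 <= D * w) by (apply Rmult_le_pos; lra).
    apply Rle_trans with (w + w1 * C).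
    + apply Rplus_le_compat_l. apply Rmult_le_compat_l; lra.
    + apply Rle_trans with (exp Z * (V + (1 + D) * w) * (1 + C)).
      * assert (G1 : w <= exp Z * w) by (rewrite <- (Rmult_1_l w) at 1; apply Rmult_le_compat_r; lra).
        assert (G2 : w1 * C <= exp Z * (V + D * w) * C) by (apply Rmult_le_compat_r; lra).
        assert (G3 : 0 <= exp Z * (V + D * w)) by (apply Rmult_le_pos; lra).
        assert (G4 : 0 <= exp Z * w) by (apply Rmult_le_pos; lra).
        assert (G5 : 0 <= exp Z * w * C) by (apply Rmult_le_pos; lra). lra.
      * replace ((1 + C) * exp Z * (1 + 8 * delta2 * (1 + D)) * (V + e)) with
          (exp Z * ((1 + 8 * delta2 * (1 + D)) * (V + e)) * (1 + C)) by ring.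
        apply Rmult_le_compat_r; [lra|]. apply Rmult_le_compat_l; [lra|].
        assert ((1 + D) * w <= (1 + D) * (4 * delta2 * e)) by (apply Rmult_le_compat_l; lra).
        assert (0 <= (1 + D) * (delta2 * e)) by (apply Rmult_le_pos; [lra | apply Rmult_le_pos; lra]).
        assert (0 <= 8 * delta2 * (1 + D) * V) by (apply Rmult_le_pos; lra). lra.
Qed.

(** * Gamma quotients as growth sequences *)

Fixpoint den (e : R) (k : nat) : R :=
  match k with
  | O => 1
  | S j => den e j * Rabs (1 - e * INR (S j))
  end.

Definition weight (a e : R) (k : nat) : R :=
  match k with
  | O | 1%nat => 0
  | _ => Gamma (INR k + a) / den e k
  end.

Lemma weight_eq a e k : (2 <= k)%nat -> weight a e k = Gamma (INR k + a) / den e k.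
Proof. intros Hk. destruct k as [|[|k]]; [lia | lia | reflexivity]. Qed.

Lemma den_pos e k : (forall n, 1 - e * INR (S n) <> 0) -> 0 < den e k.
Proof.
  intros H. induction k; [simpl; lra|].
  change (0 < den e k * Rabs (1 - e * INR (S k))).
  apply Rmult_lt_0_compat; [exact IHk | apply Rabs_pos_lt, H].
Qed.

Lemma weight_growth a e : -2 < a -> (forall n, 1 - e * INR (S n) <> 0) ->
  growth e a (weight a e).
Proof.
  intros Ha He. split; [reflexivity|]. split; [reflexivity|].
  assert (HG : forall k, (2 <= k)%nat -> 0 < INR k + a).
  { intros k Hk. apply le_INR in Hk. simpl in Hk. lra. }
  split.
  - intros k Hk. rewrite weight_eq by exact Hk.
    apply Rdiv_lt_0_compat; [apply Gamma_pos, HG, Hk | apply den_pos, He].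
  - intros k Hk. rewrite !weight_eq by lia.
    replace (INR (S k) + a) with (INR k + a + 1) by (rewrite S_INR; ring).
    rewrite Gamma_S by (apply HG, Hk).
    change (den e (S k)) with (den e k * Rabs (1 - e * INR (S k))).
    pose proof (den_pos e k He). pose proof (Rabs_pos_lt _ (He k)). field. lra.
Qed.

Lemma Neps_spec e : 0 < e -> (forall n : nat, / e <> INR n) ->
  e * INR (Neps e) < 1 < e * INR (S (Neps e)).
Proof.
  intros He Hn. destruct (base_Int_part (/ e)) as [H1 H2].
  assert (Hi : 0 < / e) by (apply Rinv_0_lt_compat, He).
  assert (Hz : (0 <= Int_part (/ e))%Z).
  { apply le_IZR. apply Rnot_lt_le. intros C.
    assert (C' : (Int_part (/ e) + 1 <= 0)%Z) by (apply lt_IZR in C; lia).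
    apply IZR_le in C'. rewrite plus_IZR in C'. lra. }
  assert (E : INR (Neps e) = IZR (Int_part (/ e))).
  { unfold Neps. rewrite INR_IZR_INZ, Z2Nat.id by exact Hz. reflexivity. }
  assert (Hlt : INR (Neps e) < / e).
  { destruct (Rle_lt_or_eq_dec (INR (Neps e)) (/ e)) as [H|H]; [lra | exact H |].
    exfalso. apply (Hn (Neps e)). symmetry. exact H. }
  rewrite S_INR. split.
  - apply Rmult_lt_reg_l with (/ e); [exact Hi|]. rewrite <- Rmult_assoc, Rinv_l by lra. lra.
  - apply Rmult_lt_reg_l with (/ e); [exact Hi|]. rewrite <- Rmult_assoc, Rinv_l by lra. lra.
Qed.

Lemma den_Gamma e N : 0 < e -> e * INR N < 1 < e * INR (S N) ->
  (forall k, (k <= N)%nat -> den e k = e ^ k * Gamma (/ e) / Gamma (/ e - INR k)) /\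
  (forall j, den e (N + j) = e ^ (N + j) * Gamma (/ e) * Gamma (INR (N + j) + 1 - / e)
     / (Gamma (/ e - INR N) * Gamma (1 - (/ e - INR N)))).
Proof.
  intros He HN.
  assert (Hal : 0 < / e - INR N < 1).
  { rewrite S_INR in HN. split; apply Rmult_lt_reg_l with e; try lra;
      rewrite Rmult_minus_distr_l, Rinv_r by lra; lra. }
  assert (HD1 : forall k, (k <= N)%nat -> den e k = e ^ k * Gamma (/ e) / Gamma (/ e - INR k)).
  { induction k; intros Hk.
    - simpl. rewrite Rminus_0_r. field. apply Rgt_not_eq, Gamma_pos. apply Rinv_0_lt_compat, He.
    - change (den e k * Rabs (1 - e * INR (S k)) = e ^ S k * Gamma (/ e) / Gamma (/ e - INR (S k))).
      rewrite IHk by lia.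
      assert (HkN : INR (S k) <= INR N) by (apply le_INR; lia).
      assert (Hp : 0 < / e - INR (S k)) by lra.
      replace (/ e - INR k) with (/ e - INR (S k) + 1) by (rewrite S_INR; ring).
      rewrite Gamma_S by exact Hp.
      assert (HeN : e * INR (S k) <= e * INR N) by (apply Rmult_le_compat_l; lra).
      rewrite Rabs_pos_eq by lra. pose proof (Gamma_pos _ Hp).
      replace (1 - e * INR (S k)) with (e * (/ e - INR (S k))) by (field; lra).
      simpl pow. field. repeat split; lra. }
  split; [exact HD1|].
  assert (G1 : 0 < Gamma (/ e - INR N)) by (apply Gamma_pos; lra).
  assert (G2 : 0 < Gamma (1 - (/ e - INR N))) by (apply Gamma_pos; lra).
  induction j.
  - rewrite Nat.add_0_r, HD1 by lia.
    replace (INR N + 1 - / e) with (1 - (/ e - INR N)) by ring. field. lra.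
  - rewrite Nat.add_succ_r.
    change (den e (N + j) * Rabs (1 - e * INR (S (N + j))) = e ^ S (N + j) * Gamma (/ e) *
      Gamma (INR (S (N + j)) + 1 - / e) / (Gamma (/ e - INR N) * Gamma (1 - (/ e - INR N)))).
    rewrite IHj.
    assert (HNj : INR (S N) <= INR (S (N + j))) by (apply le_INR; lia).
    assert (HeN : e * INR (S N) <= e * INR (S (N + j))) by (apply Rmult_le_compat_l; lra).
    rewrite Rabs_left by lra.
    assert (Hp : 0 < INR (N + j) + 1 - / e) by (rewrite !S_INR in HNj; lra).
    replace (INR (S (N + j)) + 1 - / e) with (INR (N + j) + 1 - / e + 1) by (rewrite S_INR; ring).
    rewrite Gamma_S by exact Hp.
    replace (- (1 - e * INR (S (N + j)))) with (e * (INR (N + j) + 1 - / e)) by (rewrite S_INR; field; lra).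
    simpl pow. field. lra.
Qed.

(** The normalizing factors of [Vbar] are those of the homogeneous solution:
    by the functional equation, [Gamma (1/e) Gamma (k + 1 - 1/e)] over
    [Gamma alpha Gamma (1 - alpha)] is the product of the [|1/e - j|], j <= k. *)
Lemma Vbar_tail a e x : 0 < e -> (forall n : nat, / e <> INR n) -> (2 <= Neps e)%nat ->
  Vbar a e x = / e * PSeries (tail (Neps e) (weight a e)) (e * x).
Proof.
  intros He Hn HN2. pose proof (Neps_spec e He Hn) as HN.
  set (N := Neps e) in *.
  destruct (den_Gamma e N He HN) as [_ HD].
  assert (Hal : 0 < / e - INR N < 1).
  { rewrite S_INR in HN. split; apply Rmult_lt_reg_l with e; try lra;
      rewrite Rmult_minus_distr_l, Rinv_r by lra; lra. }
  transitivity (/ e * PSeries (PS_incr_n (fun n => weight a e (N + n)) N) (e * x)).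
  2:{ f_equal. apply PSeries_ext. intros n. rewrite PS_incr_n_simplify. unfold tail.
      destruct (le_dec N n), (le_lt_dec N n); try lia; [|reflexivity]. f_equal. lia. }
  rewrite PSeries_incr_n. unfold PSeries. rewrite <- !Series_scal_l.
  unfold Vbar, alpha. fold N. rewrite <- Series_scal_l. apply Series_ext. intros j.
  rewrite weight_eq by lia. rewrite HD.
  assert (G1 : 0 < Gamma (/ e - INR N)) by (apply Gamma_pos; lra).
  assert (G2 : 0 < Gamma (1 - (/ e - INR N))) by (apply Gamma_pos; lra).
  assert (G3 : 0 < Gamma (/ e)) by (apply Gamma_pos, Rinv_0_lt_compat, He).
  assert (G4 : 0 < Gamma (INR (N + j) + 1 - / e)).
  { apply Gamma_pos. assert (INR N <= INR (N + j)) by (apply le_INR; lia). lra. }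
  cbv zeta. rewrite !Rpow_mult_distr, !pow_add.
  assert (0 < e ^ N) by (apply pow_lt, He). assert (0 < e ^ j) by (apply pow_lt, He).
  field. repeat split; lra.
Qed.

(** * Power series solutions of the differential equation *)

Lemma PS_pow_ext m m' l k : (forall i, (i <= k)%nat -> m i = m' i) ->
  PS_pow m l k = PS_pow m' l k.
Proof.
  revert k. induction l; intros k H; [reflexivity|].
  rewrite !PS_pow_S. unfold PS_mult. apply sum_eq. intros i Hi.
  rewrite H by lia. rewrite IHl by (intros; apply H; lia). reflexivity.
Qed.

Lemma PS_g_ext f h mu m m' n : (forall l, h 0%nat l = 0) ->
  (forall i, (i < n)%nat -> m i = m' i) -> PS_g f h mu m n = PS_g f h mu m' n.
Proof.
  intros Hh H. unfold PS_g. f_equal. f_equal. apply sum_eq. intros k Hk.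
  apply sum_eq. intros l Hl. destruct k; [rewrite Hh; ring|].
  f_equal. apply PS_pow_ext. intros i Hi. apply H. lia.
Qed.

Section Solution.

Variables (e a : R) (f : nat -> R) (h : nat -> nat -> R) (mu : R).

(** [approx n] is the solution up to order [n - 1]: the coefficient of order [n]
    of [g (x, m x)] involves lower orders only. *)
Fixpoint approx (n : nat) : nat -> R :=
  match n with
  | O => fun _ => 0
  | S j => fun k =>
      if Nat.eq_dec k j then
        if lt_dec k 2 then 0
        else (PS_g f h mu (approx j) k - (INR (pred k) + a) * approx j (pred k))
             / (1 - e * INR k)
      else approx j k
  end.

Definition solution (k : nat) : R := approx (S k) k.

Lemma approx_solution n k : (k < n)%nat -> approx n k = solution k.
Proof.
  intros H. induction H; [reflexivity|].
  change (approx (S m) k) with (if Nat.eq_dec k m then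
        if lt_dec k 2 then 0
        else (PS_g f h mu (approx m) k - (INR (pred k) + a) * approx m (pred k))
             / (1 - e * INR k)
      else approx m k).
  destruct (Nat.eq_dec k m); [lia | exact IHle].
Qed.

Lemma solution_eq n : (forall l, h 0%nat l = 0) ->
  solution (S (S n)) = (PS_g f h mu solution (S (S n)) - (INR (S n) + a) * solution (S n))
             / (1 - e * INR (S (S n))).
Proof.
  intros Hh. unfold solution at 1.
  change (approx (S (S (S n))) (S (S n))) with (if Nat.eq_dec (S (S n)) (S (S n)) then
        if lt_dec (S (S n)) 2 then 0
        else (PS_g f h mu (approx (S (S n))) (S (S n)) - (INR (S n) + a) * approx (S (S n)) (S n))
             / (1 - e * INR (S (S n)))
      else approx (S (S n)) (S (S n))).
  destruct (Nat.eq_dec (S (S n)) (S (S n))); [|lia]. destruct (lt_dec (S (S n)) 2); [lia|].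
  rewrite (approx_solution (S (S n)) (S n)) by lia.
  rewrite (PS_g_ext f h mu (approx (S (S n))) solution (S (S n)) Hh (fun i Hi => approx_solution _ i Hi)).
  reflexivity.
Qed.

Hypothesis Hh0 : forall l, h 0%nat l = 0.

Lemma solution_recursion : (forall n, 1 - e * INR (S n) <> 0) ->
  recursion e a f h mu solution.
Proof.
  intros He. split; [reflexivity|]. split; [reflexivity|]. intros n.
  rewrite solution_eq by exact Hh0. field. apply He.
Qed.

Lemma recursion_unique m m' : (forall n, 1 - e * INR (S n) <> 0) ->
  recursion e a f h mu m -> recursion e a f h mu m' -> m = m'.
Proof.
  intros He (m0 & m1 & Hm) (m0' & m1' & Hm'). apply functional_extensionality.
  intros k. induction k as [k IH] using lt_wf_ind.
  destruct k as [|[|k]]; [congruence | congruence|].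
  specialize (Hm k). specialize (Hm' k).
  rewrite (PS_g_ext f h mu m m' (S (S k)) Hh0 IH) in Hm. rewrite (IH (S k)) in Hm by lia.
  apply Rmult_eq_reg_l with (1 - e * INR (S (S k))); [lra | apply He].
Qed.

Hypothesis Hf01 : f 0%nat = 0 /\ f 1%nat = 0.
Hypothesis Hh10 : h 1%nat 0%nat = 0.
Hypothesis Hh11 : h 1%nat 1%nat = 0.

Lemma PS_g_01 m : PS_g f h mu m 0 = 0 /\ PS_g f h mu m 1 = 0.
Proof.
  destruct Hf01 as [F0 F1]. unfold PS_g. rewrite F0, F1. split; simpl.
  - rewrite Hh0. ring.
  - rewrite !Hh0, Hh10, Hh11. ring.
Qed.

Lemma recursion_coef m : m 0%nat = 0 -> m 1%nat = 0 ->
  recursion e a f h mu m <-> forall k, Lcoef e a m k = - PS_g f h mu m k.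
Proof.
  intros m0 m1. destruct (PS_g_01 m) as [G0 G1]. split.
  - intros (_ & _ & Hr) [|[|k]].
    + rewrite G0. simpl. rewrite m0. ring.
    + rewrite G1. unfold Lcoef. rewrite m0, m1. ring.
    + rewrite <- Hr. unfold Lcoef. ring.
  - intros H. split; [exact m0|]. split; [exact m1|]. intros n.
    specialize (H (S (S n))). unfold Lcoef in H. lra.
Qed.

Lemma formal_recursion m : e = 0 ->
  formal_center_manifold a f h mu m <-> recursion e a f h mu m.
Proof.
  intros He. unfold formal_center_manifold, recursion.
  split; intros (m0 & m1 & Hr); split; auto; split; auto.
  - intros n. rewrite <- Hr, He. change (PS_incr_n (PS_derive m) 2 (S (S n))) with (INR (S n) * m (S n)).
    change (PS_incr_1 m (S (S n))) with (m (S n)). ring.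
  - destruct (PS_g_01 m) as [G0 G1]. intros [|[|n]].
    + rewrite G0. change (0 + (m 0%nat + a * 0) = 0). rewrite m0. ring.
    + rewrite G1. change (0 + (m 1%nat + a * m 0%nat) = 0). rewrite m0, m1. ring.
    + rewrite <- Hr, He. change (PS_incr_n (PS_derive m) 2 (S (S n))) with (INR (S n) * m (S n)).
      change (PS_incr_1 m (S (S n))) with (m (S n)). ring.
Qed.

Variables tau B : R.
Hypothesis Htau : 0 < tau.
Hypothesis Hf : forall k, Rabs (f k) <= B * tau ^ k.
Hypothesis Hh : forall k l, Rabs (h k l) <= tau ^ (k + l).

(** Inside the disk of convergence, the recursion is the differential equation
    read off coefficient by coefficient. *)
Lemma recursion_ode m x M : recursion e a f h mu m ->
  Rbar_lt (Rabs x) (CV_radius m) ->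
  abs_bounded m (Rabs x) M -> tau * Rabs x <= 1 / 2 -> tau * M <= 1 / 2 ->
  x * (x - e) * Derive (PSeries m) x + (1 + a * x) * PSeries m x = g f h mu x (PSeries m x).
Proof.
  intros Hr Hx Hm HtX HtM.
  pose proof (L_pseries e a m x Hx) as HL.
  pose proof (is_pseries_PS_g f h mu tau B m Htau Hf Hh (proj1 Hr) x M Hm HtX HtM) as HG.
  assert (E : PSeries (Lcoef e a m) x = - g f h mu x (PSeries m x)).
  { rewrite <- (is_pseries_unique _ _ _ HG), <- PSeries_opp. apply PSeries_ext. intros k.
    apply (recursion_coef m (proj1 Hr) (proj1 (proj2 Hr))), Hr. }
  rewrite (is_pseries_unique _ _ _ HL) in E. lra.
Qed.

Lemma ex_pseries_radius b x : ex_pseries b x -> Rbar_le (Rabs x) (CV_radius b).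
Proof.
  intros H. destruct (Rbar_le_lt_dec (Rabs x) (CV_radius b)) as [L|L]; [exact L|].
  exfalso. apply (CV_disk_outside b x L). apply ex_series_lim_0.
  apply ex_pseries_R. exact H.
Qed.

(** Both sides of the invariance equation are power series near 0, hence have
    the same coefficients. *)
Lemma weak_stable_recursion m : weak_stable_manifold a f h mu e m ->
  recursion e a f h mu m.
Proof.
  intros (m0 & m1 & Hrad & [d Hd]). apply recursion_coef; auto. intros n.
  (* on a small disk the majorant of m is small, because m has no constant term *)
  assert (HX : exists X0 M, 0 < X0 /\ Rbar_lt X0 (CV_radius m) /\ 0 <= M /\ abs_bounded m X0 M).
  { assert (Hx : exists X0, 0 < X0 /\ Rbar_lt X0 (CV_radius m)).
    { destruct (CV_radius m) as [R0| |]; simpl in Hrad |- *.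
      - exists (R0 / 2). simpl. lra.
      - exists 1. simpl. split; [lra | exact I].
      - contradiction. }
    destruct Hx as [X0 [HX0 HXr]]. exists X0.
    assert (HX1 : Rbar_lt (Rabs X0) (CV_radius m)) by (rewrite Rabs_pos_eq by lra; exact HXr).
    pose proof (CV_disk_inside m X0 HX1) as He.
    exists (Series (fun n => Rabs (m n * X0 ^ n))). split; [exact HX0|]. split; [exact HXr|].
    assert (HB : forall L, psum (fun k => Rabs (m k)) X0 L <= Series (fun n => Rabs (m n * X0 ^ n))).
    { intros L. apply Rle_trans with (2 := series_tail _ L (fun k => Rabs_pos _) He).
      right. apply sum_eq. intros. rewrite Rabs_mult, (Rabs_pos_eq (X0 ^ _)); [reflexivity | apply pow_le; lra]. }
    split; [|exact HB]. apply Rle_trans with (2 := HB 0%nat). apply psum_nonneg; [lra|]. intros; apply Rabs_pos. }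
  destruct HX as (X0 & M & HX0 & HXr & HM0 & HM).
  set (x1 := Rmin (Rmin (d / 2) (X0 / 2)) (Rmin (/ (2 * tau)) (X0 / (2 * tau * (M + 1))))).
  assert (HtM : 0 < 2 * tau * (M + 1)) by (apply Rmult_lt_0_compat; lra).
  assert (Hx1 : 0 < x1).
  { pose proof (cond_pos d). unfold x1. repeat apply Rmin_pos; try lra.
    - apply Rinv_0_lt_compat; lra.
    - apply Rdiv_lt_0_compat; assumption. }
  assert (Q1 : x1 <= Rmin (d / 2) (X0 / 2)) by apply Rmin_l.
  assert (Q2 : x1 <= Rmin (/ (2 * tau)) (X0 / (2 * tau * (M + 1)))) by apply Rmin_r.
  pose proof (Rmin_l (d / 2) (X0 / 2)). pose proof (Rmin_r (d / 2) (X0 / 2)).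
  pose proof (Rmin_l (/ (2 * tau)) (X0 / (2 * tau * (M + 1)))).
  pose proof (Rmin_r (/ (2 * tau)) (X0 / (2 * tau * (M + 1)))).
  assert (Hid : forall x, Rabs x <= x1 ->
     is_pseries (Lcoef e a m) x (- g f h mu x (PSeries m x)) /\
     is_pseries (PS_g f h mu m) x (g f h mu x (PSeries m x))).
  { intros x Hx. pose proof (Rabs_pos x) as Hx0.
    assert (Hxr : Rbar_lt (Rabs x) (CV_radius m)).
    { apply Rbar_le_lt_trans with (2 := HXr). simpl. pose proof (cond_pos d). lra. }
    assert (Hab : abs_bounded m (Rabs x) (Rabs x / X0 * M)).
    { intros L. apply Rle_trans with (psum (above 0 (fun k => Rabs (m k))) (Rabs x) L).
      - right. apply sum_eq. intros k _. unfold above. destruct (lt_dec 0 k); [reflexivity|].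
        replace k with 0%nat by lia. rewrite m0, Rabs_R0. reflexivity.
      - apply Rle_trans with (1 := above_psum 0 (fun k => Rabs (m k)) (Rabs x) X0 L ltac:(pose proof (cond_pos d); lra) HX0 (fun k => Rabs_pos _)).
        rewrite !pow_1. apply Rmult_le_compat_l; [apply Rdiv_le_0_compat; lra | apply HM]. }
    assert (HtX : tau * Rabs x <= 1 / 2).
    { apply Rle_trans with (tau * / (2 * tau)); [apply Rmult_le_compat_l; lra | right; field; lra]. }
    assert (HtMx : tau * (Rabs x / X0 * M) <= 1 / 2).
    { apply Rle_trans with (tau * (X0 / (2 * tau * (M + 1)) / X0 * M)).
      - apply Rmult_le_compat_l; [lra|]. apply Rmult_le_compat_r; [exact HM0|].
        apply Rmult_le_compat_r; [left; apply Rinv_0_lt_compat, HX0 | lra].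
      - apply Rmult_le_reg_r with (2 * (M + 1)); [lra|].
        replace (tau * (X0 / (2 * tau * (M + 1)) / X0 * M) * (2 * (M + 1))) with M by (field; lra). lra. }
    split; [|apply (is_pseries_PS_g f h mu tau B m Htau Hf Hh m0 x _ Hab HtX HtMx)].
    pose proof (L_pseries e a m x Hxr) as HL.
    assert (Hb : ball 0 d x).
    { apply <- ball_0. pose proof (cond_pos d). lra. }
    specialize (Hd x Hb). cbv beta in Hd.
    replace (- g f h mu x (PSeries m x)) with (x * (e - x) * Derive (PSeries m) x - (1 + a * x) * PSeries m x);
      [exact HL|]. lra. }
  assert (Hr1 : Rbar_lt 0 (CV_radius (Lcoef e a m))).
  { apply Rbar_lt_le_trans with (Finite (Rabs x1)); [simpl; rewrite Rabs_pos_eq; lra|].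
    apply ex_pseries_radius. eexists. apply Hid. rewrite Rabs_pos_eq; lra. }
  assert (Hr2 : Rbar_lt 0 (CV_radius (PS_opp (PS_g f h mu m)))).
  { rewrite CV_radius_opp. apply Rbar_lt_le_trans with (Finite (Rabs x1)); [simpl; rewrite Rabs_pos_eq; lra|].
    apply ex_pseries_radius. eexists. apply Hid. rewrite Rabs_pos_eq; lra. }
  change (- PS_g f h mu m n) with (PS_opp (PS_g f h mu m) n).
  apply PSeries_ext_recip; auto.
  exists (mkposreal x1 Hx1). intros x Hx. rewrite PSeries_opp.
  apply -> ball_0 in Hx. simpl in Hx.
  destruct (Hid x) as [I1 I2]; [lra|].
  rewrite (is_pseries_unique _ _ _ I1), (is_pseries_unique _ _ _ I2). reflexivity.
Qed.

End Solution.

(** * The limit of vanishing epsilon *)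

Section Limits.

Variable F : (R -> Prop) -> Prop.
Context {FF : Filter F}.

Lemma lim_mult (u v : R -> R) lu lv :
  filterlim u F (locally lu) -> filterlim v F (locally lv) ->
  filterlim (fun e => u e * v e) F (locally (lu * lv)).
Proof. intros Hu Hv. exact (filterlim_comp_2 u v Rmult Hu Hv (filterlim_mult lu lv)). Qed.

Lemma lim_plus (u v : R -> R) lu lv :
  filterlim u F (locally lu) -> filterlim v F (locally lv) ->
  filterlim (fun e => u e + v e) F (locally (lu + lv)).
Proof. intros Hu Hv. exact (filterlim_comp_2 u v Rplus Hu Hv (filterlim_plus lu lv)). Qed.

Lemma lim_const (c : R) : filterlim (fun _ : R => c) F (locally c).
Proof. apply filterlim_const. Qed.

Lemma lim_opp (u : R -> R) lu :
  filterlim u F (locally lu) -> filterlim (fun e => - u e) F (locally (- lu)).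
Proof.
  intros Hu. apply (filterlim_ext (fun e => -1 * u e)); [intros; ring|].
  replace (- lu) with (-1 * lu) by ring. apply lim_mult; [apply lim_const | exact Hu].
Qed.

Lemma lim_comp (phi : R -> R) (u : R -> R) lu :
  continuous phi lu -> filterlim u F (locally lu) ->
  filterlim (fun e => phi (u e)) F (locally (phi lu)).
Proof. intros Hp Hu. exact (filterlim_comp _ _ _ u phi F (locally lu) (locally (phi lu)) Hu Hp). Qed.

Lemma lim_div (u v : R -> R) lu lv : lv <> 0 ->
  filterlim u F (locally lu) -> filterlim v F (locally lv) ->
  filterlim (fun e => u e / v e) F (locally (lu / lv)).
Proof.
  intros H Hu Hv. apply lim_mult; [exact Hu|].
  apply (lim_comp Rinv v lv); [apply continuous_Rinv, H | exact Hv].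
Qed.

Lemma lim_sum (u : R -> nat -> R) (u0 : nat -> R) n :
  (forall k, (k <= n)%nat -> filterlim (fun e => u e k) F (locally (u0 k))) ->
  filterlim (fun e => sum_f_R0 (u e) n) F (locally (sum_f_R0 u0 n)).
Proof.
  intros H. induction n; simpl.
  - apply H. lia.
  - apply lim_plus; [apply IHn; intros; apply H; lia | apply H; lia].
Qed.

Lemma lim_PS_pow (m : R -> nat -> R) (m0 : nat -> R) l k :
  (forall i, (i <= k)%nat -> filterlim (fun e => m e i) F (locally (m0 i))) ->
  filterlim (fun e => PS_pow (m e) l k) F (locally (PS_pow m0 l k)).
Proof.
  revert k. induction l; intros k H; [apply lim_const|].
  apply (lim_sum (fun e i => m e i * PS_pow (m e) l (k - i)) (fun i => m0 i * PS_pow m0 l (k - i))).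
  intros i Hi. apply lim_mult; [apply H, Hi|]. apply IHl. intros; apply H; lia.
Qed.

Variables (a : R -> R) (f : R -> nat -> R) (h : R -> nat -> nat -> R) (mu : R).
Hypothesis Ha : filterlim a F (locally (a 0)).
Hypothesis Hf : forall k, filterlim (fun e => f e k) F (locally (f 0 k)).
Hypothesis Hh : forall k l, filterlim (fun e => h e k l) F (locally (h 0 k l)).
Hypothesis Hid : filterlim (fun e => e) F (locally 0).
Hypothesis H0 : forall l, h 0 0%nat l = 0.
Hypothesis H0F : F (fun e => forall l, h e 0%nat l = 0).

Let sol e := solution e (a e) (f e) (h e) mu.

Lemma lim_PS_g n : (forall i, (i < n)%nat -> filterlim (fun e => sol e i) F (locally (sol 0 i))) ->
  filterlim (fun e => PS_g (f e) (h e) mu (sol e) n) F (locally (PS_g (f 0) (h 0) mu (sol 0) n)).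
Proof.
  intros H. unfold PS_g. apply lim_plus; [apply Hf|]. apply lim_mult; [apply lim_const|].
  apply (lim_sum (fun e k => sum_f_R0 (fun l => h e k l * PS_pow (sol e) l (n - k)) n)
                 (fun k => sum_f_R0 (fun l => h 0 k l * PS_pow (sol 0) l (n - k)) n)).
  intros k Hk. destruct k as [|k].
  - apply (filterlim_ext_loc (fun _ => 0)).
    + revert H0F. apply filter_imp. intros e He. symmetry. apply sum_zero. intros l _. rewrite He. ring.
    + replace (sum_f_R0 (fun l => h 0 0%nat l * PS_pow (sol 0) l (n - 0)) n) with 0.
      * apply lim_const.
      * symmetry. apply sum_zero. intros l _. rewrite H0. ring.
  - apply (lim_sum (fun e l => h e (S k) l * PS_pow (sol e) l (n - S k))
                   (fun l => h 0 (S k) l * PS_pow (sol 0) l (n - S k))).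
    intros l Hl. apply lim_mult; [apply Hh|]. apply lim_PS_pow. intros i Hi. apply H. lia.
Qed.

Lemma lim_solution k : filterlim (fun e => sol e k) F (locally (sol 0 k)).
Proof.
  induction k as [k IH] using lt_wf_ind. destruct k as [|[|k]]; [apply lim_const | apply lim_const |].
  unfold sol at 2. rewrite solution_eq by exact H0. fold (sol 0).
  apply (filterlim_ext_loc (fun e =>
    (PS_g (f e) (h e) mu (sol e) (S (S k)) - (INR (S k) + a e) * sol e (S k)) / (1 - e * INR (S (S k))))).
  { revert H0F. apply filter_imp. intros e He. unfold sol at 3. rewrite solution_eq by exact He. reflexivity. }
  apply lim_div; [lra | |].
  - apply lim_plus; [apply lim_PS_g, IH|]. apply lim_opp. apply lim_mult; [|apply IH; lia].
    apply lim_plus; [apply lim_const | exact Ha].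
  - apply lim_plus; [apply lim_const|]. apply lim_opp. apply lim_mult; [exact Hid | apply lim_const].
Qed.

Lemma lim_den k : filterlim (fun e => den e k) F (locally (den 0 k)).
Proof.
  induction k; [apply lim_const|]. apply lim_mult; [exact IHk|].
  apply (lim_comp Rabs (fun e => 1 - e * INR (S k)) (1 - 0 * INR (S k))).
  - apply continuity_pt_filterlim, Rcontinuity_abs.
  - apply lim_plus; [apply lim_const|]. apply lim_opp. apply lim_mult; [exact Hid | apply lim_const].
Qed.

Lemma den_0 k : den 0 k = 1.
Proof.
  induction k; [reflexivity|]. change (den 0 k * Rabs (1 - 0 * INR (S k)) = 1).
  rewrite IHk, Rmult_0_l, Rminus_0_r, Rabs_R1. ring.
Qed.

Hypothesis Ha2 : -2 < a 0.

Lemma lim_weight k : filterlim (fun e => weight (a e) e k) F (locally (weight (a 0) 0 k)).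
Proof.
  destruct k as [|[|k]]; [apply lim_const | apply lim_const|].
  assert (Hk : 0 < INR (S (S k)) + a 0) by (rewrite !S_INR; pose proof (pos_INR k); lra).
  apply lim_div.
  - rewrite den_0. lra.
  - apply (lim_comp Gamma (fun e => INR (S (S k)) + a e)); [apply Gamma_continuous, Hk|].
    apply lim_plus; [apply lim_const | exact Ha].
  - apply lim_den.
Qed.

(** Fixed orders converge because they are polynomials in the data and Gamma
    is continuous. *)
Lemma lim_increment k :
  filterlim (fun e => increment e (f e) (h e) mu (weight (a e) e) (sol e) k) F
    (locally (increment 0 (f 0) (h 0) mu (weight (a 0) 0) (sol 0) k)).
Proof.
  destruct k as [|[|k]]; [apply lim_const | apply lim_const|].
  assert (Hk : 0 < INR (S (S k)) + a 0) by (rewrite !S_INR; pose proof (pos_INR k); lra).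
  apply lim_div.
  - rewrite Rmult_0_l, Rminus_0_r, Rmult_1_l, weight_eq, den_0 by lia. unfold Rdiv.
    rewrite Rinv_1, Rmult_1_r. apply Rgt_not_eq, Gamma_pos, Hk.
  - apply lim_mult; [apply lim_const|]. apply lim_PS_g. intros i _. apply lim_solution.
  - apply lim_mult; [|apply lim_weight].
    apply lim_plus; [apply lim_const|]. apply lim_opp. apply lim_mult; [exact Hid | apply lim_const].
Qed.

End Limits.

(** Analyticity in [e] enters only through continuity at 0 from the right. *)
Lemma analytic_family_lim {I : Type} (deg : I -> nat) eps0 (Fm : R -> I -> R) i :
  0 < eps0 -> analytic_family deg eps0 Fm ->
  filterlim (fun e => Fm e i) (at_right 0) (locally (Fm 0 i)).
Proof.
  intros He H. destruct (H 0) as (r & C & c & Hr & Hc & Hs); [lra|].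
  assert (Hrd : 0 < r ^ deg i) by (apply pow_lt, Hr).
  assert (HR : Rbar_le r (CV_radius (c i))).
  { destruct (CV_radius_bounded (c i)) as [U _]. apply U. exists (C / r ^ deg i). intros n.
    rewrite Rabs_mult, (Rabs_pos_eq (r ^ n)) by (apply pow_le; lra).
    apply Rmult_le_reg_r with (r ^ deg i); [exact Hrd|].
    unfold Rdiv. rewrite (Rmult_assoc C), Rinv_l, Rmult_1_r by lra.
    apply Rle_trans with (2 := Hc i n). rewrite pow_add. right. ring. }
  assert (Hcont : continuous (PSeries (c i)) 0).
  { apply continuity_pt_filterlim, PSeries_continuity.
    apply Rbar_lt_le_trans with (2 := HR). simpl. rewrite Rabs_R0. exact Hr. }
  assert (E : forall e, 0 <= e < eps0 -> Rabs e < r -> PSeries (c i) e = Fm e i).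
  { intros e He1 He2. apply is_pseries_unique. rewrite <- (Rminus_0_r e) at 1.
    apply Hs; [exact He1 | rewrite Rminus_0_r; exact He2]. }
  rewrite <- (E 0) by (rewrite ?Rabs_R0; lra).
  apply (filterlim_ext_loc (PSeries (c i))).
  - assert (Hm : 0 < Rmin eps0 r) by (apply Rmin_pos; lra).
    exists (mkposreal _ Hm). intros e Hb He0.
    apply -> ball_0 in Hb. simpl in Hb. pose proof (Rmin_l eps0 r). pose proof (Rmin_r eps0 r).
    apply E; [|lra]. rewrite Rabs_pos_eq in Hb; lra.
  - apply filterlim_filter_le_1 with (2 := Hcont). apply filter_le_within.
Qed.

(** * The theorem *)

Definition nonresonant (e : R) : Prop := forall n : nat, / e <> INR n.

(** The limit [e -> 0] through the values for which the weak-stable manifold is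
    defined. *)
Definition small_nonresonant : (R -> Prop) -> Prop := within nonresonant (at_right 0).

Lemma small_nonresonant_filter : Filter small_nonresonant.
Proof. apply within_filter. apply within_filter. apply locally_filter. Qed.

Lemma small_nonresonant_intro (P : R -> Prop) d : 0 < d ->
  (forall e, 0 < e < d -> nonresonant e -> P e) -> small_nonresonant P.
Proof.
  intros Hd H. exists (mkposreal d Hd). intros e Hb He Hn.
  apply -> ball_0 in Hb. simpl in Hb. rewrite Rabs_pos_eq in Hb by lra. apply H; [lra | exact Hn].
Qed.

Lemma small_nonresonant_elim (P : R -> Prop) : small_nonresonant P ->
  exists d, 0 < d /\ forall e, 0 < e < d -> nonresonant e -> P e.
Proof.
  intros [d Hd]. exists d. split; [apply cond_pos|]. intros e He Hn.
  apply Hd; [|lra | exact Hn].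
  apply <- ball_0. rewrite Rabs_pos_eq by lra. lra.
Qed.

Lemma nonresonant_neq e : 0 < e -> nonresonant e -> forall n, 1 - e * INR (S n) <> 0.
Proof.
  intros He Hn n H. apply (Hn (S n)). apply Rmult_eq_reg_l with e; [|lra].
  rewrite Rinv_r; lra.
Qed.

Lemma filterlim_between (F : (R -> Prop) -> Prop) {FF : Filter F} (u : R -> R) l lo hi :
  filterlim u F (locally l) -> lo < l < hi -> F (fun e => lo < u e < hi).
Proof.
  intros H Hl. assert (Hd : 0 < Rmin (l - lo) (hi - l)) by (apply Rmin_pos; lra).
  generalize (proj1 (filterlim_locally u l) H (mkposreal _ Hd)). apply filter_imp.
  intros e Hb. unfold ball in Hb; simpl in Hb. unfold AbsRing_ball, abs, minus, plus, opp in Hb; simpl in Hb.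
  apply Rabs_def2 in Hb. pose proof (Rmin_l (l - lo) (hi - l)). pose proof (Rmin_r (l - lo) (hi - l)). lra.
Qed.

Lemma filterlim_Neps : filterlim Neps small_nonresonant eventually.
Proof.
  intros P [n0 H0]. unfold filtermap.
  assert (Hn : 0 < INR (S n0)) by (apply lt_0_INR; lia).
  apply (small_nonresonant_intro _ (/ INR (S n0))); [apply Rinv_0_lt_compat, Hn|].
  intros e He Hr. apply H0. destruct (Neps_spec e (proj1 He) Hr) as [_ H1].
  assert (H2 : e * INR (S n0) < 1).
  { apply Rlt_le_trans with (/ INR (S n0) * INR (S n0)); [apply Rmult_lt_compat_r; lra | right; field; lra]. }
  assert (H3 : INR (S n0) < INR (S (Neps e))) by (apply Rmult_lt_reg_l with e; lra).
  apply INR_lt in H3. lia.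
Qed.

(** A radius slightly beyond a set of points on which the sum of the tail is
    bounded; continuity of the sum costs a factor 2. *)
Lemma radius_beyond e a W N K1 (T : R -> Prop) :
  0 < e -> growth e a W -> (1 <= N)%nat -> 0 < K1 ->
  (forall t, T t -> 0 <= t <= 3 / 4 * e /\ PSeries (tail N W) t <= e * K1) ->
  exists r, 0 < r <= 4 / 5 * e /\ (forall t, T t -> t < r) /\
    forall L, psum (tail N W) r L <= e * (2 * K1).
Proof.
  intros He HW HN HK HT.
  set (A := PSeries (tail N W)).
  assert (HeK : 0 < e * K1) by (apply Rmult_lt_0_compat; assumption).
  assert (Wn : forall k, 0 <= W k) by (intros k; apply (growth_nonneg e a W k HW)).
  assert (A0 : A 0 = 0).
  { unfold A. rewrite PSeries_0. unfold tail. destruct (le_dec N 0); [lia | reflexivity]. }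
  set (T' := fun t => T t \/ t = 0).
  assert (HT' : forall t, T' t -> 0 <= t <= 3 / 4 * e /\ A t <= e * K1).
  { intros t [Ht| ->]; [apply HT, Ht|]. rewrite A0. lra. }
  destruct (completeness T') as [r0 [Hub Hlub]].
  { exists (3 / 4 * e). intros t Ht. apply HT', Ht. }
  { exists 0. right. reflexivity. }
  assert (Hr0 : 0 <= r0 <= 3 / 4 * e).
  { split; [apply Hub; right; reflexivity|]. apply Hlub. intros t Ht. apply HT', Ht. }
  assert (Hc : continuity_pt A r0).
  { apply PSeries_continuity, (tail_radius e a W N r0 He HW). rewrite Rabs_pos_eq; lra. }
  destruct (Hc (e * K1 / 2)) as [dl [Hdl Hcont]]; [lra|].
  assert (Hcl : forall t, Rabs (t - r0) < dl -> Rabs (A t - A r0) < e * K1 / 2).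
  { intros t Ht. destruct (Req_dec t r0) as [->|Hne].
    - rewrite Rminus_diag, Rabs_R0. lra.
    - apply Hcont. split; [split; [exact I | congruence] | exact Ht]. }
  assert (Hnear : exists t, T' t /\ r0 - dl < t).
  { apply Classical_Prop.NNPP. intros C. assert (r0 <= r0 - dl); [|lra].
    apply Hlub. intros t Ht. apply Rnot_lt_le. intros Hlt. apply C. exists t. split; assumption. }
  destruct Hnear as [t [Ht Htn]].
  assert (HAr0 : A r0 <= 3 / 2 * (e * K1)).
  { assert (t <= r0) by (apply Hub, Ht).
    assert (H1 : Rabs (A t - A r0) < e * K1 / 2) by (apply Hcl; apply Rabs_def1; lra).
    apply Rabs_def2 in H1. destruct (HT' t Ht) as [_ H2]. lra. }
  assert (Hmin : 0 < Rmin (dl / 2) (e / 20)) by (apply Rmin_pos; lra).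
  pose proof (Rmin_l (dl / 2) (e / 20)). pose proof (Rmin_r (dl / 2) (e / 20)).
  exists (r0 + Rmin (dl / 2) (e / 20)). split; [lra|]. split.
  - intros t' Ht'. assert (t' <= r0) by (apply Hub; left; exact Ht'). lra.
  - set (r := r0 + Rmin (dl / 2) (e / 20)).
    assert (Hr : 0 < r < e) by (unfold r; lra).
    assert (HAr : A r <= 2 * (e * K1)).
    { assert (H1 : Rabs (A r - A r0) < e * K1 / 2) by (apply Hcl; unfold r; apply Rabs_def1; lra).
      apply Rabs_def2 in H1. lra. }
    intros L. apply Rle_trans with (A r); [|lra].
    destruct (tail_abs_bounded e a W N r He HW ltac:(lra)) as [M HM].
    apply (nonneg_series_bounds (fun k => tail N W k * r ^ k) M L).
    + intros k. apply Rmult_le_pos; [apply (tail_bounds N W k Wn) | apply pow_le; lra].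
    + intros n. apply Rle_trans with (2 := HM n). right. apply sum_eq. intros k _.
      rewrite Rabs_pos_eq; [reflexivity | apply (tail_bounds N W k Wn)].
Qed.

(** The Taylor series of the manifold provides the extension, and it is the
    weak-stable manifold. *)
Lemma scaled_solution_extends rho a f h mu e m r M (I : R -> Prop) tau B :
  0 < rho -> tau = / rho -> 0 < e ->
  (forall l, h 0%nat l = 0) -> f 0%nat = 0 /\ f 1%nat = 0 -> h 1%nat 0%nat = 0 -> h 1%nat 1%nat = 0 ->
  (forall k, Rabs (f k) <= B * tau ^ k) -> (forall k l, Rabs (h k l) <= tau ^ (k + l)) ->
  recursion e a f h mu m -> 0 < r <= e -> abs_bounded m r M ->
  tau * e <= 1 / 4 -> tau * M <= 1 / 4 ->
  (forall x, I x -> Rabs (e * x) < r) ->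
  extends_over rho a f h mu e m I (fun x => / e * PSeries m (e * x)) /\
  weak_stable_manifold a f h mu e m.
Proof.
  intros Hrho -> He Hh0 Hf01 Hh10 Hh11 Hf Hh Hrec Hr HM Hte HtM HI.
  set (tau := / rho) in *.
  assert (Htau : 0 < tau) by (apply Rinv_0_lt_compat, Hrho).
  assert (Hrt : rho * tau = 1) by (unfold tau; field; lra).
  assert (Hsmall : forall z, tau * z <= 1 / 4 -> z < rho).
  { intros z Hz. apply Rmult_lt_reg_l with tau; [exact Htau|]. lra. }
  assert (Hode : forall X, Rabs X < r ->
     Rbar_lt (Rabs X) (CV_radius m) /\ Rabs (PSeries m X) < rho /\
     X * (X - e) * Derive (PSeries m) X + (1 + a * X) * PSeries m X = g f h mu X (PSeries m X)).
  { intros X HX. pose proof (Rabs_pos X).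
    assert (Hrad : Rbar_lt (Rabs X) (CV_radius m)).
    { apply Rbar_lt_le_trans with (Finite r); [exact HX|]. apply abs_bounded_radius with M; [lra | exact HM]. }
    assert (HMX : abs_bounded m (Rabs X) M).
    { intros L. apply Rle_trans with (2 := HM L). apply psum_mono_X; [lra|]. intros; apply Rabs_pos. }
    split; [exact Hrad|]. split.
    - apply Rle_lt_trans with M; [apply abs_bounded_PSeries_le, HMX | apply Hsmall, HtM].
    - assert (HtX : tau * Rabs X <= tau * e) by (apply Rmult_le_compat_l; lra).
      apply (recursion_ode e a f h mu Hh0 Hf01 Hh10 Hh11 tau B Htau Hf Hh m X M Hrec Hrad HMX); lra. }
  split.
  - exists (- (r / e)), (r / e).
    assert (Hre : 0 < r / e) by (apply Rdiv_lt_0_compat; lra).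
    split; [lra|].
    assert (Habs : forall x, Rabs (e * x) < r <-> - (r / e) < x < r / e).
    { intros x. assert (Heq : e * (r / e) = r) by (field; lra). split.
      - intros H. apply Rabs_def2 in H. split; apply Rmult_lt_reg_l with e; lra.
      - intros [H1 H2]. apply (Rmult_lt_compat_l e) in H1; [|lra]. apply (Rmult_lt_compat_l e) in H2; [|lra].
        apply Rabs_def1; lra. }
    split; [intros x Hx; apply Habs, HI, Hx|].
    split; [exists (mkposreal 1 Rlt_0_1); intros; reflexivity|].
    intros x Hx. apply Habs in Hx. destruct (Hode (e * x) Hx) as (Hrad & Hval & HD).
    assert (HeY : e * (/ e * PSeries m (e * x)) = PSeries m (e * x)) by (field; lra).
    rewrite HeY.
    assert (HdY : is_derive (fun x => / e * PSeries m (e * x)) x (Derive (PSeries m) (e * x))).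
    { assert (Hd0 : is_derive (PSeries m) (e * x) (Derive (PSeries m) (e * x)))
        by (apply Derive_correct, ex_derive_PSeries, Hrad).
      pose proof (is_derive_comp (PSeries m) (fun x => e * x) x _ e Hd0) as Hcp.
      assert (Hlin : is_derive (fun x => e * x) x e) by (auto_derive; [exact Logic.I | ring]).
      specialize (Hcp Hlin). apply (is_derive_scal _ _ (/ e)) in Hcp.
      replace (Derive (PSeries m) (e * x)) with (/ e * scal e (Derive (PSeries m) (e * x))); [exact Hcp|].
      unfold scal; simpl. unfold mult; simpl. field. lra. }
    split; [apply Hsmall; apply Rle_trans with (2 := Hte); apply Rmult_le_compat_l; lra|].
    split; [exact Hval|]. split; [eexists; exact HdY|].
    assert (HDe : Derive (fun x : R => / e * PSeries m (e * x)) x = Derive (PSeries m) (e * x))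
      by exact (is_derive_unique _ _ _ HdY).
    rewrite HDe, <- HD. field. lra.
  - split; [apply Hrec|]. split; [apply Hrec|].
    split.
    + destruct (Hode 0) as (H0 & _); [rewrite Rabs_R0; lra|]. rewrite Rabs_R0 in H0. exact H0.
    + exists (mkposreal r (proj1 Hr)). intros x Hx.
      apply -> ball_0 in Hx. simpl in Hx. destruct (Hode x Hx) as (_ & _ & HD). rewrite <- HD. ring.
Qed.

Theorem theorem3p5 :
  forall (eps0 rho B : R) (a : R -> R) (f : R -> nat -> R)
         (h : R -> nat -> nat -> R) (K delta2 upsilon : R),
  0 < eps0 -> 0 < rho -> 0 < B ->
  analytic_family (fun _ : unit => 0%nat) eps0 (fun e _ => a e) ->
  analytic_family (fun k : nat => k) eps0 f ->
  analytic_family (fun kl : nat * nat => (fst kl + snd kl)%nat) eps0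
    (fun e kl => h e (fst kl) (snd kl)) ->
  (forall e k, 0 <= e < eps0 -> (k < 2)%nat -> f e k = 0) ->
  (forall e k l, 0 <= e < eps0 ->
     ~ ((2 <= k)%nat /\ l = 1%nat) -> ~ ((1 <= k)%nat /\ (2 <= l)%nat) ->
     h e k l = 0) ->
  (forall e k, 0 <= e < eps0 -> Rabs (f e k) <= B * / rho ^ k) ->
  (forall e k l, 0 <= e < eps0 -> Rabs (h e k l) <= / rho ^ (k + l)) ->
  (forall k, h 0 k 1%nat = 0) ->
  -2 < a 0 ->
  0 < K -> 0 < delta2 -> 0 < upsilon < K ->
  exists mu0 : R, 0 < mu0 /\
  forall mu : R, 0 <= mu < mu0 ->
  exists m0 : nat -> R,
    unique (formal_center_manifold (a 0) (f 0) (h 0) mu) m0 /\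
  exists S : R,
    is_lim_seq (fun k => (-1) ^ k * m0 k / Gamma (INR k + a 0)) S /\
    (S <> 0 ->
     exists eps1 : R, 0 < eps1 <= eps0 /\
     forall e : R, 0 < e < eps1 -> (forall n : nat, / e <> INR n) ->
     exists m : nat -> R,
       unique (weak_stable_manifold (a e) (f e) (h e) mu e) m /\
       forall I : R -> Prop,
         is_interval I ->
         (forall x, I x -> - delta2 * e <= x <= 3 / 4) ->
         (forall x, I x -> Rabs (Vbar (a e) e x) <= K) ->
         exists Y : R -> R,
           extends_over rho (a e) (f e) (h e) mu e m I Y /\
           forall x, I x ->
             Rabs (Y x - (-1) ^ Neps e * S * Vbar (a e) e x) <= upsilon).
Proof.
  intros eps0 rho B a f h K delta2 upsilon Heps0 Hrho HB Aa Af Ah Hf0 Hh0 Hfb Hhb _ Ha0 HK Hd2 Hup.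
  set (tau := / rho). assert (Htau : 0 < tau) by (apply Rinv_0_lt_compat, Hrho).
  assert (Hf : forall e, 0 <= e < eps0 -> forall k, Rabs (f e k) <= B * tau ^ k).
  { intros e He k. unfold tau. rewrite pow_inv. apply Hfb, He. }
  assert (Hh : forall e, 0 <= e < eps0 -> forall k l, Rabs (h e k l) <= tau ^ (k + l)).
  { intros e He k l. unfold tau. rewrite pow_inv. apply Hhb, He. }
  assert (Hhm : forall e, 0 <= e < eps0 -> forall k l, Rabs (h e k l) <= hmaj tau k l).
  { intros e He k l. pose proof (Hh e He k l) as H1. pose proof (Hh0 e k l He) as H2.
    destruct k as [|[|k]], l as [|[|l]]; unfold hmaj;
      try (rewrite H2 by lia; rewrite Rabs_R0; lra); exact H1. }
  assert (Hh00 : forall e, 0 <= e < eps0 -> forall l, h e 0%nat l = 0) by (intros e He l; apply Hh0; [exact He | lia | lia]).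
  assert (Hh10 : forall e, 0 <= e < eps0 -> h e 1%nat 0%nat = 0) by (intros e He; apply Hh0; [exact He | lia | lia]).
  assert (Hh11 : forall e, 0 <= e < eps0 -> h e 1%nat 1%nat = 0) by (intros e He; apply Hh0; [exact He | lia | lia]).
  assert (Hf01 : forall e, 0 <= e < eps0 -> f e 0%nat = 0 /\ f e 1%nat = 0) by (intros e He; split; apply Hf0; auto; lia).
  assert (H00 : 0 <= 0 < eps0) by lra.
  pose proof small_nonresonant_filter as FF.
  set (F := small_nonresonant) in *.
  assert (HFle : filter_le F (at_right 0)).
  { apply filter_le_within. }
  assert (La : filterlim a F (locally (a 0))).
  { apply (filterlim_filter_le_1 _ HFle). exact (analytic_family_lim _ eps0 _ tt Heps0 Aa). }
  assert (Lf : forall k, filterlim (fun e => f e k) F (locally (f 0 k))).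
  { intros k. apply (filterlim_filter_le_1 _ HFle). exact (analytic_family_lim _ eps0 _ k Heps0 Af). }
  assert (Lh : forall k l, filterlim (fun e => h e k l) F (locally (h 0 k l))).
  { intros k l. apply (filterlim_filter_le_1 _ HFle). exact (analytic_family_lim _ eps0 _ (k, l) Heps0 Ah). }
  assert (Lid : filterlim (fun e : R => e) F (locally 0)).
  { apply (filterlim_filter_le_1 _ HFle). intros P HP. revert HP. apply filter_le_within. }
  assert (HhF : F (fun e => forall l, h e 0%nat l = 0)).
  { apply (small_nonresonant_intro _ eps0 Heps0). intros e He _ l. apply Hh00. lra. }
  set (c0 := Rmin 1 ((a 0 + 2) / 2)).
  assert (Hc0 : 0 < c0 <= 1) by (split; [apply Rmin_pos; lra | apply Rmin_l]).
  assert (Hc0a : c0 - 2 < a 0) by (pose proof (Rmin_r 1 ((a 0 + 2) / 2)); unfold c0; lra).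
  destruct (nfloor_ex (Rabs (a 0) + 1)) as [nA HnA]; [pose proof (Rabs_pos (a 0)); lra|].
  set (A := S nA).
  assert (HA : 1 <= INR A) by (unfold A; rewrite S_INR; pose proof (pos_INR nA); lra).
  assert (HaA : a 0 < INR A) by (unfold A; rewrite S_INR; pose proof (Rle_abs (a 0)); lra).
  set (ga := weight (a 0) 0 2).
  assert (Hne0 : forall n, 1 - 0 * INR (S n) <> 0) by (intros n; rewrite Rmult_0_l; lra).
  assert (Hgr0 : growth 0 (a 0) (weight (a 0) 0)) by (apply weight_growth; assumption).
  assert (Hga : 0 < ga) by (apply Hgr0; lia).
  set (g0 := ga / 2). set (g1 := 2 * ga).
  assert (Hg01 : 0 < g0 <= g1) by (unfold g0, g1; lra).
  assert (HT0 : tame c0 (INR A) g0 g1 0 (a 0) (weight (a 0) 0)).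
  { split; [lra|]. split; [lra|]. split; [exact Hgr0|]. fold ga. unfold g0, g1; lra. }
  assert (HTF : F (fun e => tame c0 (INR A) g0 g1 e (a e) (weight (a e) e))).
  { pose proof (filterlim_between F a (a 0) (c0 - 2) (INR A) La ltac:(lra)) as E1.
    pose proof (filterlim_between F _ _ (ga / 2) (2 * ga) (lim_weight F a La Lid Ha0 2) ltac:(fold ga; lra)) as E2.
    assert (E3 : F (fun e => 0 < e < 1 / 4 /\ nonresonant e)).
    { apply (small_nonresonant_intro _ (1 / 4)); [lra|]. intros e He Hn. split; [lra | exact Hn]. }
    generalize (filter_and _ _ E1 (filter_and _ _ E2 E3)). apply filter_imp.
    intros e (B1 & B2 & B3 & B4). split; [lra|]. split; [lra|]. split.
    - apply weight_growth; [lra | apply nonresonant_neq; [lra | exact B4]].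
    - unfold g0, g1. lra. }
  destruct (low_bound c0 (INR A) g0 g1 tau B Hc0 HA (proj1 Hg01) Htau HB)
    as (C0 & mu1 & beta & HC0 & Hmu1 & Hb0 & Hbs & Hlow).
  exists (Rmin mu1 1). split; [apply Rmin_pos; lra|]. intros mu Hmu.
  pose proof (Rmin_l mu1 1) as Hm1. pose proof (Rmin_r mu1 1) as Hm2.
  set (sol := fun e => solution e (a e) (f e) (h e) mu).
  assert (Hsol : forall e, 0 <= e < eps0 -> (forall n, 1 - e * INR (S n) <> 0) ->
     recursion e (a e) (f e) (h e) mu (sol e)).
  { intros e He Hne. apply solution_recursion; [apply Hh00, He | exact Hne]. }
  exists (sol 0). split.
  { split.
    - apply (formal_recursion 0 (a 0) (f 0) (h 0) mu (Hh00 0 H00) (Hf01 0 H00) (Hh10 0 H00) (Hh11 0 H00) (sol 0) eq_refl).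
      apply Hsol; assumption.
    - intros m' Hm'.
      apply (formal_recursion 0 (a 0) (f 0) (h 0) mu (Hh00 0 H00) (Hf01 0 H00) (Hh10 0 H00) (Hh11 0 H00) m' eq_refl) in Hm'.
      apply (recursion_unique 0 (a 0) (f 0) (h 0) mu (Hh00 0 H00) _ _ Hne0); [apply Hsol; assumption | exact Hm']. }
  set (inc := fun e => increment e (f e) (h e) mu (weight (a e) e) (sol e)).
  assert (Hlow0 := Hlow 0 (a 0) (weight (a 0) 0) (f 0) (h 0) mu (sol 0) HT0 ltac:(lra) (Hf 0 H00) (Hhm 0 H00) (Hsol 0 H00 Hne0)).
  assert (Hinc0 : forall k, Rabs (inc 0 k) <= beta k) by (intros k; apply Hlow0; lra).
  assert (Hex : ex_series (inc 0)).
  { apply ex_series_Rabs. apply nonneg_ex_series with (Series beta); [intros; apply Rabs_pos|].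
    intros n. apply Rle_trans with (2 := series_tail beta n Hb0 Hbs). apply sum_Rle. intros; apply Hinc0. }
  set (S := Series (inc 0)).
  assert (HSlim : is_lim_seq (sum_f_R0 (inc 0)) S).
  { apply is_lim_seq_ext with (2 := Series_correct _ Hex). intros k. apply sum_n_Reals. }
  exists S. split.
  { apply (is_lim_seq_ext_loc (sum_f_R0 (inc 0))); [|exact HSlim].
    exists 2%nat. intros k Hk. destruct (Hlow0 k ltac:(lra)) as (_ & E & _). rewrite E.
    rewrite weight_eq, den_0 by exact Hk. fold (inc 0).
    assert (HG : 0 < Gamma (INR k + a 0)).
    { apply Gamma_pos. apply le_INR in Hk. simpl in Hk. lra. }
    pose proof (pow_m1_sqr k) as Hs.
    transitivity ((-1) ^ k * (-1) ^ k * sum_f_R0 (inc 0) k); [rewrite Hs; ring | field; lra]. }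
  intros _.
  assert (HSF : filterlim (fun e => sum_f_R0 (inc e) (Neps e)) F (locally S)).
  { apply (filterlim_ext (fun e => sum_f_R0 (fun j => inc e j - inc 0 j) (Neps e) + sum_f_R0 (inc 0) (Neps e))).
    { intros e. rewrite <- plus_sum. apply sum_eq. intros; ring. }
    replace S with (0 + S) by ring. apply lim_plus; [exact FF | |].
    - apply tannery with (beta := fun j => 2 * beta j).
      + exact FF.
      + intros j.
        assert (HL : filterlim (fun e => inc e j + - inc 0 j) F (locally (inc 0 j + - inc 0 j))).
        { apply lim_plus; [exact FF | | apply lim_const; exact FF].
          apply (lim_increment F a f h mu La Lf Lh Lid (Hh00 0 H00) HhF Ha0). }
        rewrite Rplus_opp_r in HL. exact HL.
      + destruct Hbs as [l Hl]. exists (2 * l). apply (is_series_scal_l 2 beta l Hl).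
      + intros j. specialize (Hb0 j). lra.
      + assert (E3 : F (fun e => 0 < e < eps0 /\ nonresonant e)).
        { apply (small_nonresonant_intro _ eps0 Heps0). intros e He Hn. split; assumption. }
        generalize (filter_and _ _ HTF E3). apply filter_imp. intros e (HT & He & Hn) j Hj.
        assert (He' : 0 <= e < eps0) by lra.
        assert (Hej : e * INR j < 1).
        { apply (low_le _ _ _ _ _ _ _ HT) with (Neps e); [exact Hj | apply Neps_spec; [lra | exact Hn]]. }
        pose proof (Hlow e (a e) (weight (a e) e) (f e) (h e) mu (sol e) HT ltac:(lra) (Hf e He') (Hhm e He')
          (Hsol e He' (nonresonant_neq e (proj1 He) Hn)) j Hej) as (B1 & _).
        specialize (Hinc0 j). fold (inc e) in B1.
        apply Rle_trans with (1 := Rabs_triang _ _). rewrite Rabs_Ropp. lra.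
    - apply (filterlim_comp _ _ _ Neps (sum_f_R0 (inc 0)) F eventually (locally S) filterlim_Neps).
      exact HSlim. }
  destruct (negative_side c0 (INR A) g0 g1 delta2 Hc0 HA (proj1 Hg01) Hd2) as (C3 & e3 & HC3 & He3 & Hneg).
  destruct (radius_choice c0 g0 g1 A Hc0 Hg01) as (C5 & C9 & e2 & HC5 & HC9 & He2 & Hrad).
  destruct (W_geom c0 (INR A) g0 g1 Hc0 (proj1 Hg01) (1 + 2 * tau) ltac:(lra)) as (CW & HCW & HWg).
  (* bounds the tail at |e x| over e, for x of either sign in I *)
  set (K1 := K + C3 * (K + 1)).
  assert (HC3K : 0 < C3 * (K + 1)) by (apply Rmult_lt_0_compat; lra).
  assert (HK1 : 0 < K1) by (unfold K1; lra).
  destruct (high_order c0 (INR A) g0 g1 tau B C0 (2 * K1) C5 C9 CW Hc0 Htau HB HC0 ltac:(lra) HC5 HC9 HCW)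
    as (C6 & C10 & e1 & HC6 & HC10 & He1 & Hhigh).
  assert (HupK : 0 < upsilon / (2 * K)) by (apply Rdiv_lt_0_compat; lra).
  pose proof (filterlim_between F _ S (S - upsilon / (2 * K)) (S + upsilon / (2 * K)) HSF ltac:(lra)) as HSN.
  destruct (small_nonresonant_elim _ (filter_and _ _ HTF HSN)) as (d & Hd & Hgood).
  set (e4 := Rmin (Rmin (Rmin e1 e2) (Rmin e3 eps0)) (Rmin (Rmin d (upsilon / (2 * C10))) (3 / (4 * delta2)))).
  assert (He4 : 0 < e4).
  { unfold e4. repeat apply Rmin_pos; try lra; apply Rdiv_lt_0_compat; lra. }
  assert (He4s : e4 <= e1 /\ e4 <= e2 /\ e4 <= e3 /\ e4 <= eps0 /\ e4 <= d /\ e4 <= upsilon / (2 * C10) /\ e4 <= 3 / (4 * delta2)).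
  { set (x1 := Rmin e1 e2) in e4. set (x2 := Rmin e3 eps0) in e4.
    set (x3 := Rmin d (upsilon / (2 * C10))) in e4. set (x4 := 3 / (4 * delta2)) in *.
    pose proof (Rmin_l (Rmin x1 x2) (Rmin x3 x4)) as L1. pose proof (Rmin_r (Rmin x1 x2) (Rmin x3 x4)) as L2.
    fold e4 in L1, L2.
    pose proof (Rmin_l x1 x2). pose proof (Rmin_r x1 x2). pose proof (Rmin_l x3 x4). pose proof (Rmin_r x3 x4).
    pose proof (Rmin_l e1 e2). pose proof (Rmin_r e1 e2). pose proof (Rmin_l e3 eps0). pose proof (Rmin_r e3 eps0).
    pose proof (Rmin_l d (upsilon / (2 * C10))). pose proof (Rmin_r d (upsilon / (2 * C10))).
    unfold x1, x2, x3 in *. repeat split; lra. }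
  exists e4. split; [lra|]. intros e He Hn.
  destruct (Hgood e ltac:(lra) Hn) as [HT HSNe].
  assert (He' : 0 <= e < eps0) by lra.
  pose proof (nonresonant_neq e (proj1 He) Hn) as Hne.
  pose proof (Neps_spec e (proj1 He) Hn) as HN.
  set (N := Neps e) in *. set (W := weight (a e) e) in *.
  pose proof (N_large e N ltac:(lra) HN) as HNl.
  pose proof (Hsol e He' Hne) as Hrec.
  pose proof (Hlow e (a e) W (f e) (h e) mu (sol e) HT ltac:(lra) (Hf e He') (Hhm e He') Hrec) as Hlowe.
  assert (HlowN : forall k, (k <= N)%nat -> e * INR k < 1).
  { intros k Hk. apply (low_le _ _ _ _ _ _ _ HT) with N; [exact Hk | apply HN]. }
  assert (HgrW : growth e (a e) W) by apply HT.
  assert (HWN : 0 < W N) by (apply HgrW; lia).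
  set (s := (-1) ^ N * sum_f_R0 (inc e) N).
  destruct (Hlowe N (HlowN N (le_n _))) as (_ & HmN & HmNb).
  change (sol e N = (-1) ^ N * W N * sum_f_R0 (inc e) N) in HmN.
  assert (HmN' : sol e N = s * W N) by (rewrite HmN; unfold s; ring).
  assert (Hs : Rabs s <= C0).
  { rewrite HmN', Rabs_mult, (Rabs_pos_eq (W N)) in HmNb by lra. apply Rmult_le_reg_r with (W N); assumption. }
  destruct (Hrad e (a e) W N HT ltac:(lra) HN) as (Hlast & Y & HY & HPY & HYN).
  assert (HWNg : (2 * tau) ^ N <= CW * W N).
  { apply Rle_trans with ((1 + 2 * tau) ^ N); [apply pow_incr; lra|].
    apply (HWg e (a e) W N HT); [lia | apply HN]. }
  assert (Hmain : forall T : R -> Prop,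
     (forall t, T t -> 0 <= t <= 3 / 4 * e /\ PSeries (tail N W) t <= e * K1) ->
     exists r, 0 < r <= 4 / 5 * e /\ (forall t, T t -> t < r) /\
       tau * e <= 1 / 4 /\ tau * (C6 * e) <= 1 / 4 /\ abs_bounded (sol e) r (C6 * e) /\
       forall X, Rabs X <= r -> Rabs (PSeries (sol e) X - s * PSeries (tail N W) X) <= C10 * e ^ 2).
  { intros T HTT. destruct (radius_beyond e (a e) W N K1 T (proj1 He) HgrW ltac:(lia) HK1 HTT) as (r & Hr & HTr & HVr).
    exists r. split; [exact Hr|]. split; [exact HTr|].
    apply (Hhigh e (a e) W (f e) (h e) mu (sol e) N s r Y); auto; try lra; try lia.
    intros k Hk. apply Hlowe, HlowN. lia. }
  exists (sol e). split.
  { destruct (Hmain (fun _ => False)) as (r & Hr & _ & Q1 & Q2 & Q3 & _); [intros t []|].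
    split.
    - apply (scaled_solution_extends rho (a e) (f e) (h e) mu e (sol e) r (C6 * e) (fun _ => False) tau B);
        auto; try lra. intros x [].
    - intros m' Hm'.
      apply (weak_stable_recursion e (a e) (f e) (h e) mu (Hh00 e He') (Hf01 e He') (Hh10 e He') (Hh11 e He')
               tau B Htau (Hf e He') (Hh e He')) in Hm'.
      apply (recursion_unique e (a e) (f e) (h e) mu (Hh00 e He') _ _ Hne Hrec Hm'). }
  intros I _ HI HIV.
  assert (HVt : forall x, PSeries (tail N W) (e * x) = e * Vbar (a e) e x).
  { intros x. rewrite Vbar_tail; [|lra | exact Hn | fold N; lia]. fold N W. field. lra. }
  assert (Hde : delta2 * e <= 3 / 4).
  { apply Rle_trans with (delta2 * (3 / (4 * delta2))); [apply Rmult_le_compat_l; lra | right; field; lra]. }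
  destruct (Hmain (fun t => exists x, I x /\ t = Rabs (e * x))) as (r & Hr & HTr & Q1 & Q2 & Q3 & Q4).
  { intros t (x & Hx & ->). destruct (HI x Hx) as [X1 X2]. specialize (HIV x Hx).
    rewrite Rabs_mult, (Rabs_pos_eq e) by lra. split.
    - split; [apply Rmult_le_pos; [lra | apply Rabs_pos]|].
      rewrite Rmult_comm. apply Rmult_le_compat_r; [lra|]. apply Rabs_le. lra.
    - destruct (Rle_lt_dec 0 x) as [Hx0|Hx0].
      + rewrite (Rabs_pos_eq x Hx0), HVt. apply Rmult_le_compat_l; [lra|].
        pose proof (Rle_abs (Vbar (a e) e x)). unfold K1. lra.
      + rewrite (Rabs_left x Hx0).
        assert (Hsx : 0 <= e * - x <= delta2 * e ^ 2).
        { split; [apply Rmult_le_pos; lra|]. replace (delta2 * e ^ 2) with (e * (delta2 * e)) by ring.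
          apply Rmult_le_compat_l; lra. }
        apply Rle_trans with (1 := Hneg e (a e) W N (e * - x) HT ltac:(lra) ltac:(lia) HN Hlast Hsx).
        replace (- (e * - x)) with (e * x) by ring. rewrite HVt, Rabs_mult, (Rabs_pos_eq e) by lra.
        replace (e * K1) with (C3 * (e * K + e) + e * K) by (unfold K1; ring).
        assert (H1 : e * Rabs (Vbar (a e) e x) <= e * K) by (apply Rmult_le_compat_l; lra).
        assert (H2 : C3 * (e * Rabs (Vbar (a e) e x) + e) <= C3 * (e * K + e)) by (apply Rmult_le_compat_l; lra).
        assert (0 <= e * K) by (apply Rmult_le_pos; lra). lra. }
  exists (fun x => / e * PSeries (sol e) (e * x)). split.
  { apply (scaled_solution_extends rho (a e) (f e) (h e) mu e (sol e) r (C6 * e) I tau B); auto; try lra.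
    intros x Hx. apply HTr. exists x. split; [exact Hx | reflexivity]. }
  intros x Hx.
  assert (HXr : Rabs (e * x) <= r) by (left; apply HTr; exists x; split; [exact Hx | reflexivity]).
  specialize (Q4 (e * x) HXr). rewrite HVt in Q4. specialize (HIV x Hx).
  set (V := Vbar (a e) e x) in *.
  replace (/ e * PSeries (sol e) (e * x) - (-1) ^ N * S * V) with
    (/ e * (PSeries (sol e) (e * x) - s * (e * V)) + (-1) ^ N * (sum_f_R0 (inc e) N - S) * V)
    by (unfold s; field; lra).
  apply Rle_trans with (1 := Rabs_triang _ _).
  rewrite !Rabs_mult, pow_m1_abs, Rmult_1_l, (Rabs_pos_eq (/ e)) by (left; apply Rinv_0_lt_compat; lra).
  assert (HS1 : Rabs (sum_f_R0 (inc e) N - S) <= upsilon / (2 * K)) by (apply Rabs_le; lra).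
  assert (P1 : / e * Rabs (PSeries (sol e) (e * x) - s * (e * V)) <= upsilon / 2).
  { apply Rle_trans with (/ e * (C10 * e ^ 2)).
    - apply Rmult_le_compat_l; [left; apply Rinv_0_lt_compat; lra | exact Q4].
    - replace (/ e * (C10 * e ^ 2)) with (C10 * e) by (field; lra).
      apply Rle_trans with (C10 * (upsilon / (2 * C10))); [apply Rmult_le_compat_l; lra | right; field; lra]. }
  assert (P2 : Rabs (sum_f_R0 (inc e) N - S) * Rabs V <= upsilon / 2).
  { apply Rle_trans with (upsilon / (2 * K) * K); [|right; field; lra].
    apply Rmult_le_compat; auto; apply Rabs_pos. }
  lra.
Qed.
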